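(* Let $\alpha>0$ and $x_0\in\mathbb{R}$ be fixed. For $\omega\in\mathbb{R}$ and $n\in\mathbb{Z}$ let $$a_n(\omega)=\int_{-\infty}^{\infty}\mathrm{e}^{-\alpha(x-x_0)^2}\cos(\omega x)\,\overline{\varphi_n(x)}\,\mathrm{d}x,\qquad b_n(\omega)=\frac12\int_{-\infty}^{\infty}\mathrm{e}^{-\alpha(x-x_0)^2+\mathrm{i}\omega x}\,\overline{\varphi_n(x)}\,\mathrm{d}x,$$ where $\varphi_n(x)=\mathrm{i}^n\sqrt{\frac{2}{\pi}}\,\frac{(1+2\mathrm{i}x)^n}{(1-2\mathrm{i}x)^{n+1}}$ are the Malmquist--Takenaka functions. Then $$|a_n(\omega)|\le|b_n(\omega)|+|b_n(-\omega)|,$$ and the following bounds hold. (a) For all $\omega\ge0$ and all $n<0$: $\ |b_n(\omega)|\le\pi^{1/4}2^{-7/4}\alpha^{-1/4}\,\mathrm{e}^{-\omega^2/(4\alpha)}$. (b) For any given constants $\delta>0$ and $c>\tfrac14+\delta$, as $\omega\to+\infty$, uniformly for integers $n\ge0$ with $\frac14+\delta\le\frac{n}{\omega}\le c$, $$|b_n(\omega)|\le\frac{1+\mathcal{O}(\omega^{-1})}{2\sqrt{2\omega}\left(\frac{n}{\omega}-\frac14\right)^{1/4}}\left\{\exp\left(-\alpha\left(\sqrt{\frac{n}{\omega}-\frac14}-x_0\right)^2\right)+\exp\left(-\alpha\left(\sqrt{\frac{n}{\omega}-\frac14}+x_0\right)^2\right)\right\}.$$ (c) The corresponding bounds for $b_n(-\omega)$,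 $\omega\ge 0$, hold under the symmetry $n\mapsto -n-1$: for all $\omega\ge0$ and $n\ge0$ the bound in (a) holds for $|b_n(-\omega)|$; and, as $\omega\to+\infty$, uniformly for integers $n<0$ such that $m=-n-1$ satisfies $\frac14+\delta\le\frac{m}{\omega}\le c$, $|b_n(-\omega)|$ is bounded by the right-hand side in (b) with $n$ replaced by $m$.
   Context: The Malmquist--Takenaka functions $\{\varphi_n\}_{n\in\mathbb{Z}}$ form an orthonormal basis of $\mathrm{L}_2(\mathbb{R})$; $a_n(\omega)=b_n(\omega)+b_n(-\omega)$ is the $n$-th coefficient of the wave packet $f(x)=\mathrm{e}^{-\alpha(x-x_0)^2}\cos(\omega x)$. The symbol $\mathcal{O}(\omega^{-1})$ denotes a quantity bounded in absolute value by $C\omega^{-1}$ for all sufficiently large $\omega$ and all $n$ in the stated range, with $C$ and the threshold for $\omega$ depending only on $\alpha,x_0,\delta,c$. *)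

(* Defs.v *)
From mathcomp Require Export all_boot all_order all_algebra.
From mathcomp Require Export all_classical all_reals all_analysis.
From mathcomp.real_closed Require Export complex.

Set Implicit Arguments.
Unset Strict Implicit.
Unset Printing Implicit Defensive.

Import Order.TTheory GRing.Theory Num.Theory.
Import numFieldNormedType.Exports.

Local Open Scope ring_scope.
Local Open Scope complex_scope.

(* The modulus on R[i] provided by the numeric structure takes its values in
   R[i]; [cmod] is the same modulus with values in R. *)
Definition cmod (R : realType) (z : R[i]) : R := complex.Re `|z|.

Definition cexp (R : realType) (z : R[i]) : R[i] :=
  (expR (complex.Re z))%:C * (cos (complex.Im z) +i* sin (complex.Im z)).

(* Lebesgue integral over the real line of a complex-valued function, taken
   componentwise; meaningful when both components are integrable, as is the
   case for a Gaussian times a bounded continuous function. *)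
Definition cintegral (R : realType) (f : R -> R[i]) : R[i] :=
  (\int[lebesgue_measure]_x complex.Re (f x))%R
    +i* (\int[lebesgue_measure]_x complex.Im (f x))%R.

Definition malmquist_takenaka (R : realType) (n : int) (x : R) : R[i] :=
  ('i%C ^ n) * (Num.sqrt (2 / pi))%:C *
  ((1 + 2 * 'i%C * x%:C) ^ n / (1 - 2 * 'i%C * x%:C) ^ (n + 1)).

Definition coef_a (R : realType) (alpha x0 w : R) (n : int) : R[i] :=
  cintegral (fun x : R =>
    (expR (- alpha * (x - x0) ^+ 2) * cos (w * x))%:C *
    (malmquist_takenaka n x)^*%C).

Definition coef_b (R : realType) (alpha x0 w : R) (n : int) : R[i] :=
  2^-1 * cintegral (fun x : R =>
    cexp ((- alpha * (x - x0) ^+ 2)%:C + 'i%C * (w * x)%:C) *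
    (malmquist_takenaka n x)^*%C).

Definition exp_bound (R : realType) (alpha w : R) : R :=
  pi `^ (1 / 4) * 2 `^ (- (7 / 4)) * alpha `^ (- (1 / 4)) *
  expR (- (w ^+ 2 / (4 * alpha))).

(* [e] stands for the O(1/w) term *)
Definition saddle_bound (R : realType) (alpha x0 w : R) (n : int) (e : R) : R :=
  let r := n%:~R / w - 1 / 4 in
  (1 + e) / (2 * Num.sqrt (2 * w) * r `^ (1 / 4)) *
  (expR (- alpha * (Num.sqrt r - x0) ^+ 2) +
   expR (- alpha * (Num.sqrt r + x0) ^+ 2)).

(* Main.v *)
Require Import Defs.
From mathcomp Require Import ring lra measurable_realfun.

(* Every coefficient reduces to a nonnegative index: [b_(-n-1)(-w)] is the
   conjugate of [b_n(w)] up to a phase.  For [n >= 0] the integrand continues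
   analytically to [C] minus [i/2], and the line of integration can be deformed
   below that pole.

   On the side where the coefficients are exponentially small, the line is moved
   to the saddle [x0 - i w/(2 alpha)] of the Gaussian, where the coefficient
   becomes [exp (- w^2/(4 alpha))] times the integral [J] of [G g] with [G] a real
   Gaussian and [g] in the Hardy class.  Cauchy-Schwarz alone loses a factor
   [sqrt 2]; it is recovered because [\int g^2 = 0], so that the real part of
   [conj J * g] carries half of the squared norm.

   On the oscillatory side put [a = sqrt (n/w - 1/4)].  The phase is stationary at
   [x = a] and [x = - a], and the line is bent into
   [x + i s x] with [s x = 2 a (x^2 - a^2) / (x^2 + 3 a^2)].  At both stationary
   points it follows the direction of steepest descent, and [|s'| <= 1] everywhere,
   so that taking absolute values only costs a relative error [O(1/w)]: the cubic
   term of the exponent and the linear term of the amplitude are odd and have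
   vanishing Gaussian moments. *)

Set Implicit Arguments.
Unset Strict Implicit.
Unset Printing Implicit Defensive.

Import Order.TTheory GRing.Theory Num.Theory.
Import numFieldNormedType.Exports.

Local Open Scope classical_set_scope.
Local Open Scope ring_scope.

Section ComplexModulus.
Local Open Scope complex_scope.
Context {R : realType}.
Implicit Types z u v : R[i].

Lemma cmodE z : cmod z = Num.sqrt (complex.Re z ^+ 2 + complex.Im z ^+ 2).
Proof. by rewrite /cmod normc_def. Qed.

Lemma cmod_ge0 z : 0 <= cmod z.
Proof. by rewrite cmodE sqrtr_ge0. Qed.

Lemma sqr_cmod z : cmod z ^+ 2 = complex.Re z ^+ 2 + complex.Im z ^+ 2.
Proof. by rewrite cmodE sqr_sqrtr// addr_ge0// sqr_ge0. Qed.

Lemma cmodC z : (cmod z)%:C = `|z|.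
Proof. by rewrite /cmod normc_def. Qed.

Lemma cmodM u v : cmod (u * v) = cmod u * cmod v.
Proof. by apply: (@complexI R); rewrite rmorphM /= !cmodC normrM. Qed.

Lemma cmodV z : cmod z^-1 = (cmod z)^-1.
Proof. by apply: (@complexI R); rewrite fmorphV /= !cmodC normfV. Qed.

Lemma cmodX z n : cmod (z ^+ n) = cmod z ^+ n.
Proof. by apply: (@complexI R); rewrite rmorphXn /= !cmodC normrX. Qed.

Lemma ler_cmodD u v : cmod (u + v) <= cmod u + cmod v.
Proof. by rewrite -lecR rmorphD /= !cmodC ler_normD. Qed.

Lemma cmodN z : cmod (- z) = cmod z.
Proof. by apply: (@complexI R); rewrite !cmodC normrN. Qed.

Lemma cmod_real (x : R) : cmod x%:C = `|x|.
Proof. by rewrite cmodE /= expr0n /= addr0 sqrtr_sqr. Qed.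

Lemma cmod_nat n : cmod (n%:R : R[i]) = n%:R.
Proof. by apply: (@complexI R); rewrite cmodC normr_nat rmorph_nat. Qed.

Lemma cmod_conj z : cmod z^*%C = cmod z.
Proof. by case: z => a b; rewrite !cmodE /= sqrrN. Qed.

Lemma cmod0 : cmod (0 : R[i]) = 0.
Proof. by rewrite /cmod normr0. Qed.

Lemma cmod1 : cmod (1 : R[i]) = 1.
Proof. by rewrite /cmod normr1. Qed.

Lemma cmod_eq0 z : (cmod z == 0) = (z == 0).
Proof. by rewrite -(inj_eq (@complexI R)) cmodC normr_eq0. Qed.

Lemma cmodi : cmod ('i%C : R[i]) = 1.
Proof. by rewrite cmodE /= expr0n /= add0r expr1n sqrtr1. Qed.

Lemma normr_Re_le z : `|complex.Re z| <= cmod z.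
Proof.
by rewrite -sqrtr_sqr cmodE ler_wsqrtr// lerDl sqr_ge0.
Qed.

Lemma normr_Im_le z : `|complex.Im z| <= cmod z.
Proof.
by rewrite -sqrtr_sqr cmodE ler_wsqrtr// lerDr sqr_ge0.
Qed.

Lemma cmod_le_add z : cmod z <= `|complex.Re z| + `|complex.Im z|.
Proof.
rewrite -(@ler_pXn2r _ 2) ?nnegrE ?cmod_ge0 ?addr_ge0//.
rewrite sqr_cmod sqrrD !real_normK ?num_real//.
by rewrite -addrA lerD2l lerDr mulrn_wge0// mulr_ge0.
Qed.

Lemma Re_conjM u v : complex.Re (u^*%C * v) =
  complex.Re u * complex.Re v + complex.Im u * complex.Im v.
Proof. by case: u v => a b [c d] /=; rewrite mulNr opprK. Qed.

Lemma cmod_cexp z : cmod (cexp z) = expR (complex.Re z).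
Proof.
rewrite /cexp cmodM cmod_real ger0_norm ?expR_ge0// cmodE /= cos2Dsin2.
by rewrite sqrtr1 mulr1.
Qed.

Lemma conj_cexp z : (cexp z)^*%C = cexp z^*%C.
Proof.
case: z => a b; rewrite /cexp /= cosN sinN.
by apply/eqP; rewrite eq_complex /=; apply/andP; split; apply/eqP; ring.
Qed.

Lemma cmod_exprD1_le (u : R[i]) k : cmod u <= 1 ->
  cmod (u ^+ k - (-1) ^+ k) <= k%:R * cmod (u + 1).
Proof.
move=> u1; elim: k => [|k IHk]; first by rewrite !expr0 subrr cmod0 mul0r.
have -> : u ^+ k.+1 - (-1) ^+ k.+1 = u * (u ^+ k - (-1) ^+ k) + (-1) ^+ k * (u + 1).
  by rewrite !exprS; ring.
rewrite (le_trans (ler_cmodD _ _))// -natr1 mulrDl mul1r lerD//.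
  by rewrite cmodM (le_trans _ IHk)// ler_piMl ?cmod_ge0.
by rewrite cmodM cmodX cmodN cmod1 expr1n mul1r.
Qed.

End ComplexModulus.

(** * Derivatives of complex-valued functions of a real variable *)

Section PointwiseRules.
Local Open Scope complex_scope.
Context {R : realType}.
Implicit Types (f g : R -> R) (x df dg : R).

Lemma is_derive_add f g x df dg : is_derive x 1 f df -> is_derive x 1 g dg ->
  is_derive x 1 (fun t => f t + g t) (df + dg).
Proof. exact: is_deriveD. Qed.

Lemma is_derive_opp f x df : is_derive x 1 f df ->
  is_derive x 1 (fun t => - f t) (- df).
Proof. exact: is_deriveN. Qed.

Lemma is_derive_sub f g x df dg : is_derive x 1 f df -> is_derive x 1 g dg ->
  is_derive x 1 (fun t => f t - g t) (df - dg).
Proof. exact: is_deriveB. Qed.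

Lemma is_derive_mul f g x df dg : is_derive x 1 f df -> is_derive x 1 g dg ->
  is_derive x 1 (fun t => f t * g t) (df * g x + f x * dg).
Proof.
move=> fdf gdg; have H := is_deriveM fdf gdg.
rewrite (_ : df * _ + _ = f x *: dg + g x *: df)//.
by rewrite addrC [df * _]mulrC.
Qed.

Lemma is_derive_scale k f x df : is_derive x 1 f df ->
  is_derive x 1 (fun t => k * f t) (k * df).
Proof. exact: is_deriveZ. Qed.

Lemma is_derive_exprn f x df n : is_derive x 1 f df ->
  is_derive x 1 (fun t => f t ^+ n) (n%:R * f x ^+ n.-1 * df).
Proof. by move=> /(is_deriveX n); rewrite exprfctE. Qed.

Lemma is_derive_inv f x df : f x != 0 -> is_derive x 1 f df ->
  is_derive x 1 (fun t => (f t)^-1) (- df / f x ^+ 2).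
Proof.
move=> fx0 fdf; have := is_deriveV fx0 fdf.
by rewrite /GRing.scale /= mulNr mulrC mulNr.
Qed.

Lemma is_derive_congr f x df df' : is_derive x 1 f df -> df = df' ->
  is_derive x 1 f df'.
Proof. by move=> ? <-. Qed.

Lemma is_derive_ext f g x df : f =1 g -> is_derive x 1 f df ->
  is_derive x 1 g df.
Proof. by move=> /funext ->. Qed.

End PointwiseRules.

Section RealVariableDerivative.
Local Open Scope complex_scope.
Context {R : realType}.
Implicit Types (F G : R -> R[i]) (x : R).

Definition is_cderive F x (d : R[i]) :=
  is_derive x 1 (fun t => complex.Re (F t)) (complex.Re d) /\
  is_derive x 1 (fun t => complex.Im (F t)) (complex.Im d).

Lemma is_cderive_eq F x d d' : is_cderive F x d -> d = d' -> is_cderive F x d'.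
Proof. by move=> ? <-. Qed.

Lemma is_cderive_cst c x : is_cderive (fun=> c) x 0.
Proof. by split; exact: is_derive_cst. Qed.

Lemma ReD (u v : R[i]) : complex.Re (u + v) = complex.Re u + complex.Re v.
Proof. by case: u v => a b [c d]. Qed.

Lemma ImD (u v : R[i]) : complex.Im (u + v) = complex.Im u + complex.Im v.
Proof. by case: u v => a b [c d]. Qed.

Lemma ReN (u : R[i]) : complex.Re (- u) = - complex.Re u.
Proof. by case: u. Qed.

Lemma ImN (u : R[i]) : complex.Im (- u) = - complex.Im u.
Proof. by case: u. Qed.

Lemma Re_mul (u v : R[i]) : complex.Re (u * v) =
  complex.Re u * complex.Re v - complex.Im u * complex.Im v.
Proof. by case: u v => a b [c d]. Qed.

Lemma Im_mul (u v : R[i]) : complex.Im (u * v) =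
  complex.Re u * complex.Im v + complex.Im u * complex.Re v.
Proof. by case: u v => a b [c d]. Qed.

Lemma Re_inv (z : R[i]) : complex.Re z^-1 =
  complex.Re z / (complex.Re z ^+ 2 + complex.Im z ^+ 2).
Proof. by case: z. Qed.

Lemma Im_inv (z : R[i]) : complex.Im z^-1 =
  - complex.Im z / (complex.Re z ^+ 2 + complex.Im z ^+ 2).
Proof. by case: z => a b /=; rewrite mulNr. Qed.

Lemma is_cderiveD F G x dF dG : is_cderive F x dF -> is_cderive G x dG ->
  is_cderive (fun t => F t + G t) x (dF + dG).
Proof.
move=> [F1 F2] [G1 G2]; rewrite /is_cderive ReD ImD; split.
  by apply: is_derive_ext (is_derive_add F1 G1) => t; rewrite ReD.
by apply: is_derive_ext (is_derive_add F2 G2) => t; rewrite ImD.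
Qed.

Lemma is_cderiveM F G x dF dG : is_cderive F x dF -> is_cderive G x dG ->
  is_cderive (fun t => F t * G t) x (dF * G x + F x * dG).
Proof.
move=> [F1 F2] [G1 G2]; rewrite /is_cderive ReD ImD !Re_mul !Im_mul; split.
  have H := is_derive_sub (is_derive_mul F1 G1) (is_derive_mul F2 G2).
  apply: (is_derive_ext _ (is_derive_congr H _)); last first.
    by ring.
  by move=> t; rewrite Re_mul.
have H := is_derive_add (is_derive_mul F1 G2) (is_derive_mul F2 G1).
apply: (is_derive_ext _ (is_derive_congr H _)); last first.
  by ring.
by move=> t; rewrite Im_mul.
Qed.

Lemma is_cderiveMl c F x dF : is_cderive F x dF ->
  is_cderive (fun t => c * F t) x (c * dF).
Proof.
move=> FdF; apply: is_cderive_eq.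
  by apply: is_cderiveM FdF; exact: is_cderive_cst.
by rewrite mul0r add0r.
Qed.

Lemma is_cderiveN F x dF : is_cderive F x dF ->
  is_cderive (fun t => - F t) x (- dF).
Proof.
move=> /(is_cderiveMl (-1)); rewrite mulN1r.
by under eq_fun do rewrite mulN1r.
Qed.

Lemma is_cderiveB F G x dF dG : is_cderive F x dF -> is_cderive G x dG ->
  is_cderive (fun t => F t - G t) x (dF - dG).
Proof. by move=> FdF /is_cderiveN; exact: is_cderiveD. Qed.

Lemma is_cderiveX F x dF n : is_cderive F x dF ->
  is_cderive (fun t => F t ^+ n) x (n%:R * F x ^+ n.-1 * dF).
Proof.
move=> FdF; elim: n => [|n IHn].
  rewrite !mul0r; under eq_fun do rewrite expr0.
  exact: is_cderive_cst.
under eq_fun do rewrite exprS.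
apply: is_cderive_eq; first exact: is_cderiveM FdF IHn.
case: n {IHn} => [|n] /=; first by rewrite !mul0r mulr0 addr0 !expr0; ring.
by rewrite -[n.+2]addn1 natrD exprS; ring.
Qed.

Lemma is_cderiveV F x dF : F x != 0 -> is_cderive F x dF ->
  is_cderive (fun t => (F t)^-1) x (- dF * (F x)^-1 ^+ 2).
Proof.
move=> Fx0 [F1 F2].
have := is_derive_add (is_derive_exprn 2 F1) (is_derive_exprn 2 F2).
set N := (N in is_derive x 1 N _) => dN.
have Nx0 : N x != 0 by rewrite /N -sqr_cmod expf_neq0// cmod_eq0.
have dNV := is_derive_inv Nx0 dN.
have E : (N x)^-1 = (complex.Re (F x) ^+ 2 + complex.Im (F x) ^+ 2) / N x ^+ 2.
  by rewrite -/(N x) expr2 invfM mulrA mulfV// mul1r.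
split.
  have H := is_derive_mul F1 dNV.
  apply: (is_derive_ext _ (is_derive_congr H _)); last first.
    rewrite expr2 !(Re_mul, Im_mul, ReN, ImN, Re_inv, Im_inv) -/(N x).
    have -> : complex.Re dF / N x = complex.Re dF *
      ((complex.Re (F x) ^+ 2 + complex.Im (F x) ^+ 2) / N x ^+ 2) by rewrite -E.
    by rewrite /= expr1 expr2 invfM; ring.
  by move=> t; rewrite Re_inv.
have H := is_derive_mul (is_derive_opp F2) dNV.
apply: (is_derive_ext _ (is_derive_congr H _)); last first.
  rewrite expr2 !(Re_mul, Im_mul, ReN, ImN, Re_inv, Im_inv) -/(N x).
  have -> : - complex.Im dF / N x = - complex.Im dF *
    ((complex.Re (F x) ^+ 2 + complex.Im (F x) ^+ 2) / N x ^+ 2) by rewrite -E.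
  by rewrite /= expr1 expr2 invfM; ring.
by move=> t; rewrite Im_inv.
Qed.

Lemma is_cderive_cexp F x dF : is_cderive F x dF ->
  is_cderive (fun t => cexp (F t)) x (cexp (F x) * dF).
Proof.
move=> [F1 F2].
have e1 := is_derive1_comp (is_derive_expR (complex.Re (F x))) F1.
have c1 := is_derive1_comp (is_derive_cos (complex.Im (F x))) F2.
have s1 := is_derive1_comp (is_derive_sin (complex.Im (F x))) F2.
split.
  have H := is_derive_mul e1 c1.
  apply: (is_derive_ext _ (is_derive_congr H _)); last first.
    by rewrite /cexp !Re_mul !Im_mul /=; ring.
  by move=> t; rewrite /cexp Re_mul /= mul0r subr0.
have H := is_derive_mul e1 s1.
apply: (is_derive_ext _ (is_derive_congr H _)); last first.
  by rewrite /cexp !Im_mul !Re_mul /=; ring.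
by move=> t; rewrite /cexp Im_mul /= mul0r addr0.
Qed.

End RealVariableDerivative.

Local Notation lintegrable f := (lebesgue_measure.-integrable setT (EFin \o f)).

(** * Integrals over the real line *)

Section RealIntegrals.
Local Open Scope complex_scope.
Context {R : realType}.
Notation mu := (@lebesgue_measure R).
Implicit Types (f g F : R -> R).

Lemma continuous_lintegrable f g : continuous f -> (forall x, `|f x| <= g x) ->
  lintegrable g -> lintegrable f.
Proof.
move=> cf fg; apply: le_integrable => //.
  by apply/measurable_EFinP; exact: continuous_measurable_fun.
by move=> x _ /=; rewrite lee_fin (le_trans (fg x))// ler_norm.
Qed.

Lemma is_derive_continuous F f : (forall x : R, is_derive x 1 F (f x)) ->
  continuous F.
Proof.
by move=> dF x; apply/differentiable_continuous/derivable1_diffP; case: (dF x).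
Qed.

Lemma lintegrableD f g : lintegrable f -> lintegrable g ->
  lintegrable (fun x => f x + g x).
Proof. by move=> If Ig; exact: (integrableD measurableT If Ig). Qed.

Lemma lintegrableZ k f : lintegrable f -> lintegrable (fun x => k * f x).
Proof. by move=> If; exact: (integrableZl measurableT k If). Qed.

Lemma Rintegral_FTC_line F f (L : R) :
  (forall x : R, is_derive x 1 F (f x)) -> continuous f -> lintegrable f ->
  (fun n : nat => F n%:R - F (- n%:R)) @ \oo --> L ->
  (\int[mu]_x f x = L)%R.
Proof.
move=> dF cf If FL.
pose f_ n := (f \_ `[- n%:R, n%:R] : R -> R).
have f_E n : (\int[mu]_x f_ n x = F n%:R - F (- n%:R))%R.
  rewrite /f_ -Rintegral_mkcond.
  case: n => [|n]; first by rewrite oppr0 set_itv1 Rintegral_set1 subrr.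
  rewrite /Rintegral (@continuous_FTC2 _ f F)//.
  - by rewrite (@lt_le_trans _ _ 0)// oppr_lt0 ltr0Sn.
  - exact: continuous_subspaceT.
  - split.
    + by move=> x _; case: (dF x).
    + exact/cvg_at_right_filter/(is_derive_continuous dF).
    + exact/cvg_at_left_filter/(is_derive_continuous dF).
  - by move=> x _; rewrite derive1E; exact: derive_val.
have mf : measurable_fun setT f by exact: continuous_measurable_fun.
suff : (fun n => \int[mu]_x f_ n x)%R @ \oo --> (\int[mu]_x f x)%R.
  under eq_fun do rewrite f_E.
  by move=> H; apply: (cvg_unique _ H FL).
apply: fine_cvg; rewrite fineK; last exact: integrable_fin_num.
apply: (@dominated_cvg _ _ _ mu setT measurableT (fun n x => (f_ n x)%:E)
   (EFin \o f) (fun x => `|f x|%:E)) => //.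
- move=> n; apply/measurable_EFinP.
  by apply/(measurable_restrictT f (measurable_itv _))/measurable_funTS.
- move=> x _; apply: cvg_EFin; first exact: nearW.
  apply: cvg_near_cst; near=> n => /=.
  rewrite /f_ patchE mem_set//= in_itv /= -ler_norml.
  by near: n; exact: nbhs_infty_ger.
- exact: integrable_norm.
- move=> n x _; rewrite lee_fin /f_ patchE; case: ifP => // _.
  by rewrite normr0.
Unshelve. all: by end_near. Qed.

Lemma Rintegral_derive_decay F f (K : R) :
  (forall x : R, is_derive x 1 F (f x)) -> continuous f -> lintegrable f ->
  (forall x, `|F x| * `|x| <= K) -> (\int[mu]_x f x = 0)%R.
Proof.
move=> dF cf If FK; apply: (Rintegral_FTC_line dF cf If).
have lim0 (s : R) : `|s| = 1 -> (fun n : nat => F (s * n%:R)) @ \oo --> (0 : R).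
  move=> s1; apply/cvgr0Pnorm_le => e e0; near=> n.
  have n0 : 0 < n%:R :> R by rewrite ltr0n; near: n; exact: nbhs_infty_gt.
  have ns : `|s * n%:R| = n%:R.
    by rewrite normrM s1 mul1r gtr0_norm.
  have := FK (s * n%:R); rewrite ns -ler_pdivlMr// => /le_trans; apply.
  rewrite ler_pdivrMr// mulrC -ler_pdivrMr//.
  by near: n; exact: nbhs_infty_ger.
rewrite -[X in _ --> X](subr0 0); apply: cvgB.
  by under eq_fun do rewrite -[_%:R]mul1r; apply: lim0; rewrite normr1.
by under eq_fun do rewrite -mulN1r; apply: lim0; rewrite normrN1.
Unshelve. all: by end_near. Qed.

End RealIntegrals.

Section Gaussians.
Local Open Scope complex_scope.
Context {R : realType}.
Notation mu := (@lebesgue_measure R).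

Lemma expr_expR_bounded (b : R) k : 0 < b ->
  exists2 C, 0 <= C & forall v, 0 <= v -> v ^+ k * expR (- (b * v)) <= C.
Proof.
move=> b0; exists ((k.+1%:R / b) ^+ k); first by rewrite exprn_ge0// divr_ge0// ltW.
move=> v v0; have k0 : 0 < k.+1%:R :> R by rewrite ltr0Sn.
set E := expR (b * v / k.+1%:R).
have E1 : 1 <= E by rewrite -[leLHS]expR0 ler_expR divr_ge0// mulr_ge0// ltW.
have vE : v <= k.+1%:R / b * E.
  have : b * v / k.+1%:R <= E by rewrite (le_trans _ (expR_ge1Dx _))// lerDr.
  move=> H; rewrite (_ : v = k.+1%:R / b * (b * v / k.+1%:R)).
    by rewrite ler_wpM2l// divr_ge0// ltW.
  by field; rewrite ?gt_eqF.
rewrite expRN ler_pdivrMr ?expR_gt0//.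
have -> : expR (b * v) = E ^+ k.+1.
  rewrite /E -expRM_natl; congr expR; field.
  by rewrite -natr1 addrC in k0 *; rewrite gt_eqF.
apply: (le_trans (y := (k.+1%:R / b * E) ^+ k)).
- by rewrite lerXn2r// nnegrE// (le_trans _ vE).
- by rewrite exprMn ler_wpM2l ?ler_weXn2l// exprn_ge0// divr_ge0// ltW.
Qed.

Lemma gauss_moment (b : R) k : 0 < b -> exists2 C, 0 <= C &
  forall y : R, `|y| ^+ k * expR (- b * y ^+ 2) <= C * expR (- (b / 2) * y ^+ 2).
Proof.
move=> b0; have b20 : 0 < b / 2 by rewrite divr_gt0.
have [C C0 HC] := expr_expR_bounded k b20.
exists (1 + C); first by rewrite addr_ge0.
move=> y; rewrite (_ : - b * y ^+ 2 = - (b / 2 * y ^+ 2) + - (b / 2) * y ^+ 2); last by lra.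
rewrite expRD mulrA ler_wpM2r ?expR_ge0//.
have y2 := sqr_ge0 y; have [y1|y1] := lerP `|y| 1.
  have E1 : `|y| ^+ k * expR (- (b / 2 * y ^+ 2)) <= 1.
    apply: mulr_ile1; [exact: exprn_ge0|exact: expR_ge0|exact: exprn_ile1|].
    by rewrite -[leRHS]expR0 ler_expR oppr_le0 mulr_ge0// ltW.
  by rewrite (le_trans E1)// lerDl.
rewrite (le_trans _ (le_trans (HC _ y2) _))// ?lerDr//.
rewrite ler_wpM2r ?expR_ge0// -[y ^+ 2]real_normK ?num_real// -exprM.
by rewrite ler_weXn2l// ?leq_pmull// ltW.
Qed.

Lemma is_derive_gauss (b m x : R) :
  is_derive x 1 (fun x => expR (- b * (x - m) ^+ 2))
    (expR (- b * (x - m) ^+ 2) * (- b * (2%:R * (x - m) ^+ 1 * (1 - 0)))).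
Proof.
apply: is_derive1_comp; apply: is_derive_scale.
by apply: is_derive_exprn; apply: is_derive_sub.
Qed.

Lemma continuous_gauss (b m : R) : continuous (fun x => expR (- b * (x - m) ^+ 2)).
Proof. by apply: is_derive_continuous => x; exact: is_derive_gauss. Qed.

Lemma continuous_exprB (m : R) k : continuous (fun x => (x - m) ^+ k).
Proof.
apply: (is_derive_continuous (f := fun x => k%:R * (x - m) ^+ k.-1 * (1 - 0))) => x.
by apply: is_derive_exprn; apply: is_derive_sub.
Qed.

Section fixed_gauss.
Local Open Scope complex_scope.
Variables (b m : R).
Hypothesis b0 : 0 < b.

Let sigma := Num.sqrt (b *+ 2)^-1.

Let sigma0 : sigma != 0.
Proof. by rewrite gt_eqF// sqrtr_gt0 invr_gt0 mulrn_wgt0. Qed.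

Let gaussE : (fun x => expR (- b * (x - m) ^+ 2)) =
  (fun x => Num.sqrt (pi / b) * normal_pdf m sigma x).
Proof.
have s2 : sigma ^+ 2 *+ 2 = b^-1.
  rewrite sqr_sqrtr ?invr_ge0 ?mulrn_wge0// ?ltW//.
  by rewrite -[LHS]mulr_natr -[b *+ 2]mulr_natr invfM -mulrA mulVf ?mulr1 ?pnatr_eq0.
apply/funext => x; rewrite normal_pdfE// /normal_peak /normal_fun s2.
have pb0 : Num.sqrt (pi / b) != 0 by rewrite gt_eqF// sqrtr_gt0 divr_gt0 ?pi_gt0.
rewrite -mulrnAl s2 [b^-1 * pi]mulrC [RHS]mulrA mulfV// mul1r.
by congr expR; rewrite invrK !mulNr mulrC.
Qed.

Lemma lintegrable_gauss : lintegrable (fun x => expR (- b * (x - m) ^+ 2)).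
Proof. rewrite gaussE; apply: lintegrableZ; exact: integrable_normal_pdf. Qed.

Lemma Rintegral_gauss :
  (\int[mu]_x expR (- b * (x - m) ^+ 2) = Num.sqrt (pi / b))%R.
Proof.
rewrite gaussE RintegralZl//; last exact: integrable_normal_pdf.
by rewrite /Rintegral integral_normal_pdf mulr1.
Qed.

End fixed_gauss.

Lemma lintegrable_gaussX (b m : R) k : 0 < b ->
  lintegrable (fun x => (x - m) ^+ k * expR (- b * (x - m) ^+ 2)).
Proof.
move=> b0; have [C C0 HC] := gauss_moment k b0.
apply: (@continuous_lintegrable _ _ (fun x => C * expR (- (b / 2) * (x - m) ^+ 2))).
- by move=> x; apply: cvgM; [exact: continuous_exprB|exact: continuous_gauss].
- by move=> x; rewrite normrM normrX (ger0_norm (expR_ge0 _)).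
- by apply: lintegrableZ; apply: lintegrable_gauss; rewrite divr_gt0.
Qed.

Lemma gaussX_decay (b m : R) k : 0 < b ->
  exists K, forall x, `|(x - m) ^+ k * expR (- b * (x - m) ^+ 2)| * `|x| <= K.
Proof.
move=> b0; have [C C0 HC] := gauss_moment k b0.
have [D D0 HD] := gauss_moment k.+1 b0.
exists (D + C * `|m|) => x.
have e1 : expR (- (b / 2) * (x - m) ^+ 2) <= 1.
  by rewrite -[leRHS]expR0 ler_expR mulNr oppr_le0 mulr_ge0 ?sqr_ge0// divr_ge0// ltW.
have xm : `|x| <= `|x - m| + `|m| by rewrite -{1}[x](subrK m) ler_normD.
rewrite normrM normrX (ger0_norm (expR_ge0 _)).
rewrite (le_trans (ler_wpM2l _ xm)) ?mulr_ge0 ?expR_ge0//.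
rewrite mulrDr lerD//.
  by rewrite mulrAC -exprSr (le_trans (HD _))// ler_piMr.
by rewrite ler_wpM2r// (le_trans (HC _))// ler_piMr.
Qed.

Lemma Rintegral_gaussX1 (b m : R) : 0 < b ->
  (\int[mu]_x ((x - m) * expR (- b * (x - m) ^+ 2)) = 0)%R.
Proof.
move=> b0; have [K HK] := gaussX_decay m 0 b0.
have b00 : b != 0 by rewrite gt_eqF.
have dF (x : R) : is_derive x 1 (fun x => - (2 * b)^-1 * expR (- b * (x - m) ^+ 2))
    ((x - m) * expR (- b * (x - m) ^+ 2)).
  have := is_derive_scale (- (2 * b)^-1) (is_derive_gauss b m x).
  by move/is_derive_congr; apply; field.
apply: (Rintegral_derive_decay dF (K := `|- (2 * b)^-1| * K)).
- by move=> x; apply: cvgM; [exact: (@continuous_exprB m 1)|exact: continuous_gauss].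
- exact: (lintegrable_gaussX m 1 b0).
- move=> x; rewrite normrM -mulrA ler_wpM2l//.
  by have := HK x; rewrite expr0 mul1r.
Qed.

Lemma Rintegral_gaussX3 (b m : R) : 0 < b ->
  (\int[mu]_x ((x - m) ^+ 3 * expR (- b * (x - m) ^+ 2)) = 0)%R.
Proof.
move=> b0; have [K0 HK0] := gaussX_decay m 0 b0.
have [K2 HK2] := gaussX_decay m 2 b0.
have b00 : b != 0 by rewrite gt_eqF.
have dF (x : R) : is_derive x 1
    (fun x => - (2 * b)^-1 * (((x - m) ^+ 2 + b^-1) * expR (- b * (x - m) ^+ 2)))
    ((x - m) ^+ 3 * expR (- b * (x - m) ^+ 2)).
  have d1 : is_derive x 1 (fun x => (x - m) ^+ 2 + b^-1)
      (2%:R * (x - m) ^+ 1 * (1 - 0) + 0).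
    by apply: is_derive_add; apply: is_derive_exprn.
  have := is_derive_scale (- (2 * b)^-1) (is_derive_mul d1 (is_derive_gauss b m x)).
  by move/is_derive_congr; apply; field.
apply: (Rintegral_derive_decay dF (K := `|- (2 * b)^-1| * (K2 + b^-1 * K0))).
- by move=> x; apply: cvgM; [exact: continuous_exprB|exact: continuous_gauss].
- exact: (lintegrable_gaussX m 3 b0).
- move=> x; rewrite normrM -mulrA ler_wpM2l// mulrDl.
  rewrite (le_trans (ler_wpM2r (normr_ge0 _) (ler_normD _ _)))// mulrDl lerD//.
  rewrite normrM -mulrA ger0_norm ?invr_ge0 ?(ltW b0)// ler_wpM2l ?invr_ge0 ?(ltW b0)//.
  by have := HK0 x; rewrite expr0 mul1r.
Qed.

End Gaussians.

Section CauchyWeight.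
Local Open Scope complex_scope.
Context {R : realType}.
Notation mu := (@lebesgue_measure R).

Lemma cauchy_den_gt0 (x : R) : 0 < 1 + 4 * x ^+ 2.
Proof. by rewrite ltr_wpDr// mulr_ge0// sqr_ge0. Qed.

Lemma continuous_cauchy : continuous (fun x : R => (1 + 4 * x ^+ 2)^-1).
Proof.
move=> x; apply: cvgV; first by rewrite gt_eqF// cauchy_den_gt0.
apply: cvgD; first exact: cvg_cst.
by apply: cvgM; [exact: cvg_cst|exact: exprn_continuous].
Qed.

Let integral_cauchy : (\int[mu]_x (1 + 4 * x ^+ 2)^-1%:E = (pi / 2)%:E)%E.
Proof.
have datan (x : R) : is_derive x 1 (fun x => 2^-1 * atan (2 * x)) (1 + 4 * x ^+ 2)^-1.
  have d2 : is_derive x 1 (fun x => 2 * x) (2 * 1).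
    exact: is_derive_scale (is_derive_id _ _).
  have da : is_derive (2 * x) 1 atan (1 + (2 * x) ^+ 2)^-1.
    by apply: DeriveDef; [exact: derivable_atan|rewrite -derive1E derive1_atan].
  have := is_derive_scale 2^-1 (is_derive1_comp da d2).
  move/is_derive_congr; apply; rewrite exprMn.
  have -> : (2 ^+ 2 = 4 :> R) by rewrite -natrX.
  by field; rewrite gt_eqF// cauchy_den_gt0.
rewrite ge0_symfun_integralT//=.
- rewrite (_ : [set x | _] = `[0, +oo[%classic); last first.
    by apply/seteqP; split => x/=; rewrite in_itv/= andbT.
  rewrite (@ge0_continuous_FTC2y _ (fun x => (1 + 4 * x ^+ 2)^-1)
    (fun x => 2^-1 * atan (2 * x)) 0 (2^-1 * (pi / 2)))//.
  + by rewrite mulr0 atan0 mulr0 sube0 -EFinM; congr EFin; field.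
  + by move=> x _; rewrite invr_ge0 (ltW (cauchy_den_gt0 _)).
  + exact: (continuous_subspaceT continuous_cauchy).
  + apply: cvgM; first exact: cvg_cst.
    apply: (cvg_comp (fun x : R => 2 * x) atan); last exact: cvgy_atan.
    by apply: gt0_cvgMry => //; exact: cvg_id.
  + exact/cvg_at_right_filter/(is_derive_continuous datan).
  + by move=> x _; rewrite derive1E; exact: derive_val.
- by move=> x; rewrite invr_ge0 (ltW (cauchy_den_gt0 _)).
- exact: continuous_cauchy.
- by move=> x /=; rewrite sqrrN.
Qed.

Lemma lintegrable_cauchy : lintegrable (fun x : R => (1 + 4 * x ^+ 2)^-1).
Proof.
have mf : measurable_fun setT (fun x : R => (1 + 4 * x ^+ 2)^-1).
  exact: continuous_measurable_fun continuous_cauchy.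
apply/integrableP; split; first exact/measurable_EFinP.
under eq_integral => x _ do rewrite /= ger0_norm ?invr_ge0 ?(ltW (cauchy_den_gt0 _))//.
by rewrite integral_cauchy ltry.
Qed.

Lemma Rintegral_cauchy : (\int[mu]_x (1 + 4 * x ^+ 2)^-1 = pi / 2)%R.
Proof. by rewrite /Rintegral integral_cauchy. Qed.

End CauchyWeight.

Section ComplexIntegrals.
Local Open Scope complex_scope.
Context {R : realType}.
Notation mu := (@lebesgue_measure R).
Implicit Types (f g F : R -> R[i]).

Definition cintegrable f :=
  lintegrable (fun x => complex.Re (f x)) /\ lintegrable (fun x => complex.Im (f x)).

Definition ccontinuous f :=
  continuous (fun x => complex.Re (f x)) /\ continuous (fun x => complex.Im (f x)).

Definition cderivable f := forall x, exists d, is_cderive f x d.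

Lemma cderivable_continuous f : cderivable f -> ccontinuous f.
Proof.
move=> df; split=> x; have [d [[d1 _] [d2 _]]] := df x.
  exact/differentiable_continuous/derivable1_diffP.
exact/differentiable_continuous/derivable1_diffP.
Qed.

Lemma ccontinuousM (f g : R -> R[i]) : ccontinuous f -> ccontinuous g ->
  ccontinuous (fun x => f x * g x).
Proof.
move=> [f1 f2] [g1 g2]; split=> x.
  rewrite (_ : (fun x => _) = (fun x => complex.Re (f x) * complex.Re (g x) -
     complex.Im (f x) * complex.Im (g x))).
    by apply: cvgB; apply: cvgM; [exact: f1|exact: g1|exact: f2|exact: g2].
  by apply/funext => t; rewrite Re_mul.
rewrite (_ : (fun x => _) = (fun x => complex.Re (f x) * complex.Im (g x) +
     complex.Im (f x) * complex.Re (g x))).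
  by apply: cvgD; apply: cvgM; [exact: f1|exact: g2|exact: f2|exact: g1].
by apply/funext => t; rewrite Im_mul.
Qed.

Lemma dominated_cintegrable f (g : R -> R) : ccontinuous f ->
  (forall x, cmod (f x) <= g x) -> lintegrable g -> cintegrable f.
Proof.
move=> [c1 c2] fg Ig; split; apply: (continuous_lintegrable _ _ Ig) => // x.
- exact: le_trans (normr_Re_le _) (fg x).
- exact: le_trans (normr_Im_le _) (fg x).
Qed.

Lemma cintegralE f : cintegral f =
  (\int[mu]_x complex.Re (f x))%R +i* (\int[mu]_x complex.Im (f x))%R.
Proof. by []. Qed.

Lemma cintegralD f g : cintegrable f -> cintegrable g ->
  cintegral (fun x => f x + g x) = cintegral f + cintegral g.
Proof.
move=> [f1 f2] [g1 g2]; rewrite !cintegralE; apply/eqP.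
rewrite eq_complex /= -!RintegralD//; apply/andP; split; apply/eqP;
  by apply: eq_Rintegral => x _; rewrite (ReD, ImD).
Qed.

Lemma cintegrableM c f : cintegrable f -> cintegrable (fun x => c * f x).
Proof.
move=> [f1 f2]; split.
  have := lintegrableD (lintegrableZ (complex.Re c) f1) (lintegrableZ (- complex.Im c) f2).
  by apply: eq_integrable => // x _; rewrite /= Re_mul mulNr.
have := lintegrableD (lintegrableZ (complex.Re c) f2) (lintegrableZ (complex.Im c) f1).
by apply: eq_integrable => // x _; rewrite /= Im_mul.
Qed.

Lemma cintegralM c f : cintegrable f ->
  cintegral (fun x => c * f x) = c * cintegral f.
Proof.
move=> [f1 f2]; apply/eqP; rewrite eq_complex Re_mul Im_mul !cintegralE /=.
rewrite -!RintegralZl// -RintegralB -?RintegralD//; do ?[exact: lintegrableZ].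
by apply/andP; split; apply/eqP; apply: eq_Rintegral => x _;
  rewrite (Re_mul, Im_mul).
Qed.

Lemma cintegral_conj f : cintegrable f ->
  cintegral (fun x => (f x)^*%C) = (cintegral f)^*%C.
Proof.
move=> [f1 f2]; rewrite !cintegralE /= -mulN1r -RintegralZl//; congr Complex.
  by apply: eq_Rintegral => x _; case: (f x).
by apply: eq_Rintegral => x _; rewrite mulN1r; case: (f x).
Qed.

Lemma le_cmod_cintegral f (g : R -> R) : cintegrable f -> lintegrable g ->
  (forall x, cmod (f x) <= g x) -> cmod (cintegral f) <= (\int[mu]_x g x)%R.
Proof.
move=> If Ig fg; set J := cintegral f.
have [->|J0] := eqVneq J 0.
  by rewrite cmod0; apply: Rintegral_ge0 => x _; apply: le_trans (cmod_ge0 _) (fg x).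
have cJ0 : 0 < cmod J by rewrite lt_neqAle eq_sym cmod_eq0 J0 cmod_ge0.
rewrite -(ler_pM2l cJ0) -expr2.
have -> : cmod J ^+ 2 = complex.Re (cintegral (fun x => J^*%C * f x)).
  by rewrite cintegralM// -/J Re_conjM sqr_cmod !expr2.
have [I1 I2] := cintegrableM (J^*%C) If.
rewrite -RintegralZl//; apply: le_Rintegral => //; first exact: lintegrableZ.
move=> x _; rewrite (le_trans (ler_norm _))// (le_trans (normr_Re_le _))//.
by rewrite cmodM cmod_conj ler_pM2l.
Qed.

Lemma cintegral_derive_decay F f (K : R) :
  (forall x : R, is_cderive F x (f x)) -> ccontinuous f -> cintegrable f ->
  (forall x, cmod (F x) * `|x| <= K) -> cintegral f = 0.
Proof.
move=> dF [c1 c2] [i1 i2] FK; rewrite cintegralE.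
rewrite (Rintegral_derive_decay (fun x => (dF x).1) c1 i1 (K := K)); last first.
  by move=> x; apply: le_trans (FK x); rewrite ler_wpM2r// normr_Re_le.
rewrite (Rintegral_derive_decay (fun x => (dF x).2) c2 i2 (K := K))//.
by move=> x; apply: le_trans (FK x); rewrite ler_wpM2r// normr_Im_le.
Qed.

End ComplexIntegrals.

(** * Wave packets and deformation of the contour *)

Section Packet.
Local Open Scope complex_scope.
Context {R : realType}.
Notation mu := (@lebesgue_measure R).
Variables (alpha x0 w : R) (n : nat).
Implicit Types z : R[i].

Definition pole z := 1 + 2 * 'i%C * z.

Definition packet_exponent z := - alpha%:C * (z - x0%:C) ^+ 2 + 'i%C * w%:C * z.

Definition packet_factor z := (pole z)^-1 * (2 * (pole z)^-1 - 1) ^+ n.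

Definition packet z := cexp (packet_exponent z) * packet_factor z.

Definition dpole z : R[i] := - (2 * 'i%C) * (pole z)^-1 ^+ 2.

Definition dpacket_factor z :=
  dpole z * (2 * (pole z)^-1 - 1) ^+ n +
  (pole z)^-1 * (n%:R * (2 * (pole z)^-1 - 1) ^+ n.-1 * (2 * dpole z)).

Definition dpacket z :=
  cexp (packet_exponent z) *
  ((- alpha%:C * (2 * (z - x0%:C)) + 'i%C * w%:C) * packet_factor z +
   dpacket_factor z).

Lemma sqr_cmod_pole (x y : R) :
  cmod (pole (x +i* y)) ^+ 2 = (1 - 2 * y) ^+ 2 + 4 * x ^+ 2.
Proof. rewrite sqr_cmod /pole /=; ring. Qed.

Lemma is_cderive_inv_pole (g : R -> R[i]) x dg : pole (g x) != 0 ->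
  is_cderive g x dg -> is_cderive (fun t => (pole (g t))^-1) x (dpole (g x) * dg).
Proof.
move=> g0 gdg; have dp : is_cderive (fun t => pole (g t)) x (0 + 2 * 'i%C * dg).
  by apply: is_cderiveD; [exact: is_cderive_cst|exact: is_cderiveMl].
apply: is_cderive_eq (is_cderiveV g0 dp) _.
by rewrite add0r /dpole; ring.
Qed.

Lemma is_cderive_inv_poleB1 (g : R -> R[i]) x dg : pole (g x) != 0 ->
  is_cderive g x dg ->
  is_cderive (fun t => 2 * (pole (g t))^-1 - 1) x (2 * dpole (g x) * dg).
Proof.
move=> g0 gdg; have H := is_cderive_inv_pole g0 gdg.
apply: is_cderive_eq (is_cderiveB (is_cderiveMl 2 H) (is_cderive_cst 1 x)) _.
by rewrite subr0 mulrA.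
Qed.

Lemma is_cderive_packet_factor (g : R -> R[i]) x dg : pole (g x) != 0 ->
  is_cderive g x dg ->
  is_cderive (fun t => packet_factor (g t)) x (dpacket_factor (g x) * dg).
Proof.
move=> g0 gdg; have H := is_cderive_inv_pole g0 gdg.
have H2 := is_cderiveX n (is_cderive_inv_poleB1 g0 gdg).
apply: is_cderive_eq (is_cderiveM H H2) _.
by rewrite /dpacket_factor; ring.
Qed.

Lemma is_cderive_packet_exponent (g : R -> R[i]) x dg :
  is_cderive g x dg ->
  is_cderive (fun t => packet_exponent (g t)) x
    ((- alpha%:C * (2 * (g x - x0%:C)) + 'i%C * w%:C) * dg).
Proof.
move=> gdg.
have H1 := is_cderiveX 2 (is_cderiveB gdg (is_cderive_cst x0%:C x)).
have H2 := is_cderiveD (is_cderiveMl (- alpha%:C) H1) (is_cderiveMl ('i%C * w%:C) gdg).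
apply: is_cderive_eq H2 _.
by rewrite /= subr0 expr1; ring.
Qed.

Lemma is_cderive_packet (g : R -> R[i]) x dg : pole (g x) != 0 ->
  is_cderive g x dg ->
  is_cderive (fun t => packet (g t)) x (dpacket (g x) * dg).
Proof.
move=> g0 gdg; have H1 := is_cderive_cexp (is_cderive_packet_exponent gdg).
apply: is_cderive_eq (is_cderiveM H1 (is_cderive_packet_factor g0 gdg)) _.
by rewrite /dpacket; ring.
Qed.

Lemma cderivable_dpacket (g : R -> R[i]) x dg : pole (g x) != 0 ->
  is_cderive g x dg -> exists d, is_cderive (fun t => dpacket (g t)) x d.
Proof.
move=> g0 gdg; have He := is_cderive_cexp (is_cderive_packet_exponent gdg).
have HP := is_cderive_packet_factor g0 gdg.
have HW := is_cderive_inv_pole g0 gdg.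
have HB := is_cderive_inv_poleB1 g0 gdg.
have Hd : is_cderive (fun t => dpole (g t)) x _ := is_cderiveMl (- (2 * 'i%C)) (is_cderiveX 2 HW).
have H1 := is_cderiveD
  (is_cderiveMl (- alpha%:C) (is_cderiveMl 2 (is_cderiveB gdg (is_cderive_cst x0%:C x))))
  (is_cderive_cst ('i%C * w%:C) x).
have H2 := is_cderiveD (is_cderiveM Hd (is_cderiveX n HB))
  (is_cderiveM HW (is_cderiveM (is_cderiveMl n%:R (is_cderiveX n.-1 HB))
                    (is_cderiveMl 2 Hd))).
eexists; exact: is_cderiveM He (is_cderiveD (is_cderiveM H1 HP) H2).
Qed.

Lemma Re_packet_exponent (x y : R) : complex.Re (packet_exponent (x +i* y)) =
  - alpha * (x - x0) ^+ 2 + alpha * y ^+ 2 - w * y.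
Proof. by rewrite /packet_exponent /=; ring. Qed.

Lemma cmod_packet (x y : R) : cmod (packet (x +i* y)) =
  expR (- alpha * (x - x0) ^+ 2 + alpha * y ^+ 2 - w * y) *
  cmod (packet_factor (x +i* y)).
Proof. by rewrite /packet cmodM cmod_cexp Re_packet_exponent. Qed.

Hypothesis alpha0 : 0 < alpha.

Lemma packet_bound (Y B : R) : exists2 K, 0 <= K & forall x y : R, `|y| <= Y ->
  cmod (pole (x +i* y))^-1 <= B ->
  cmod (packet (x +i* y)) <= K * expR (- (alpha / 2) * (x - x0) ^+ 2) /\
  cmod (dpacket (x +i* y)) <= K * expR (- (alpha / 2) * (x - x0) ^+ 2).
Proof.
have [Y0|Y0] := ltP Y 0.
  by exists 0 => // x y yY; have := le_lt_trans (le_trans (normr_ge0 y) yY) Y0; rewrite ltxx.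
have [B0|B0] := ltP B 0.
  by exists 0 => // x y _ yY; have := le_lt_trans (le_trans (cmod_ge0 _) yY) B0; rewrite ltxx.
have [C0 C00 HC0] := gauss_moment 0 alpha0.
have [C1 C10 HC1] := gauss_moment 1 alpha0.
pose E := expR (alpha * Y ^+ 2 + `|w| * Y).
pose P := B * (2 * B + 1) ^+ n.
pose D := 2 * B ^+ 2 * (2 * B + 1) ^+ n +
   B * (n%:R * (2 * B + 1) ^+ n.-1 * (2 * (2 * B ^+ 2))).
pose L := alpha * (2 * Y) + `|w|.
have E0 : 0 <= E by exact: expR_ge0.
have B10 : 0 <= 2 * B + 1 by rewrite addr_ge0// mulr_ge0.
have P0 : 0 <= P by rewrite mulr_ge0// exprn_ge0.
have D0 : 0 <= D.
  by rewrite addr_ge0// !mulr_ge0// ?exprn_ge0// mulr_ge0 ?exprn_ge0.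
have L0 : 0 <= L.
  by apply: addr_ge0 => //; rewrite mulr_ge0 ?(ltW alpha0)// mulr_ge0.
pose K1 := E * P * C0; pose K2 := E * ((alpha * 2 * C1 + L * C0) * P + D * C0).
have K10 : 0 <= K1 by apply: mulr_ge0 => //; apply: mulr_ge0.
have K20 : 0 <= K2.
  apply: mulr_ge0 => //; apply: addr_ge0; last exact: mulr_ge0.
  apply: mulr_ge0 => //; apply: addr_ge0; last exact: mulr_ge0.
  by rewrite mulr_ge0// mulr_ge0// ltW.
exists (K1 + K2); first by rewrite addr_ge0.
move=> x y yY; set z := x +i* y => WB.
have eE : expR (alpha * y ^+ 2 - w * y) <= E.
  rewrite ler_expR lerD//.
    rewrite ler_wpM2l ?(ltW alpha0)// -[y ^+ 2]real_normK ?num_real//.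
    by rewrite lerXn2r// nnegrE.
  by rewrite -mulNr (le_trans (ler_norm _))// normrM normrN ler_wpM2l.
have BB : cmod (2 * (pole z)^-1 - 1) <= 2 * B + 1.
  rewrite (le_trans (ler_cmodD _ _))// cmodN cmod1 lerD2r cmodM.
  by rewrite cmod_nat ler_wpM2l.
have Bn k : cmod ((2 * (pole z)^-1 - 1) ^+ k) <= (2 * B + 1) ^+ k.
  by rewrite cmodX lerXn2r// nnegrE ?cmod_ge0.
have PB : cmod (packet_factor z) <= P.
  by rewrite /packet_factor cmodM ler_pM ?cmod_ge0.
have dB : cmod (dpole z) <= 2 * B ^+ 2.
  rewrite /dpole cmodM cmodN cmodM cmodi cmod_nat mulr1.
  by rewrite ler_wpM2l// cmodX lerXn2r// nnegrE cmod_ge0.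
have DB : cmod (dpacket_factor z) <= D.
  rewrite (le_trans (ler_cmodD _ _))// lerD//.
    by rewrite [leLHS]cmodM; apply: ler_pM; rewrite ?cmod_ge0.
  rewrite [leLHS]cmodM; apply: ler_pM; rewrite ?cmod_ge0//.
  rewrite [leLHS]cmodM; apply: ler_pM; rewrite ?cmod_ge0//.
    by rewrite [leLHS]cmodM cmod_nat; apply: ler_pM; rewrite ?cmod_ge0.
  by rewrite [leLHS]cmodM cmod_nat ler_wpM2l.
have LB : cmod (- alpha%:C * (2 * (z - x0%:C)) + 'i%C * w%:C) <=
    alpha * 2 * `|x - x0| + L.
  rewrite (le_trans (ler_cmodD _ _))// !cmodM cmodi cmodN !cmod_real mul1r /L addrA.
  rewrite lerD2r gtr0_norm// -mulrA -mulrDr ler_wpM2l ?(ltW alpha0)//.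
  rewrite cmod_nat -mulrDr ler_wpM2l//.
  rewrite (le_trans (cmod_le_add _))//= subr0 lerD2l//.
have e0 := expR_ge0 (- alpha * (x - x0) ^+ 2).
have g0 := expR_ge0 (- (alpha / 2) * (x - x0) ^+ 2).
have hC0 := HC0 (x - x0); rewrite expr0 mul1r in hC0.
have hC1 := HC1 (x - x0); rewrite expr1 in hC1.
have expE : cmod (cexp (packet_exponent z)) <= expR (- alpha * (x - x0) ^+ 2) * E.
  by rewrite cmod_cexp Re_packet_exponent -addrA expRD ler_wpM2l.
split.
  apply: (le_trans (y := K1 * expR (- (alpha / 2) * (x - x0) ^+ 2))); last first.
    by rewrite ler_wpM2r// lerDl.
  rewrite cmodM (le_trans (ler_pM (cmod_ge0 _) (cmod_ge0 _) expE PB))//.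
  set e := expR (- alpha * _) in hC0 *; rewrite (_ : e * E * P = E * P * e); last by ring.
  by rewrite /K1 -[leRHS]mulrA; apply: ler_wpM2l => //; exact: mulr_ge0.
apply: (le_trans (y := K2 * expR (- (alpha / 2) * (x - x0) ^+ 2))); last first.
  by rewrite ler_wpM2r// lerDr.
rewrite cmodM.
have H : cmod ((- alpha%:C * (2 * (z - x0%:C)) + 'i%C * w%:C) * packet_factor z +
     dpacket_factor z) <= (alpha * 2 * `|x - x0| + L) * P + D.
  by rewrite (le_trans (ler_cmodD _ _))// lerD// cmodM ler_pM ?cmod_ge0.
rewrite (le_trans (ler_pM (cmod_ge0 _) (cmod_ge0 _) expE H))//.
set e := expR (- alpha * _) in e0 hC0 hC1 *; set g := expR (- (alpha / 2) * _).
rewrite (_ : e * E * _ = E * (alpha * 2 * P * (`|x - x0| * e) + (L * P + D) * e)); last by ring.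
rewrite (_ : K2 * g = E * (alpha * 2 * P * (C1 * g) + (L * P + D) * (C0 * g))); last first.
  by rewrite /K2; ring.
apply: ler_wpM2l => //.
apply: lerD; apply: ler_wpM2l => //.
- by apply: mulr_ge0 => //; rewrite mulr_ge0// ltW.
- by rewrite addr_ge0// mulr_ge0.
Qed.

End Packet.

Section ContourShift.
Local Open Scope complex_scope.
Context {R : realType}.
Notation mu := (@lebesgue_measure R).
Variables (alpha x0 w : R) (n : nat).
Hypothesis alpha0 : 0 < alpha.
Variables (s ds : R -> R) (S e : R).
Hypothesis is_ds : forall x : R, is_derive x 1 s (ds x).
Hypothesis dds : forall x : R, derivable ds x 1.
Hypothesis s_bound : forall x, `|s x| <= S.
Hypothesis ds_bound : forall x, `|ds x| <= S.
Hypothesis e0 : 0 < e.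
Hypothesis pole_far : forall x t, 0 <= t ->
  e ^+ 2 <= (1 - 2 * (t * s x)) ^+ 2 + 4 * x ^+ 2.

Local Notation pk := (packet alpha x0 w n).
Local Notation dpk := (dpacket alpha x0 w n).

(* Deforming with [t ^+ 2] instead of [t] keeps the deformation on the
   pole-free side for all real [t], so that the integral is constant on R. *)
Let z t x : R[i] := x +i* (t ^+ 2 * s x).
Let F t x := pk (z t x) * (1 +i* (t ^+ 2 * ds x)).
Let H t x := pk (z t x) * (0 +i* (2 * t * s x)).
Let dF t x := dpk (z t x) * (0 +i* (2 * t * s x)) * (1 +i* (t ^+ 2 * ds x)) +
  pk (z t x) * (0 +i* (2 * t * ds x)).

Let S0 : 0 <= S.
Proof. exact: le_trans (normr_ge0 _) (s_bound 0). Qed.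

Let cmod_pole t x : e <= cmod (pole (z t x)).
Proof.
rewrite -(@ler_pXn2r _ 2) ?nnegrE ?cmod_ge0 ?(ltW e0)//.
by rewrite sqr_cmod_pole pole_far// sqr_ge0.
Qed.

Let pole_neq0 t x : pole (z t x) != 0.
Proof. by rewrite -cmod_eq0 gt_eqF// (lt_le_trans e0). Qed.

Let cmod_inv_pole t x : cmod (pole (z t x))^-1 <= e^-1.
Proof. by rewrite cmodV lef_pV2// posrE (lt_le_trans e0). Qed.

Let is_cderive_z_x t (x : R) : is_cderive (z t) x (1 +i* (t ^+ 2 * ds x)).
Proof. by split; [exact: is_derive_id|exact: is_derive_scale]. Qed.

Let is_cderive_z_t x (t : R) : is_cderive (z^~ x) t (0 +i* (2 * t * s x)).
Proof.
split; first exact: is_derive_cst.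
have := is_derive_mul (is_derive_exprn 2 (is_derive_id t 1)) (is_derive_cst (s x) t 1).
by move/is_derive_congr; apply; rewrite /= expr1 mulr1 mulr0 addr0.
Qed.

Let is_cderive_F_t x (t : R) : is_cderive (F^~ x) t (dF t x).
Proof.
have d1 : is_cderive (fun t : R => 1 +i* (t ^+ 2 * ds x)) t (0 +i* (2 * t * ds x)).
  split; first exact: is_derive_cst.
  have := is_derive_mul (is_derive_exprn 2 (is_derive_id t 1)) (is_derive_cst (ds x) t 1).
  by move/is_derive_congr; apply; rewrite /= expr1 mulr1 mulr0 addr0.
exact: (is_cderiveM (is_cderive_packet alpha x0 w n
  (pole_neq0 t x : pole ((z^~ x) t) != 0) (is_cderive_z_t x t)) d1).
Qed.

Let is_cderive_H_x t (x : R) : is_cderive (H t) x (dF t x).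
Proof.
have d1 : is_cderive (fun x : R => 0 +i* (2 * t * s x)) x (0 +i* (2 * t * ds x)).
  by split; [exact: is_derive_cst|exact: is_derive_scale].
have Hp := is_cderive_packet alpha x0 w n (pole_neq0 t x) (is_cderive_z_x t x).
by apply: is_cderive_eq (is_cderiveM Hp d1) _; rewrite /dF mulrAC.
Qed.

Let is_cderive_ds k (x : R) : is_cderive (fun x => 1 +i* (k * ds x)) x
  (0 +i* (k * 'D_1 ds x)).
Proof.
split; first exact: is_derive_cst.
by apply: is_derive_scale; apply: DeriveDef.
Qed.

Let is_cderive_ds0 k (x : R) : is_cderive (fun x => 0 +i* (k * ds x)) x
  (0 +i* (k * 'D_1 ds x)).
Proof.
split; first exact: is_derive_cst.
by apply: is_derive_scale; apply: DeriveDef.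
Qed.

Let cderivable_F t : cderivable (F t).
Proof.
move=> x; have Hp := is_cderive_packet alpha x0 w n (pole_neq0 t x) (is_cderive_z_x t x).
eexists; exact: is_cderiveM Hp (is_cderive_ds _ _).
Qed.

Let cderivable_dF t : cderivable (dF t).
Proof.
move=> x.
have [d Hd] := cderivable_dpacket alpha x0 w n (pole_neq0 t x) (is_cderive_z_x t x).
have Hs : is_cderive (fun x : R => 0 +i* (2 * t * s x)) x (0 +i* (2 * t * ds x)).
  by split; [exact: is_derive_cst|exact: is_derive_scale].
have Hp := is_cderive_packet alpha x0 w n (pole_neq0 t x) (is_cderive_z_x t x).
eexists; exact: is_cderiveD (is_cderiveM (is_cderiveM Hd Hs) (is_cderive_ds _ _))
  (is_cderiveM Hp (is_cderive_ds0 _ _)).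
Qed.

Let bounds T : exists2 K, 0 <= K & forall t x, `|t| <= T ->
  [/\ cmod (F t x) <= K * expR (- (alpha / 2) * (x - x0) ^+ 2),
      cmod (dF t x) <= K * expR (- (alpha / 2) * (x - x0) ^+ 2) &
      cmod (H t x) <= K * expR (- (alpha / 2) * (x - x0) ^+ 2)].
Proof.
have [T0|T0] := ltP T 0.
  by exists 0 => // t x tT; have := le_lt_trans (le_trans (normr_ge0 t) tT) T0; rewrite ltxx.
have [K K0 HK] := packet_bound x0 w n alpha0 (T ^+ 2 * S) e^-1.
pose a := 1 + T ^+ 2 * S; pose b := 2 * T * S.
have TS0 : 0 <= T ^+ 2 * S by rewrite mulr_ge0 ?sqr_ge0.
have a0 : 0 <= a by rewrite addr_ge0.
have b0 : 0 <= b by rewrite !mulr_ge0.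
exists (K * a + (K * b * a + K * b) + K * b).
  by rewrite !addr_ge0 ?mulr_ge0.
move=> t x tT.
have t2 : t ^+ 2 <= T ^+ 2 by rewrite -real_normK ?num_real// lerXn2r// nnegrE.
have yY : `|t ^+ 2 * s x| <= T ^+ 2 * S.
  by rewrite normrM ger0_norm ?sqr_ge0// ler_pM ?sqr_ge0.
have yY' : `|t ^+ 2 * ds x| <= T ^+ 2 * S.
  by rewrite normrM ger0_norm ?sqr_ge0// ler_pM ?sqr_ge0.
have [pB dB] := HK x (t ^+ 2 * s x) yY (cmod_inv_pole t x).
rewrite -/(z t x) in pB dB.
set g := expR _ in pB dB *.
have g0 : 0 <= g by exact: expR_ge0.
have aB : cmod (1 +i* (t ^+ 2 * ds x)) <= a.
  by rewrite (le_trans (cmod_le_add _))//= normr1 lerD2l.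
have bB f : `|f| <= S -> cmod (0 +i* (2 * t * f)) <= b.
  move=> fS; rewrite (le_trans (cmod_le_add _))//= normr0 add0r normrM normrM.
  by rewrite normr_nat ler_pM ?mulr_ge0// ler_wpM2l.
have FB : cmod (F t x) <= K * a * g.
  by rewrite [leRHS]mulrAC /F cmodM ler_pM ?cmod_ge0.
have HB : cmod (H t x) <= K * b * g.
  by rewrite [leRHS]mulrAC /H cmodM ler_pM ?cmod_ge0 ?bB.
have DB : cmod (dF t x) <= (K * b * a + K * b) * g.
  rewrite mulrDl (le_trans (ler_cmodD _ _))// lerD//.
    rewrite cmodM [leRHS]mulrAC ler_pM ?cmod_ge0//.
    by rewrite cmodM [leRHS]mulrAC ler_pM ?cmod_ge0 ?bB.
  by rewrite [leRHS]mulrAC cmodM ler_pM ?cmod_ge0 ?bB.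
split.
- by rewrite (le_trans FB)// ler_wpM2r// -addrA lerDl !addr_ge0 ?mulr_ge0.
- by rewrite (le_trans DB)// ler_wpM2r// addrAC lerDr addr_ge0 ?mulr_ge0.
- by rewrite (le_trans HB)// ler_wpM2r// lerDr !addr_ge0 ?mulr_ge0.
Qed.

Let lintegrable_dom K : lintegrable (fun x => K * expR (- (alpha / 2) * (x - x0) ^+ 2)).
Proof. by apply: lintegrableZ; apply: lintegrable_gauss; rewrite divr_gt0. Qed.

Let cintegrable_F t : cintegrable (F t).
Proof.
have [K _ HK] := bounds `|t|.
apply: dominated_cintegrable (lintegrable_dom K); first exact: cderivable_continuous.
by move=> x; have [] := HK t x (lexx _).
Qed.

Let integral_dF t : cintegral (dF t) = 0.
Proof.
have [K K0 HK] := bounds `|t|.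
have a20 : 0 < alpha / 2 by rewrite divr_gt0.
have [L HL] := gaussX_decay x0 0 a20.
apply: (@cintegral_derive_decay _ (H t) (dF t) (K * L)).
- exact: is_cderive_H_x.
- exact/cderivable_continuous/cderivable_dF.
- apply: dominated_cintegrable (lintegrable_dom K).
    exact/cderivable_continuous/cderivable_dF.
  by move=> x; have [] := HK t x (lexx _).
- move=> x; have [_ _ Hx] := HK t x (lexx _).
  rewrite (le_trans (ler_wpM2r (normr_ge0 _) Hx))// -mulrA ler_wpM2l//.
  by have := HL x; rewrite expr0 mul1r ger0_norm ?expR_ge0.
Qed.

Let is_derive_part (p : R[i] -> R) : (forall u, `|p u| <= cmod u) ->
  (forall x (t : R), is_derive t 1 (fun t => p (F t x)) (p (dF t x))) ->
  (forall t, lintegrable (fun x => p (F t x))) ->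
  (forall t, \int[mu]_x p (dF t x) = 0)%R ->
  forall t : R, is_derive t 1 (fun t => \int[mu]_x p (F t x))%R 0.
Proof.
move=> p_le dpF intp intdp t.
have [K K0 HK] := bounds (`|t| + 1).
have tI : (`]t - 1, t + 1[%classic : set R) t by rewrite /= in_itv /= ltrBlDr !ltrDl ltr01.
have IT u : (`]t - 1, t + 1[%classic : set R) u -> `|u| <= `|t| + 1.
  rewrite /= in_itv /= => /andP[u1 u2].
  rewrite -[u](subrK t) addrC (le_trans (ler_normD _ _))// lerD2l ler_norml.
  by rewrite lerBrDr lerBlDr [1 + t]addrC (ltW u2) addrC (ltW u1).
have dE u x : partial1of2 (fun t x => p (F t x)) u x = p (dF u x).
  by rewrite /partial1of2 derive1E; have := dpF x u => ?; rewrite derive_val.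
have der u x : derivable (fun t => p (F t x)) u 1 by case: (dpF x u).
have Gub u x : (`]t - 1, t + 1[%classic : set R) u -> setT x ->
    `|partial1of2 (fun t x => p (F t x)) u x| <= K * expR (- (alpha / 2) * (x - x0) ^+ 2).
  move=> uI _; rewrite dE (le_trans (p_le _))//.
  by have [_ ->] := HK u x (IT u uI).
have G0 x : 0 <= K * expR (- (alpha / 2) * (x - x0) ^+ 2) by rewrite mulr_ge0 ?expR_ge0.
apply: DeriveDef.
  exact: (@derivable_under_integral R _ _ mu (fun t x => p (F t x)) setT measurableT
    _ _ _ tI (fun u _ => intp u) (fun u x _ _ => der u x) _ G0 (lintegrable_dom K) Gub).
rewrite -derive1E (@differentiation_under_integral R _ _ mu (fun t x => p (F t x))
    setT measurableT _ _ _ tI (fun u _ => intp u) (fun u x _ _ => der u x) _ G0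
    (lintegrable_dom K) Gub).
by under eq_Rintegral do rewrite dE.
Qed.

Lemma contour_shift : cintegral (fun x => pk x%:C) =
  cintegral (fun x => pk (x +i* s x) * (1 +i* ds x)).
Proof.
have I0 t : cintegral (dF t) = 0 by exact: integral_dF.
have cst : cintegral (F 0) = cintegral (F 1).
  rewrite !cintegralE; congr Complex.
    apply: (is_derive_0_is_cst (f := fun t => \int[mu]_x complex.Re (F t x))%R).
    apply: is_derive_part; first exact: normr_Re_le.
    - by move=> x t; case: (is_cderive_F_t x t).
    - by move=> t; case: (cintegrable_F t).
    - by move=> t; case: (I0 t).
  apply: (is_derive_0_is_cst (f := fun t => \int[mu]_x complex.Im (F t x))%R).
  apply: is_derive_part; first exact: normr_Im_le.
  - by move=> x t; case: (is_cderive_F_t x t).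
  - by move=> t; case: (cintegrable_F t).
  - by move=> t; case: (I0 t).
rewrite (_ : (fun x => pk x%:C) = F 0); last first.
  by apply/funext => x; rewrite /F /z expr0n /= !mul0r mulr1.
rewrite cst; congr cintegral; apply/funext => x.
by rewrite /F /z expr1n !mul1r.
Qed.

Lemma cintegrable_shift : cintegrable (fun x => pk (x +i* s x) * (1 +i* ds x)).
Proof.
rewrite (_ : (fun x => _) = F 1); first exact: cintegrable_F.
by apply/funext => x; rewrite /F /z expr1n !mul1r.
Qed.

End ContourShift.

(** * The Malmquist-Takenaka coefficients *)

Section Coefficients.
Local Open Scope complex_scope.
Context {R : realType}.
Notation mu := (@lebesgue_measure R).
Variables (alpha x0 : R).
Hypothesis alpha0 : 0 < alpha.
Implicit Types (w x : R) (n : nat).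

Definition wave w x : R[i] :=
  cexp ((- alpha * (x - x0) ^+ 2)%:C + 'i%C * (w * x)%:C).

Lemma cexp_packet_exponent w x : cexp (packet_exponent alpha x0 w x%:C) = wave w x.
Proof.
rewrite /wave; congr cexp; apply/eqP; rewrite /packet_exponent eq_complex /=.
by apply/andP; split; apply/eqP; ring.
Qed.

Lemma conj_wave w x : (wave w x)^*%C = wave (- w) x.
Proof.
rewrite /wave conj_cexp; congr cexp; apply/eqP.
by rewrite eq_complex /=; apply/andP; split; apply/eqP; ring.
Qed.

Lemma pole_real_neq0 x : pole x%:C != 0.
Proof.
rewrite -cmod_eq0 -sqrf_eq0 sqr_cmod_pole mulr0 subr0 expr1n gt_eqF//.
by rewrite ltr_wpDr// mulr_ge0// sqr_ge0.
Qed.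

Lemma conj_pole x : (pole x%:C)^*%C = 1 - 2 * 'i%C * x%:C.
Proof.
by apply/eqP; rewrite /pole eq_complex /=; apply/andP; split; apply/eqP; ring.
Qed.

Lemma packet_factor_real n x : packet_factor n x%:C =
  (1 - 2 * 'i%C * x%:C) ^+ n / (1 + 2 * 'i%C * x%:C) ^+ n.+1.
Proof.
have p0 := pole_real_neq0 x; rewrite -exprVn exprS mulrCA -exprMn.
congr (_ * _ ^+ _); rewrite (_ : 1 - _ = 2 - pole x%:C); last by rewrite /pole; ring.
by rewrite mulrBl mulfV.
Qed.

Definition mt_coef (n : int) : R[i] := 'i%C ^ n * (Num.sqrt (2 / pi))%:C.

Lemma cmod_mt_coef (n : int) : cmod (mt_coef n) = Num.sqrt (2 / pi).
Proof.
rewrite cmodM cmod_real ger0_norm ?sqrtr_ge0//.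
suff -> : cmod ('i%C ^ n : R[i]) = 1 by rewrite mul1r.
by case: n => m; rewrite ?NegzE -?exprnN -?exprnP ?cmodV cmodX cmodi expr1n ?invr1.
Qed.

Lemma malmquist_takenaka_nat n x : (malmquist_takenaka (Posz n) x)^*%C =
  (mt_coef n)^*%C * packet_factor n x%:C.
Proof.
rewrite /malmquist_takenaka rmorphM; congr (_ * _).
rewrite packet_factor_real rmorphM; congr (_ * _).
  by rewrite rmorphXn; congr (_ ^+ _); exact: conj_pole.
rewrite fmorphV rmorphXn addn1; congr (_ ^+ _)^-1.
by have /(congr1 (@conjc R)) := conj_pole x; rewrite conjcK.
Qed.

Lemma malmquist_takenaka_neg n x : malmquist_takenaka (Negz n) x =
  mt_coef (Negz n) * packet_factor n x%:C.
Proof.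
rewrite /malmquist_takenaka; congr (_ * _); rewrite packet_factor_real mulrC.
congr (_ * _).
have -> : Negz n + 1 = - n%:Z by rewrite NegzE -addn1 PoszD opprD addrK.
by rewrite -exprnN invrK.
Qed.

Lemma cintegrable_packet w n : cintegrable (fun x => packet alpha x0 w n x%:C).
Proof.
have H0 x : `|(cst 0 : R -> R) x| <= 1 by rewrite normr0.
have := @cintegrable_shift R alpha x0 w n alpha0 (cst 0) (cst 0) 1 1
  (fun x => is_derive_cst _ _ _) (fun x => derivable_cst _ _ _) H0 H0 ltr01.
rewrite (_ : (fun x => _) = (fun x => packet alpha x0 w n x%:C)).
  by apply=> x t _; rewrite /= !mulr0 subr0 !expr1n lerDl mulr_ge0// sqr_ge0.
by apply/funext => x /=; rewrite mulr1.
Qed.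

Definition coef_integrand w (n : int) x := wave w x * (malmquist_takenaka n x)^*%C.

Lemma coef_integrand_nat w n :
  coef_integrand w n = (fun x => (mt_coef n)^*%C * packet alpha x0 w n x%:C).
Proof.
apply/funext => x; rewrite /coef_integrand malmquist_takenaka_nat /packet.
by rewrite cexp_packet_exponent mulrCA.
Qed.

Lemma coef_integrand_neg w n : coef_integrand w (Negz n) =
  (fun x => (mt_coef (Negz n) * packet alpha x0 (- w) n x%:C)^*%C).
Proof.
apply/funext => x; rewrite /coef_integrand malmquist_takenaka_neg /packet.
have conjM (u v : R[i]) : (u * v)^*%C = u^*%C * v^*%C by exact: rmorphM.
rewrite cexp_packet_exponent (conjM _ (packet_factor n _)) (conjM _ (wave _ _ * _)).
by rewrite (conjM (wave _ _)) conj_wave opprK mulrCA.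
Qed.

Lemma cintegrable_conj (f : R -> R[i]) :
  cintegrable f -> cintegrable (fun x => (f x)^*%C).
Proof.
move=> [f1 f2]; split.
  by apply: eq_integrable f1 => // x _ /=; case: (f x).
have := lintegrableZ (-1) f2; apply: eq_integrable => // x _ /=.
by rewrite mulN1r; case: (f x).
Qed.

Lemma cintegrable_coef w (n : int) : cintegrable (coef_integrand w n).
Proof.
case: n => n; rewrite ?coef_integrand_nat ?coef_integrand_neg.
  exact/cintegrableM/cintegrable_packet.
exact/cintegrable_conj/cintegrableM/cintegrable_packet.
Qed.

Lemma coef_bE w (n : int) : coef_b alpha x0 w n = 2^-1 * cintegral (coef_integrand w n).
Proof. by []. Qed.

Lemma cmod_half (z : R[i]) : cmod (2^-1 * z) = 2^-1 * cmod z.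
Proof. by rewrite cmodM cmodV cmod_nat. Qed.

Lemma cmod_coef_b_nat w n : cmod (coef_b alpha x0 w n) =
  2^-1 * Num.sqrt (2 / pi) * cmod (cintegral (fun x => packet alpha x0 w n x%:C)).
Proof.
rewrite coef_bE cmod_half coef_integrand_nat cintegralM; last exact: cintegrable_packet.
by rewrite cmodM cmod_conj cmod_mt_coef mulrA.
Qed.

Lemma cmod_coef_b_neg w n :
  cmod (coef_b alpha x0 w (Negz n)) = cmod (coef_b alpha x0 (- w) n).
Proof.
have I := cintegrable_packet (- w) n.
rewrite cmod_coef_b_nat coef_bE cmod_half coef_integrand_neg.
rewrite cintegral_conj; last exact: cintegrableM.
by rewrite cmod_conj (cintegralM _ I) cmodM cmod_mt_coef mulrA.
Qed.

Lemma coef_aE w (n : int) : coef_a alpha x0 w n = coef_b alpha x0 w n + coef_b alpha x0 (- w) n.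
Proof.
rewrite !coef_bE -mulrDr -cintegralD; do ?exact: cintegrable_coef.
rewrite -cintegralM; last first.
  have [a1 a2] := cintegrable_coef w n; have [b1 b2] := cintegrable_coef (- w) n.
  split; have := lintegrableD _ _.
    by move=> /(_ _ _ _ a1 b1); apply: eq_integrable => // x _ /=; rewrite ReD.
  by move=> /(_ _ _ _ a2 b2); apply: eq_integrable => // x _ /=; rewrite ImD.
congr cintegral; apply/funext => x; rewrite /coef_integrand -mulrDl mulrA.
congr (_ * _); rewrite -conj_wave (_ : 2^-1 = (2^-1 : R)%:C); last first.
  by rewrite fmorphV rmorph_nat.
rewrite /wave /cexp; apply/eqP.
rewrite eq_complex /= !(mul0r, mulr0, mul1r, add0r, addr0, subr0).
by apply/andP; split; apply/eqP; field.
Qed.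

End Coefficients.

(** * The exponentially small coefficients *)

Section HardySide.
Local Open Scope complex_scope.
Context {R : realType}.
Notation mu := (@lebesgue_measure R).
Variables (s : R) (n : nat).
Hypothesis s0 : s <= 0.

Let z (x : R) : R[i] := x +i* s.

Lemma sqr_cmod_pole_ge (x : R) : 1 + 4 * x ^+ 2 <= cmod (pole (z x)) ^+ 2.
Proof. rewrite sqr_cmod_pole lerD2r; have := s0; nra. Qed.

Lemma pole_lower_neq0 (x : R) : pole (z x) != 0.
Proof.
rewrite -cmod_eq0 -sqrf_eq0 gt_eqF//.
exact: lt_le_trans (cauchy_den_gt0 x) (sqr_cmod_pole_ge x).
Qed.

Lemma sqr_cmod_inv_pole_le (x : R) : cmod (pole (z x))^-1 ^+ 2 <= (1 + 4 * x ^+ 2)^-1.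
Proof.
rewrite cmodV exprVn lef_pV2 ?sqr_cmod_pole_ge// posrE ?cauchy_den_gt0//.
exact: lt_le_trans (cauchy_den_gt0 x) (sqr_cmod_pole_ge x).
Qed.

Lemma cmod_blaschke_le1 (x : R) : cmod (2 * (pole (z x))^-1 - 1) <= 1.
Proof.
have p0 := pole_lower_neq0 x.
have -> : 2 * (pole (z x))^-1 - 1 = (2 - pole (z x)) / pole (z x).
  by rewrite mulrBl mulfV.
have cp0 : 0 < cmod (pole (z x)) by rewrite lt_neqAle eq_sym cmod_eq0 p0 cmod_ge0.
rewrite cmodM cmodV ler_pdivrMr// mul1r -(@ler_pXn2r _ 2) ?nnegrE ?cmod_ge0//.
rewrite sqr_cmod_pole (_ : 2 - _ = (1 + 2 * s) -i* (2 * x)); last first.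
  by apply/eqP; rewrite /pole eq_complex /=; apply/andP; split; apply/eqP; ring.
by rewrite sqr_cmod /= sqrrN; have := s0; nra.
Qed.

Lemma sqr_cmod_factor_le (x : R) :
  cmod (packet_factor n (z x)) ^+ 2 <= (1 + 4 * x ^+ 2)^-1.
Proof.
apply: le_trans (sqr_cmod_inv_pole_le x).
rewrite /packet_factor cmodM exprMn ler_piMr ?sqr_ge0// cmodX -exprM.
by rewrite exprn_ile1 ?cmod_ge0// cmod_blaschke_le1.
Qed.

Lemma cmod_factor_le1 (x : R) : cmod (packet_factor n (z x)) <= 1.
Proof.
rewrite -(@ler_pXn2r _ 2) ?nnegrE ?cmod_ge0// expr1n (le_trans (sqr_cmod_factor_le x))//.
by rewrite invf_le1 ?cauchy_den_gt0// lerDl mulr_ge0// sqr_ge0.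
Qed.

Let is_cderive_z (x : R) : is_cderive z x 1.
Proof. by split; [exact: is_derive_id|exact: is_derive_cst]. Qed.

Lemma ccontinuous_factor : ccontinuous (fun x => packet_factor n (z x)).
Proof.
apply: cderivable_continuous => x; eexists.
exact: is_cderive_packet_factor (pole_lower_neq0 x) (is_cderive_z x).
Qed.

Lemma cintegrable_sqr_factor : cintegrable (fun x => packet_factor n (z x) ^+ 2).
Proof.
apply: dominated_cintegrable lintegrable_cauchy.
  by apply: ccontinuousM; exact: ccontinuous_factor.
by move=> x; rewrite cmodX; exact: sqr_cmod_factor_le.
Qed.

(* The square of a function of the Hardy class has vanishing integral; here the
   odd powers of the Blaschke factor give an explicit primitive. *)
Lemma cintegral_sqr_factor : cintegral (fun x => packet_factor n (z x) ^+ 2) = 0.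
Proof.
pose u x := 2 * (pole (z x))^-1 - 1.
pose c : R[i] := (- (4 * 'i%C) * (2 * n).+1%:R)^-1.
apply: (@cintegral_derive_decay _ (fun x => c * (u x ^+ (2 * n).+1 - (-1) ^+ (2 * n).+1))
  _ (cmod c * (2 * n).+1%:R)).
- move=> x; have du := is_cderive_inv_poleB1 (pole_lower_neq0 x) (is_cderive_z x).
  have := is_cderiveMl c (is_cderiveB (is_cderiveX (2 * n).+1 du)
     (is_cderive_cst ((-1) ^+ (2 * n).+1) x)).
  move/is_cderive_eq; apply; rewrite /= -/(u x) /packet_factor /dpole -/(u x).
  rewrite exprMn -exprM [(n * 2)%N]mulnC.
  set c' := - (4 * 'i%C) * (2 * n).+1%:R : R[i].
  have c'0 : c' != 0.
    by rewrite -cmod_eq0 !cmodM cmodN cmodM cmodi !cmod_nat mulr1 mulf_neq0 ?pnatr_eq0.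
  rewrite [LHS](_ : _ = c * c' * ((pole (z x))^-1 ^+ 2 * u x ^+ (2 * n))).
    by rewrite /c mulVf// mul1r.
  by rewrite /c'; ring.
- exact: ccontinuousM ccontinuous_factor ccontinuous_factor.
- exact: cintegrable_sqr_factor.
- move=> x; rewrite cmodM -mulrA ler_wpM2l ?cmod_ge0//.
  apply: le_trans (ler_wpM2r (normr_ge0 _) (cmod_exprD1_le _ (cmod_blaschke_le1 x))) _.
  rewrite subrK -mulrA -[leRHS]mulr1 ler_wpM2l//.
  rewrite -(@ler_pXn2r _ 2) ?nnegrE ?mulr_ge0 ?cmod_ge0// exprMn cmodM cmod_nat exprMn.
  rewrite (le_trans (ler_wpM2r (sqr_ge0 _) (ler_wpM2l (sqr_ge0 _) (sqr_cmod_inv_pole_le x))))//.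
  rewrite real_normK ?num_real// mulrAC expr1n ler_pdivrMr ?cauchy_den_gt0// mul1r.
  by have := sqr_ge0 x; lra.
Qed.

(* Cauchy-Schwarz gains a factor [2^-1/2] because the real part of a multiple of
   a Hardy-class function carries exactly half of its squared norm. *)
Lemma sqr_cmod_gauss_factor (b m : R) : 0 < b ->
  cmod (cintegral (fun x => (expR (- b * (x - m) ^+ 2))%:C * packet_factor n (z x))) ^+ 2
  <= pi / 4 * Num.sqrt (pi / (2 * b)).
Proof.
move=> b0; set J := cintegral _.
pose G x := expR (- b * (x - m) ^+ 2); pose g x := packet_factor n (z x).
pose q : R := pi / 4; have q0 : 0 < q by rewrite divr_gt0 ?pi_gt0.
have g1 x : cmod (g x) <= 1 by exact: cmod_factor_le1.
have IG : lintegrable G by exact: lintegrable_gauss.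
have cG : continuous G by exact: continuous_gauss.
have IGg : cintegrable (fun x => (G x)%:C * g x).
  apply: dominated_cintegrable IG.
    apply: ccontinuousM; last exact: ccontinuous_factor.
    by split => //= x; exact: cvg_cst.
  move=> x; rewrite cmodM cmod_real ger0_norm ?expR_ge0//.
  by rewrite -[leRHS]mulr1 ler_wpM2l ?expR_ge0.
have G2E : (fun x => G x ^+ 2) = (fun x => expR (- (2 * b) * (x - m) ^+ 2)).
  by apply/funext => x; rewrite /G -expRM_natl; congr expR; ring.
have b20 : 0 < 2 * b by rewrite mulr_gt0.
have IG2 : lintegrable (fun x => G x ^+ 2) by rewrite G2E; exact: lintegrable_gauss.
have [Ig2 _] := cintegrableM (J^*%C ^+ 2) cintegrable_sqr_factor.
have Ig2_0 : (\int[mu]_x complex.Re (J^*%C ^+ 2 * g x ^+ 2) = 0)%R.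
  have := cintegralM (J^*%C ^+ 2) cintegrable_sqr_factor.
  by rewrite cintegral_sqr_factor mulr0 cintegralE => -[].
have [IR _] := cintegrableM (J^*%C) IGg.
have JE : cmod J ^+ 2 = (\int[mu]_x complex.Re (J^*%C * ((G x)%:C * g x)))%R.
  have := cintegralM (J^*%C) IGg; rewrite -/J => /(congr1 (@complex.Re R)).
  by rewrite Re_conjM sqr_cmod !expr2 => <-.
have ub : (\int[mu]_x complex.Re (J^*%C * ((G x)%:C * g x)) <=
  \int[mu]_x (q / 2 * G x ^+ 2 + ((4 * q)^-1 * cmod J ^+ 2 * (1 + 4 * x ^+ 2)^-1 +
     (4 * q)^-1 * complex.Re (J^*%C ^+ 2 * g x ^+ 2))))%R.
  apply: le_Rintegral => //.
    apply: lintegrableD; first exact: lintegrableZ.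
    apply: lintegrableD; last exact: lintegrableZ.
    exact: lintegrableZ lintegrable_cauchy.
  move=> x _.
  have -> : complex.Re (J^*%C * ((G x)%:C * g x)) = G x * complex.Re (J^*%C * g x).
    by rewrite [_ * (_ * g x)]mulrCA; case: (J^*%C * g x) => a c /=; rewrite mul0r subr0.
  have k2 : 2 * complex.Re (J^*%C * g x) ^+ 2 =
     cmod (J^*%C * g x) ^+ 2 + complex.Re ((J^*%C * g x) ^+ 2).
    by rewrite sqr_cmod; case: (J^*%C * g x) => a c /=; ring.
  have kle : 2 * complex.Re (J^*%C * g x) ^+ 2 <=
      cmod J ^+ 2 * (1 + 4 * x ^+ 2)^-1 + complex.Re (J^*%C ^+ 2 * g x ^+ 2).
    rewrite k2 cmodM !exprMn cmod_conj lerD2r.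
    by rewrite ler_wpM2l ?sqr_ge0 ?sqr_cmod_factor_le.
  set k := complex.Re (J^*%C * g x) in kle *.
  apply: (le_trans (y := q / 2 * G x ^+ 2 + (4 * q)^-1 * (2 * k ^+ 2))).
    rewrite -subr_ge0 (_ : _ - _ = (2 * q)^-1 * (q * G x - k) ^+ 2); last first.
      by field; rewrite gt_eqF.
    by rewrite mulr_ge0 ?sqr_ge0// invr_ge0 mulr_ge0// ltW.
  by rewrite lerD2l -mulrA -mulrDr ler_wpM2l// invr_ge0 mulr_ge0// ltW.
have IC := lintegrableZ ((4 * q)^-1 * cmod J ^+ 2) lintegrable_cauchy.
have IJ := lintegrableZ (4 * q)^-1 Ig2.
rewrite RintegralD// in ub; first last.
- exact: lintegrableD.
- exact: lintegrableZ.
rewrite RintegralD// RintegralZl// RintegralZl// in ub; last exact: lintegrable_cauchy.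
rewrite RintegralZl// Ig2_0 mulr0 addr0 Rintegral_cauchy -JE in ub.
rewrite G2E Rintegral_gauss// in ub.
have e : (4 * q)^-1 * cmod J ^+ 2 * (pi / 2) = cmod J ^+ 2 / 2.
  by rewrite /q; move: (pi_gt0 R); move: (pi : R) => p p0; field; rewrite gt_eqF.
rewrite e in ub; move: ub; rewrite -/q.
set A := Num.sqrt _; set B := cmod J ^+ 2 => ub.
have h : B <= q * A by lra.
exact: h.
Qed.

End HardySide.

Section ExponentialBound.
Local Open Scope complex_scope.
Context {R : realType}.
Variables (alpha x0 : R).
Hypothesis alpha0 : 0 < alpha.

Lemma packet_saddleE (v : R) n (x : R) :
  packet alpha x0 v n (x +i* (v / (2 * alpha))) =
  (expR (- (v ^+ 2 / (4 * alpha))))%:C * cexp (0 +i* (v * x0)) *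
  ((expR (- alpha * (x - x0) ^+ 2))%:C * packet_factor n (x +i* (v / (2 * alpha)))).
Proof.
have a0 : alpha != 0 by rewrite gt_eqF.
rewrite /packet mulrA; congr (_ * _).
rewrite (_ : packet_exponent _ _ _ _ =
  ((- (v ^+ 2 / (4 * alpha)) + - alpha * (x - x0) ^+ 2) +i* (v * x0))).
  rewrite /cexp /= expRD expR0 mul1r; apply/eqP.
  by rewrite eq_complex /=; apply/andP; split; apply/eqP; ring.
apply/eqP; rewrite /packet_exponent eq_complex /=.
by apply/andP; split; apply/eqP; field.
Qed.

Lemma cmod_cintegral_packet (v : R) n : v <= 0 ->
  cmod (cintegral (fun x => packet alpha x0 v n x%:C)) <=
  expR (- (v ^+ 2 / (4 * alpha))) * Num.sqrt (pi / 4 * Num.sqrt (pi / (2 * alpha))).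
Proof.
move=> v0; pose s := v / (2 * alpha).
have s0 : s <= 0 by rewrite mulr_le0_ge0// invr_ge0 mulr_ge0// ltW.
have sH (x : R) : `|s| <= `|s| + 1 by rewrite lerDl.
have dH (x : R) : `|0 : R| <= `|s| + 1 by rewrite normr0 addr_ge0.
have pole_far (x t : R) : 0 <= t -> 1 ^+ 2 <= (1 - 2 * (t * s)) ^+ 2 + 4 * x ^+ 2.
  move=> t0; rewrite expr1n; have := sqr_ge0 x.
  have : t * s <= 0 by rewrite mulr_ge0_le0.
  by move: (t * s) => u; clear; nra.
rewrite (@contour_shift R alpha x0 v n alpha0 (cst s) (cst 0) (`|s| + 1) 1
  (fun x => is_derive_cst _ _ _) (fun x => derivable_cst _ _ _) sH dH ltr01 pole_far).
pose h x := (expR (- alpha * (x - x0) ^+ 2))%:C * packet_factor n (x +i* s).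
pose k : R[i] := (expR (- (v ^+ 2 / (4 * alpha))))%:C * cexp (0 +i* (v * x0)).
have Ih : cintegrable h.
  have cg := @continuous_gauss R alpha x0.
  apply: dominated_cintegrable (lintegrable_gauss x0 alpha0).
    apply: ccontinuousM; last exact: ccontinuous_factor.
    by split => //= x; exact: cvg_cst.
  move=> x; rewrite cmodM cmod_real ger0_norm ?expR_ge0//.
  by rewrite -[leRHS]mulr1 ler_wpM2l ?expR_ge0// cmod_factor_le1.
rewrite (_ : (fun x => _) = (fun x => k * h x)); last first.
  by apply/funext => x; rewrite /= packet_saddleE mulr1.
rewrite cintegralM// cmodM /k cmodM cmod_cexp /= expR0 mulr1 cmod_real.
rewrite ger0_norm ?expR_ge0// ler_wpM2l ?expR_ge0//.
rewrite -[leLHS]ger0_norm ?cmod_ge0// -sqrtr_sqr ler_wsqrtr//.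
exact: sqr_cmod_gauss_factor.
Qed.

Lemma exp_bound_constE : 2^-1 * Num.sqrt (2 / pi) *
    Num.sqrt (pi / 4 * Num.sqrt (pi / (2 * alpha))) =
  pi `^ (1 / 4) * 2 `^ (- (7 / 4)) * alpha `^ (- (1 / 4)) :> R.
Proof.
have p0 : 0 < pi :> R := pi_gt0 R.
have rootE (x e : R) (k : nat) : 0 < x -> (x `^ e) ^+ k = x `^ (e * k%:R).
  by move=> x0'; rewrite -powR_mulrn ?powR_ge0// -powRrM.
set l := LHS; set r := RHS.
have l0 : 0 <= l by rewrite !mulr_ge0 ?sqrtr_ge0 ?invr_ge0.
have r0 : 0 <= r by rewrite !mulr_ge0 ?powR_ge0.
apply/eqP; rewrite -(@eqrXn2 _ 4 _ _ isT l0 r0) /l /r {l r l0 r0}.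
apply/eqP; rewrite !exprMn !rootE//.
rewrite (_ : 1 / 4 * 4%:R = 1); last by field.
rewrite (_ : - (1 / 4) * 4%:R = - 1); last by field.
rewrite (_ : - (7 / 4) * 4%:R = - 7%:R); last by field.
rewrite !powRN !powRr1 ?(ltW p0) ?(ltW alpha0)// powR_mulrn//.
have sqrt4 (x : R) : 0 <= x -> Num.sqrt x ^+ 4 = x ^+ 2.
  by move=> x0'; rewrite (exprM _ 2 2) sqr_sqrtr.
rewrite !sqrt4 ?divr_ge0 ?mulr_ge0 ?sqrtr_ge0 ?(ltW p0)//.
rewrite !exprMn sqr_sqrtr ?divr_ge0 ?mulr_ge0 ?(ltW p0) ?(ltW alpha0)//.
move: (pi : R) p0 => p p0.
by field; rewrite !gt_eqF.
Qed.

Lemma coef_b_exp_bound (w : R) (n : nat) : 0 <= w ->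
  cmod (coef_b alpha x0 (- w) n) <= exp_bound alpha w.
Proof.
move=> w0; rewrite (cmod_coef_b_nat x0 alpha0).
have nw0 : - w <= 0 by rewrite oppr_le0.
have := ler_wpM2l _ (cmod_cintegral_packet n nw0).
move=> /(_ (2^-1 * Num.sqrt (2 / pi))) H.
apply: le_trans (H _) _; first by rewrite mulr_ge0 ?sqrtr_ge0 ?invr_ge0.
by rewrite sqrrN mulrCA mulrC exp_bound_constE.
Qed.

End ExponentialBound.

(** * Expansions that are uniform in a parameter *)

Section Artanh.
Context {R : realType}.
Implicit Types t : R.

Definition artanh t : R := 2^-1 * ln ((1 + t) / (1 - t)).

Lemma artanh0 : artanh 0 = 0.
Proof. by rewrite /artanh addr0 subr0 divr1 ln1 mulr0. Qed.

Lemma artanhN t : -1 < t < 1 -> artanh (- t) = - artanh t.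
Proof.
move=> /andP[t1 t2]; rewrite /artanh opprK -mulrN -lnV ?invf_div//.
by rewrite posrE divr_gt0//; lra.
Qed.

Lemma is_derive_artanh t : -1 < t < 1 -> is_derive t 1 artanh (1 - t ^+ 2)^-1.
Proof.
move=> /andP[t1 t2]; have p1 : 0 < 1 + t by lra.
have p2 : 0 < 1 - t by lra.
have q0 : 0 < (1 + t) / (1 - t) by rewrite divr_gt0.
have d1 := is_derive_add (is_derive_cst (1 : R) t 1) (is_derive_id t 1).
have d2 := is_derive_inv (f := fun t : R => 1 - t) (lt0r_neq0 p2)
  (is_derive_sub (is_derive_cst (1 : R) t 1) (is_derive_id t 1)).
have d3 : is_derive t 1 (fun t : R => (1 + t) / (1 - t)) _ := is_derive_mul d1 d2.
have := is_derive_scale 2^-1 (is_derive1_comp (g := fun t : R => (1 + t) / (1 - t))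
  (is_derive1_ln q0) d3).
move/is_derive_congr; apply; rewrite /=; field.
by rewrite !gt_eqF//; nra.
Qed.

Lemma ge0_from_derive (f df : R -> R) t : 0 <= t ->
  (forall u, 0 <= u <= t -> is_derive u 1 f (df u)) ->
  (forall u, 0 <= u <= t -> 0 <= df u) -> f 0 <= f t.
Proof.
rewrite le_eqVlt => /predU1P[<-//|t0] dF dF0.
have [] := @MVT R f df 0 t t0.
- by move=> x; rewrite in_itv /= => /andP[x0 xt]; apply: dF; rewrite !ltW.
- apply: derivable_within_continuous => x; rewrite in_itv /= => /dF.
  by case.
move=> c; rewrite in_itv /= => /andP[c0 ct] E.
by rewrite -subr_ge0 E mulr_ge0 ?subr_ge0 ?(ltW t0)// dF0// !ltW.
Qed.

Lemma artanh_le t : 0 <= t < 1 ->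
  artanh t <= t + t ^+ 3 / (3 * (1 - t ^+ 2)).
Proof.
move=> /andP[t0 t1]; rewrite -subr_ge0.
pose f (u : R) := u + u ^+ 3 * (3 * (1 - u ^+ 2))^-1 - artanh u.
have -> : 0 = f 0 by rewrite /f artanh0 expr0n /= mul0r !addr0 subrr.
pose df (u : R) := 1 + (3%:R * u ^+ 2 * 1 * (3 * (1 - u ^+ 2))^-1 +
   u ^+ 3 * (- (3 * (0 - 2%:R * u ^+ 1 * 1)) / (3 * (1 - u ^+ 2)) ^+ 2)) - (1 - u ^+ 2)^-1.
apply: (@ge0_from_derive f df) => // u /andP[u0 ut].
  have w0 : 0 < 1 - u ^+ 2 by nra.
  apply: is_derive_sub; last by apply: is_derive_artanh; lra.
  apply: is_derive_add; apply: is_derive_mul.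
    exact: (is_derive_exprn 3 (is_derive_id u 1)).
  apply: is_derive_inv; first by rewrite gt_eqF// mulr_gt0.
  apply: is_derive_scale; apply: is_derive_sub.
  exact: (is_derive_exprn 2 (is_derive_id u 1)).
have w0 : 0 < 1 - u ^+ 2 by nra.
rewrite (_ : df u = 2 * u ^+ 4 / (3 * (1 - u ^+ 2) ^+ 2)); last first.
  by rewrite /df; field; rewrite gt_eqF.
by rewrite divr_ge0 ?mulr_ge0 ?exprn_ge0// ltW.
Qed.

Lemma artanh_ge t : 0 <= t < 1 -> t + t ^+ 3 / 3 <= artanh t.
Proof.
move=> /andP[t0 t1]; rewrite -subr_ge0.
pose f (u : R) := artanh u - (u + 3^-1 * u ^+ 3).
have -> : 0 = f 0 by rewrite /f artanh0 expr0n /= mulr0 !addr0 subrr.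
rewrite [_ / 3]mulrC.
pose df (u : R) := (1 - u ^+ 2)^-1 - (1 + 3^-1 * (3%:R * u ^+ 2 * 1)).
apply: (@ge0_from_derive f df) => // u /andP[u0 ut].
  apply: is_derive_sub; first by apply: is_derive_artanh; lra.
  apply: is_derive_add; apply: is_derive_scale.
  exact: (is_derive_exprn 3 (is_derive_id u 1)).
have w0 : 0 < 1 - u ^+ 2 by nra.
rewrite (_ : df u = u ^+ 4 / (1 - u ^+ 2)); last first.
  by rewrite /df; field; rewrite gt_eqF.
by rewrite divr_ge0 ?exprn_ge0// ltW.
Qed.

End Artanh.

Section Jets.
Context {R : realType}.
Variables (P : R -> Prop) (d : R).
Hypothesis d0 : 0 <= d.
Hypothesis d1 : d <= 1.

(* [f a y = f0 a + f1 a * y + O(y ^+ 2)], uniformly in the parameter [a] with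
   [P a] and in [`|y| <= d]. *)
Definition jet (f : R -> R -> R) (f0 : R -> R) := exists (f1 : R -> R) (K : R), 0 <= K /\
  forall a y, P a -> `|y| <= d ->
  [/\ `|f0 a| <= K, `|f1 a| <= K & `|f a y - f0 a - f1 a * y| <= K * y ^+ 2].

Lemma jet_ext (f g : R -> R -> R) (f0 g0 : R -> R) : jet f f0 ->
  (forall a y, P a -> `|y| <= d -> f a y = g a y) ->
  (forall a, P a -> f0 a = g0 a) -> jet g g0.
Proof.
move=> [f1 [K [K0 HK]]] fg fg0; exists f1, K; split=> // a y Pa yd.
by rewrite -fg// -fg0//; exact: HK.
Qed.

Lemma jet_param (h : R -> R) M : (forall a, P a -> `|h a| <= M) ->
  jet (fun a _ => h a) h.
Proof.
move=> hM; exists (cst 0), `|M|; split=> // a y Pa _; split.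
- exact: le_trans (hM a Pa) (ler_norm _).
- by rewrite normr0.
- by rewrite /= subrr mul0r subr0 normr0 mulr_ge0// sqr_ge0.
Qed.

Lemma jet_cst c : jet (fun _ _ => c) (fun=> c).
Proof. exact: (@jet_param (fun=> c) `|c|). Qed.

Lemma jet_var : jet (fun _ y => y) (fun=> 0).
Proof.
exists (cst 1), 1; split=> // a y _ _; split; rewrite ?normr0 ?normr1//=.
by rewrite subr0 mul1r subrr normr0 mul1r sqr_ge0.
Qed.

Lemma jetD f g f0 g0 : jet f f0 -> jet g g0 ->
  jet (fun a y => f a y + g a y) (fun a => f0 a + g0 a).
Proof.
move=> [f1 [K [K0 HK]]] [g1 [L [L0 HL]]].
exists (fun a => f1 a + g1 a), (K + L); split; first exact: addr_ge0.
move=> a y Pa yd; have [F0 F1 F2] := HK a y Pa yd; have [G0 G1 G2] := HL a y Pa yd.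
split.
- by rewrite (le_trans (ler_normD _ _))// lerD.
- by rewrite (le_trans (ler_normD _ _))// lerD.
- rewrite (_ : _ - _ = (f a y - f0 a - f1 a * y) + (g a y - g0 a - g1 a * y)).
    by rewrite (le_trans (ler_normD _ _))// mulrDl lerD.
  by ring.
Qed.

Lemma jetN f f0 : jet f f0 -> jet (fun a y => - f a y) (fun a => - f0 a).
Proof.
move=> [f1 [K [K0 HK]]]; exists (fun a => - f1 a), K; split=> // a y Pa yd.
have [F0 F1 F2] := HK a y Pa yd; split; rewrite ?normrN//.
rewrite (_ : _ - _ = - (f a y - f0 a - f1 a * y)) ?normrN//.
by ring.
Qed.

Lemma jetB f g f0 g0 : jet f f0 -> jet g g0 ->
  jet (fun a y => f a y - g a y) (fun a => f0 a - g0 a).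
Proof. by move=> jf /jetN; exact: jetD. Qed.

Lemma jet_bounded f f0 : jet f f0 ->
  exists2 K, 0 <= K & forall a y, P a -> `|y| <= d ->
  `|f0 a| <= K /\ `|f a y - f0 a| <= K * `|y|.
Proof.
move=> [f1 [K [K0 HK]]]; exists (2 * K); first exact: mulr_ge0.
move=> a y Pa yd; have [F0 F1 F2] := HK a y Pa yd.
split; first by rewrite mulr2n mulrDl !mul1r (le_trans F0)// lerDl.
rewrite (_ : _ - _ = (f a y - f0 a - f1 a * y) + f1 a * y); last by ring.
rewrite (le_trans (ler_normD _ _))// mulrDl mul1r mulrDl lerD//.
  rewrite (le_trans F2)// ler_wpM2l// -real_normK ?num_real// expr2.
  by rewrite ler_piMl// (le_trans yd).
by rewrite normrM ler_wpM2r.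
Qed.

Lemma jetM f g f0 g0 : jet f f0 -> jet g g0 ->
  jet (fun a y => f a y * g a y) (fun a => f0 a * g0 a).
Proof.
move=> jf jg; have [M M0 HM] := jet_bounded jg.
move: jf jg => [f1 [K [K0 HK]]] [g1 [L [L0 HL]]].
exists (fun a => f0 a * g1 a + f1 a * g0 a), (2 * (K * L) + K * (2 * M) + 2 * (K * L)).
have KL := mulr_ge0 K0 L0; have KM := mulr_ge0 K0 M0.
split; first by rewrite !addr_ge0 ?mulr_ge0.
move=> a y Pa yd; have [F0 F1 F2] := HK a y Pa yd; have [G0 G1 G2] := HL a y Pa yd.
have [_ g0M] := HM a y Pa yd; have [g00M _] := HM a y Pa yd.
have y1 : `|y| <= 1 by exact: le_trans yd d1.
have y2 : y ^+ 2 <= 1 by rewrite -real_normK ?num_real// exprn_ile1.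
have KM2 : 0 <= K * (2 * M) by rewrite mulr_ge0// mulr_ge0.
split.
- rewrite normrM (le_trans (ler_pM _ _ F0 G0))//.
  by rewrite mulr2n mulrDl !mul1r; lra.
- rewrite (le_trans (ler_normD _ _))// !normrM.
  have := ler_pM (normr_ge0 _) (normr_ge0 _) F0 G1.
  have := ler_pM (normr_ge0 _) (normr_ge0 _) F1 G0.
  by lra.
- have gB : `|g a y| <= 2 * M.
    rewrite -[g a y](subrK (g0 a)) (le_trans (ler_normD _ _))//.
    rewrite mulr2n mulrDl mul1r lerD// (le_trans g0M)// ler_piMr//.
  have fB : `|f0 a + f1 a * y| <= 2 * K.
    rewrite (le_trans (ler_normD _ _))// mulr2n mulrDl mul1r lerD//.
    by rewrite normrM -[leRHS]mulr1 ler_pM.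
  rewrite (_ : _ - _ = (f a y - f0 a - f1 a * y) * g a y +
    (f0 a + f1 a * y) * (g a y - g0 a - g1 a * y) + f1 a * g1 a * y ^+ 2); last by ring.
  have h1 : `|(f a y - f0 a - f1 a * y) * g a y| <= K * (2 * M) * y ^+ 2.
    by rewrite normrM [leRHS]mulrAC ler_pM.
  have h2 : `|(f0 a + f1 a * y) * (g a y - g0 a - g1 a * y)| <= 2 * (K * L) * y ^+ 2.
    by rewrite normrM [2 * _]mulrA -mulrA ler_pM.
  have h3 : `|f1 a * g1 a * y ^+ 2| <= 2 * (K * L) * y ^+ 2.
    rewrite normrM [`|y ^+ 2|]ger0_norm ?sqr_ge0// ler_wpM2r ?sqr_ge0//.
    by rewrite normrM (le_trans (ler_pM _ _ F1 G1))// mulr2n mulrDl mul1r lerDl.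
  apply: le_trans (ler_normD _ _) _; rewrite [leRHS]mulrDl; apply: lerD h3.
  apply: le_trans (ler_normD _ _) _; rewrite [leRHS]mulrDl addrC; exact: lerD.
Qed.

Lemma jetV f f0 b : 0 < b -> jet f f0 ->
  (forall a y, P a -> `|y| <= d -> b <= f a y) ->
  jet (fun a y => (f a y)^-1) (fun a => (f0 a)^-1).
Proof.
move=> b0 jf fb; have [M M0 HM] := jet_bounded jf.
move: jf => [f1 [K [K0 HK]]].
have f0b a : P a -> b <= f0 a.
  move=> Pa; have := HM a 0 Pa; rewrite normr0 => /(_ d0)[_].
  by rewrite mulr0 normr_le0 subr_eq0 => /eqP <-; apply: fb => //; rewrite normr0.
exists (fun a => - f1 a / f0 a ^+ 2), (b^-1 + K * b ^- 2 + (K * K + K * M) * b ^- 3).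
have bV : 0 <= b^-1 by rewrite invr_ge0 ltW.
have c1 : 0 <= K * b ^- 2 by rewrite mulr_ge0// -exprVn exprn_ge0.
have c2 : 0 <= (K * K + K * M) * b ^- 3.
  by rewrite mulr_ge0 ?addr_ge0 ?mulr_ge0// -exprVn exprn_ge0.
split; first by rewrite !addr_ge0.
move=> a y Pa yd; have [F0 F1 F2] := HK a y Pa yd.
have [_ fM] := HM a y Pa yd.
have fb0 := fb a y Pa yd; have f0b0 := f0b a Pa.
have f0p : 0 < f0 a by exact: lt_le_trans f0b0.
have fp : 0 < f a y by exact: lt_le_trans fb0.
have iv0 : `|(f0 a)^-1| <= b^-1.
  by rewrite ger0_norm ?invr_ge0 ?(ltW f0p)// lef_pV2// posrE.
have iv : `|(f a y)^-1| <= b^-1.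
  by rewrite ger0_norm ?invr_ge0 ?(ltW fp)// lef_pV2// posrE.
have iv2 : `|(f0 a)^-1| ^+ 2 <= b^-1 ^+ 2 by rewrite lerXn2r// nnegrE.
split.
- by rewrite (le_trans iv0)// -addrA lerDl addr_ge0.
- rewrite normrM normrN -exprVn normrX.
  apply: le_trans (ler_pM (normr_ge0 _) (exprn_ge0 _ (normr_ge0 _)) F1 iv2) _.
  by rewrite exprVn -addrA addrCA lerDl addr_ge0.
- rewrite (_ : _ - _ = (f0 a)^-1 ^+ 2 * (f a y)^-1 *
     (- f0 a * (f a y - f0 a - f1 a * y) + f1 a * y * (f a y - f0 a))); last first.
    by field; rewrite !gt_eqF.
  rewrite normrM.
  have h1 : `|(f0 a)^-1 ^+ 2 * (f a y)^-1| <= b ^- 3.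
    by rewrite normrM normrX -exprVn [leRHS]exprSr; rewrite ler_pM ?exprn_ge0.
  have h2 : `|- f0 a * (f a y - f0 a - f1 a * y) + f1 a * y * (f a y - f0 a)| <=
      (K * K + K * M) * y ^+ 2.
    rewrite (le_trans (ler_normD _ _))// mulrDl lerD//.
      by rewrite normrM normrN -mulrA ler_pM.
    rewrite normrM -[y ^+ 2]real_normK ?num_real// normrM.
    rewrite (_ : K * M * _ = (K * `|y|) * (M * `|y|)); last by ring.
    by rewrite ler_pM ?mulr_ge0// ler_wpM2r.
  rewrite (le_trans (ler_pM _ _ h1 h2))// mulrA [_ * (_ + _)]mulrC.
  by rewrite ler_wpM2r ?sqr_ge0// lerDr addr_ge0.
Qed.

Lemma jetX f f0 n : jet f f0 -> jet (fun a y => f a y ^+ n) (fun a => f0 a ^+ n).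
Proof.
move=> jf; elim: n => [|n IHn].
  by apply: jet_ext (jet_cst 1) _ _ => *; rewrite expr0.
by apply: jet_ext (jetM jf IHn) _ _ => *; rewrite exprS.
Qed.

End Jets.

(** * The contour through the saddle points *)

Section Bend.
Context {R : realType}.
Implicit Types a x : R.

Definition bend a x : R := 2 * a * (x ^+ 2 - a ^+ 2) / (x ^+ 2 + 3 * a ^+ 2).

Definition dbend a x : R := 16 * a ^+ 3 * x / (x ^+ 2 + 3 * a ^+ 2) ^+ 2.

Lemma bend_den_gt0 a x : 0 < a -> 0 < x ^+ 2 + 3 * a ^+ 2.
Proof. by move=> a0; nra. Qed.

Lemma is_derive_bend a x : 0 < a -> is_derive x 1 (bend a) (dbend a x).
Proof.
move=> a0; have den0 := bend_den_gt0 x a0.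
have d1 : is_derive x 1 (fun x : R => 2 * a * (x ^+ 2 - a ^+ 2))
    (2 * a * (2%:R * x ^+ 1 * 1 - 0)).
  apply: is_derive_scale; apply: is_derive_sub.
  exact: (is_derive_exprn 2 (is_derive_id x 1)).
have d2 : is_derive x 1 (fun x : R => x ^+ 2 + 3 * a ^+ 2) (2%:R * x ^+ 1 * 1 + 0).
  apply: is_derive_add.
  exact: (is_derive_exprn 2 (is_derive_id x 1)).
have d3 := is_derive_inv (f := fun x : R => x ^+ 2 + 3 * a ^+ 2) (lt0r_neq0 den0) d2.
apply: is_derive_congr (is_derive_mul d1 d3) _.
by rewrite /dbend; field; rewrite gt_eqF.
Qed.

Lemma derivable_dbend a x : 0 < a -> derivable (dbend a) x 1.
Proof.
move=> a0; have den0 := bend_den_gt0 x a0.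
have d2 : is_derive x 1 (fun x : R => x ^+ 2 + 3 * a ^+ 2) (2%:R * x ^+ 1 * 1 + 0).
  apply: is_derive_add.
  exact: (is_derive_exprn 2 (is_derive_id x 1)).
have d3 := is_derive_inv (f := fun x : R => (x ^+ 2 + 3 * a ^+ 2) ^+ 2)
  (expf_neq0 2 (lt0r_neq0 den0)) (is_derive_exprn 2 d2).
by case: (is_derive_mul (is_derive_scale (16 * a ^+ 3) (is_derive_id x 1)) d3).
Qed.

Lemma bendN a x : bend a (- x) = bend a x.
Proof. by rewrite /bend sqrrN. Qed.

Lemma bend_sub a y : 0 < a ->
  bend a (a + y) = y * (1 - y ^+ 2 / ((a + y) ^+ 2 + 3 * a ^+ 2)).
Proof.
move=> a0; rewrite /bend; have den0 := bend_den_gt0 (a + y) a0.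
by field; rewrite gt_eqF.
Qed.

Lemma normr_dbend_le a x : 0 < a -> `|dbend a x| <= 1.
Proof.
move=> a0; have den0 := bend_den_gt0 x a0.
rewrite /dbend normrM normfV [`|_ ^+ 2|]gtr0_norm ?exprn_gt0//.
rewrite ler_pdivrMr ?exprn_gt0// mul1r ler_norml; apply/andP; split.
  rewrite -subr_ge0 (_ : _ - _ = (x + a) ^+ 2 * ((x - a) ^+ 2 + 8 * a ^+ 2)); last by ring.
  by rewrite mulr_ge0 ?sqr_ge0// addr_ge0 ?sqr_ge0// mulr_ge0// sqr_ge0.
rewrite -subr_ge0 (_ : _ - _ = (x - a) ^+ 2 * ((x + a) ^+ 2 + 8 * a ^+ 2)); last by ring.
by rewrite mulr_ge0 ?sqr_ge0// addr_ge0 ?sqr_ge0// mulr_ge0// sqr_ge0.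
Qed.

Lemma normr_bend_le a x : 0 < a -> `|bend a x| <= 2 * a.
Proof.
move=> a0; have den0 := bend_den_gt0 x a0.
rewrite /bend normrM normfV (gtr0_norm den0) ler_pdivrMr// normrM.
rewrite gtr0_norm ?mulr_gt0// ler_wpM2l ?mulr_ge0 ?(ltW a0)//.
have := sqr_ge0 x; have := sqr_ge0 a.
by rewrite ler_norml => *; apply/andP; split; lra.
Qed.

Lemma bend_ge0 a x : 0 < a -> a <= x -> 0 <= bend a x <= x - a.
Proof.
move=> a0 ax; have den0 := bend_den_gt0 x a0; apply/andP; split.
  by rewrite divr_ge0 ?(ltW den0)// mulr_ge0 ?mulr_ge0 ?(ltW a0)//; nra.
rewrite ler_pdivrMr// -subr_ge0.
rewrite (_ : _ - _ = (x - a) * (x - a) ^+ 2); last by ring.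
by rewrite mulr_ge0 ?sqr_ge0// subr_ge0.
Qed.

Lemma bend_le0 a x : 0 < a -> 0 <= x <= a -> x - a <= bend a x <= 0.
Proof.
move=> a0 /andP[x0 xa]; have den0 := bend_den_gt0 x a0; apply/andP; split.
  rewrite ler_pdivlMr// -subr_ge0.
  rewrite (_ : _ - _ = (a - x) * (x - a) ^+ 2); last by ring.
  by rewrite mulr_ge0 ?sqr_ge0// subr_ge0.
rewrite ler_pdivrMr// mul0r.
by rewrite mulr_ge0_le0 ?mulr_ge0 ?(ltW a0)//; nra.
Qed.

Lemma normr_bend_sub a x : 0 < a -> 0 <= x -> `|bend a x| <= `|x - a|.
Proof.
move=> a0 x0; have [ax|xa] := lerP a x.
  have /andP[s0 s1] := bend_ge0 a0 ax.
  by rewrite !ger0_norm// subr_ge0.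
have xa' : 0 <= x <= a by rewrite x0 ltW.
have /andP[s0 s1] := bend_le0 a0 xa'.

by rewrite (ler0_norm s1); lra.
Qed.

(* Squared moduli of [1 + 2 i z] and [1 - 2 i z] at [z = x + i * bend a x]. *)
Definition low a x : R := (1 - 2 * bend a x) ^+ 2 + 4 * x ^+ 2.
Definition high a x : R := (1 + 2 * bend a x) ^+ 2 + 4 * x ^+ 2.

Lemma low_ge a x : 0 < a -> Num.min 1 (4 * a ^+ 2) <= low a x.
Proof.
move=> a0; have den0 := bend_den_gt0 x a0; rewrite ge_min /low.
have [x2|x2] := lerP (a ^+ 2) (x ^+ 2); apply/orP; [right|left].
  by have := sqr_ge0 (1 - 2 * bend a x); lra.
have : bend a x <= 0.
  by rewrite /bend ler_pdivrMr// mul0r mulr_ge0_le0 ?mulr_ge0 ?(ltW a0)//; lra.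
by have := sqr_ge0 x; nra.
Qed.

Lemma low_gt0 a x : 0 < a -> 0 < low a x.
Proof.
move=> a0; apply: lt_le_trans (low_ge x a0).
by rewrite lt_min ltr01 mulr_gt0// exprn_gt0.
Qed.

Definition midN a x : R := 1 + 4 * bend a x ^+ 2 + 4 * x ^+ 2.

Lemma midN_ge1 a x : 1 <= midN a x.
Proof.
by rewrite /midN -addrA lerDl addr_ge0// mulr_ge0// sqr_ge0.
Qed.

Lemma ratioE a x : 0 < a -> let t := 4 * bend a x / midN a x in
  high a x / low a x = (1 + t) / (1 - t) /\ t < 1.
Proof.
move=> a0 t; have N0 : 0 < midN a x by exact: lt_le_trans ltr01 (midN_ge1 a x).
have lowE : low a x = midN a x - 4 * bend a x by rewrite /low /midN; ring.
have highE : high a x = midN a x + 4 * bend a x by rewrite /high /midN; ring.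
have low0 := low_gt0 x a0; have t1 : t < 1.
  by rewrite /t ltr_pdivrMr// mul1r -subr_gt0 -lowE.
split=> //; rewrite highE lowE /t; field.
by rewrite -lowE !gt_eqF.
Qed.

Lemma ratio_le (t U : R) : -1 < t < 1 -> artanh t <= U ->
  (1 + t) / (1 - t) <= expR (2 * U).
Proof.
move=> /andP[t1 t2] tU; have q0 : 0 < (1 + t) / (1 - t) by rewrite divr_gt0//; lra.
rewrite -[leLHS]lnK ?posrE// ler_expR.
by move: tU; rewrite /artanh; lra.
Qed.

Lemma ratio_neg_le (t : R) : -1 <= t <= 0 -> (1 + t) / (1 - t) <= expR (2 * t).
Proof.
move=> /andP[]; rewrite le_eqVlt => /predU1P[<- _|t1 t0].
  by rewrite subrr mul0r expR_ge0.
apply: ratio_le; first by rewrite t1/=; lra.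
rewrite -[t]opprK artanhN; last by apply/andP; split; lra.
have t01 : 0 <= - t < 1 by apply/andP; split; lra.
rewrite lerN2 (le_trans _ (artanh_ge t01))// lerDl divr_ge0// exprn_ge0//.
by rewrite oppr_ge0.
Qed.

End Bend.

Section NearFar.
Context {R : realType}.
Variables a0 a1 d : R.
Hypothesis a00 : 0 < a0.
Hypothesis d0 : 0 < d.
Hypothesis d1 : d <= 1.
Hypothesis da0 : d <= a0 / 2.

Let P (a : R) : Prop := a0 <= a <= a1.
Let jt := jet P d.
Let d0' := ltW d0.

Let P_gt0 a : P a -> 0 < a.
Proof. by move=> /andP[h _]; exact: lt_le_trans h. Qed.

Let jetA : jt (fun a _ => a) id.
Proof.
apply: (@jet_param R P d id a1) => a Pa; have a_gt0 := P_gt0 Pa.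
by rewrite ger0_norm ?(ltW a_gt0)//; case/andP: Pa.
Qed.

Let jetY : jt (fun _ y => y) (fun=> 0).
Proof. exact: jet_var. Qed.

Let jetC c : jt (fun _ _ => c) (fun=> c).
Proof. exact: jet_cst. Qed.

Local Notation jM := (jetM d1).
Local Notation jX := (jetX d1).

Let den (a y : R) := (a + y) ^+ 2 + 3 * a ^+ 2.
Let u (a y : R) := 1 - y ^+ 2 * (den a y)^-1.
Let N (a y : R) := 1 + 4 * (y * u a y) ^+ 2 + 4 * (a + y) ^+ 2.
Let m (a y : R) := 8 * a + 4 * y + 4 * y * u a y ^+ 2.

Let jet_u : jt u (fun=> 1).
Proof.
have jden : jt den (fun a => (a + 0) ^+ 2 + 3 * a ^+ 2).
  exact: jetD (jX 2 (jetD jetA jetY)) (jM (jetC 3) (jX 2 jetA)).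
have a02 : 0 < 3 * a0 ^+ 2 by rewrite mulr_gt0// exprn_gt0.
have jdV := jetV d0' d1 a02 jden.
apply: jet_ext (jetB (jetC 1) (jM (jX 2 jetY) (jdV _))) _ _.
- move=> a y /andP[h1 h2] _; rewrite /den.
  have : a0 ^+ 2 <= a ^+ 2 by rewrite lerXn2r ?nnegrE ?(ltW a00)// (le_trans (ltW a00)).
  by have := sqr_ge0 (a + y); lra.
- by [].
- by move=> a Pa; rewrite expr0n /= mul0r subr0.
Qed.

Let jet_N : jt N (fun a => 1 + 4 * a ^+ 2).
Proof.
apply: jet_ext (jetD (jetD (jetC 1) (jM (jetC 4) (jX 2 (jM jetY jet_u))))
  (jM (jetC 4) (jX 2 (jetD jetA jetY)))) _ _ => //.
by move=> a Pa; ring.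
Qed.

Let N_ge1 a y : 1 <= N a y.
Proof. by rewrite /N -addrA lerDl addr_ge0// mulr_ge0// sqr_ge0. Qed.

Let jet_NV : jt (fun a y => (N a y)^-1) (fun a => (1 + 4 * a ^+ 2)^-1).
Proof. exact: (jetV d0' d1 ltr01 jet_N (fun a y _ _ => N_ge1 a y)). Qed.

Let jet_m : jt m (fun a => 8 * a).
Proof.
apply: jet_ext (jetD (jetD (jM (jetC 8) jetA) (jM (jetC 4) jetY))
  (jM (jM (jetC 4) jetY) (jX 2 jet_u))) _ _ => //.
by move=> a Pa; ring.
Qed.

Let kappa (a : R) := 8 * a / (1 + 4 * a ^+ 2).

Let jet_main : jt (fun a y => u a y * m a y * (N a y)^-1) kappa.
Proof.
apply: jet_ext (jM (jM jet_u jet_m) jet_NV) _ _ => //.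
by move=> a Pa; rewrite mul1r.
Qed.

Let jet_cubic : jt (fun a y => (a ^+ 2 + 1 / 4) * (64 / 3) * (u a y * (N a y)^-1) ^+ 3)
  (fun a => (a ^+ 2 + 1 / 4) * (64 / 3) * (1 * (1 + 4 * a ^+ 2)^-1) ^+ 3).
Proof.
exact: jM (jM (jetD (jX 2 jetA) (jetC (1 / 4))) (jetC (64 / 3))) (jX 3 (jM jet_u jet_NV)).
Qed.

Let bendE a y : P a -> bend a (a + y) = y * u a y.
Proof. by move=> /P_gt0 ap; exact: bend_sub. Qed.

Let midNE a y : P a -> midN a (a + y) = N a y.
Proof. by move=> Pa; rewrite /midN bendE. Qed.

Let N1 := 1 + 4 + 4 * (a1 + 1) ^+ 2.

Let near_x a y : P a -> `|y| <= d -> a0 / 2 <= a + y <= a1 + 1.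
Proof.
move=> /andP[h1 h2] /ler_normlP[y1 y2]; have := d1; have := da0.
by move=> *; apply/andP; split; lra.
Qed.

Let near_facts a y : P a -> `|y| <= d ->
  [/\ `|y * u a y| <= `|y|, N a y <= N1 & a0 ^+ 2 <= N a y - 4 * `|y * u a y| ].
Proof.
move=> Pa yd; have ap := P_gt0 Pa.
have /andP[x1 x2] := near_x Pa yd.
have x0 : 0 <= a + y by apply: le_trans x1; rewrite divr_ge0// ltW.
have s1 : `|y * u a y| <= `|y|.
  by rewrite -bendE// (le_trans (normr_bend_sub ap x0))// addrAC subrr add0r.
have y1 : `|y| <= 1 by exact: le_trans yd d1.
have xx : (a + y) ^+ 2 <= (a1 + 1) ^+ 2.
  by rewrite lerXn2r// nnegrE// (le_trans x0).
have xx0 : (a0 / 2) ^+ 2 <= (a + y) ^+ 2.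
  by rewrite lerXn2r// nnegrE// divr_ge0// ltW.
split=> //.
- rewrite /N /N1 -[(y * _) ^+ 2]real_normK ?num_real//.
  have : `|y * u a y| ^+ 2 <= 1 by rewrite exprn_ile1// (le_trans s1).
  by lra.
- rewrite /N -[(y * u a y) ^+ 2]real_normK ?num_real//.
  move: (`|y * u a y|) => s; move: xx0; rewrite exprMn.
  by have := sqr_ge0 (1 - 2 * s); nra.
Qed.

Let e0 := a0 ^+ 2 / N1.

Let fifth_power : exists2 C : R, 0 <= C & forall t y : R, 0 <= t <= 1 ->
  t <= 4 * `|y| -> t ^+ 5 <= C * y ^+ 4.
Proof.
exists (4 ^+ 4); first exact: exprn_ge0.
move=> t y /andP[t0 t1] ty; rewrite exprS.
apply: (le_trans (y := t ^+ 4)); first by rewrite ler_piMl// exprn_ge0.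
have -> : y ^+ 4 = `|y| ^+ 4.
  by rewrite [RHS](exprM _ 2 2) real_normK ?num_real// -exprM.
by rewrite -exprMn lerXn2r// nnegrE mulr_ge0.
Qed.

Lemma decay_near : exists2 K, 0 <= K & forall a, a0 <= a <= a1 ->
  exists2 c, `|c| <= K & forall y, `|y| <= d ->
  high a (a + y) / low a (a + y) <= expR (2 * ((bend a (a + y) -
    (8 * a / (1 + 4 * a ^+ 2) * y ^+ 2 + c * y ^+ 3 - K * y ^+ 4)) / (a ^+ 2 + 1 / 4))).
Proof.
have [f1 [K1 [K10 H1]]] := jet_main.
have [K2 K20 H2] := jet_bounded d1 jet_cubic.
pose h0 (a : R) := (a ^+ 2 + 1 / 4) * (64 / 3) * (1 * (1 + 4 * a ^+ 2)^-1) ^+ 3.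
have [C C0 HC] := fifth_power.
pose K3 := (a1 ^+ 2 + 1 / 4) * (C / (3 * e0)).
have N10 : 0 < N1 by rewrite /N1 ltr_wpDr// mulr_ge0// sqr_ge0.
have e00 : 0 < e0 by rewrite divr_gt0// exprn_gt0.
have K30 : 0 <= K3.
  have a12 := sqr_ge0 a1.
  by rewrite mulr_ge0 ?addr_ge0// divr_ge0// mulr_ge0// ltW.
exists (K1 + K2 + K3); first by rewrite !addr_ge0.
move=> a Pa; have ap := P_gt0 Pa.
have z0 : `|0 : R| <= d by rewrite normr0 ltW.
exists (f1 a - h0 a).
  have [_ F1 _] := H1 a 0 Pa z0; have [F2 _] := H2 a 0 Pa z0.
  rewrite (le_trans (ler_normD _ _))// normrN -[leLHS]addr0 lerD//.
  exact: lerD.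
move=> y yd; have [s1 NN1 Nlow] := near_facts Pa yd.
have [_ _ F1] := H1 a y Pa yd; have [_ F2] := H2 a y Pa yd.
have N0 : 0 < N a y by exact: lt_le_trans ltr01 (N_ge1 a y).
have [-> t1] := ratioE (a + y) ap; rewrite /= midNE// bendE// in t1 *.
set s := y * u a y in s1 Nlow t1 *.
set t := 4 * s / N a y in t1 *.
have tabs : `|t| <= 1 - e0.
  rewrite /t normrM normfV (gtr0_norm N0) normrM normr_nat ler_pdivrMr// mulrBl mul1r.
  rewrite lerBrDr -lerBrDl (le_trans _ Nlow)// /e0 mulrAC ler_pdivrMr// ler_wpM2l ?sqr_ge0//.
have t4 : `|t| <= 4 * `|y|.
  rewrite /t normrM normfV (gtr0_norm N0) normrM normr_nat ler_pdivrMr//.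
  rewrite -mulrA ler_wpM2l// (le_trans s1)// ler_peMr//; exact: N_ge1.
have t1' : -1 < t < 1 by rewrite -ltr_norml (le_lt_trans tabs)// ltrBlDr ltrDl.
apply: ratio_le => //.
rewrite ler_pdivlMr ?ltr_wpDl ?sqr_ge0// mulrC.
set rho := a ^+ 2 + 1 / 4; have rho0 : 0 < rho by rewrite ltr_wpDl ?sqr_ge0.
have artanh_ub : artanh t <= t + t ^+ 3 / 3 + C / (3 * e0) * y ^+ 4.
  have rem0 : 0 <= C / (3 * e0) * y ^+ 4.
    by rewrite mulr_ge0 ?exprn_even_ge0// divr_ge0// mulr_ge0// ltW.
  have [t0|t0] := lerP 0 t.
    rewrite ger0_norm// in tabs t4.
    apply: le_trans (artanh_le _) _; first by rewrite t0; case/andP: t1'.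
    have w0 : e0 <= 1 - t ^+ 2 by nra.
    have w1 : 0 < 1 - t ^+ 2 by exact: lt_le_trans w0.
    rewrite (_ : t + _ / (3 * _) = t + t ^+ 3 / 3 + t ^+ 5 / (3 * (1 - t ^+ 2))); last first.
      by field; rewrite gt_eqF.
    rewrite lerD2l.
    have t5 : t ^+ 5 <= C * y ^+ 4.
      by apply: HC => //; rewrite t0; case/andP: t1' => _ /ltW.
    rewrite [leRHS]mulrAC ler_pM ?exprn_ge0//.
      by rewrite invr_ge0 mulr_ge0// ltW.
    have v0 : 0 < 3 * e0 by rewrite mulr_gt0.
    have v1 : 3 * e0 <= 3 * (1 - t ^+ 2) by rewrite ler_wpM2l.
    by rewrite lef_pV2// posrE// (lt_le_trans v0).
  have t0' : 0 <= - t < 1 by case/andP: t1' => h1 h2; rewrite oppr_ge0 (ltW t0) ltrNl h1.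
  have := artanh_ge t0'; rewrite artanhN// -[artanh t]opprK => h.
  rewrite (le_trans (y := t + t ^+ 3 / 3)) ?lerDl//.
  move: h; rewrite (_ : (- t) ^+ 3 = - t ^+ 3); last by ring.
  by move: (artanh (- t)) (artanh t) (t ^+ 3) => A1 A2 A3; lra.
have main_eq : s - rho * t = y ^+ 2 * (u a y * m a y * (N a y)^-1).
  rewrite /t /rho /s (_ : _ - _ = y * u a y * (N a y - (1 + 4 * a ^+ 2)) * (N a y)^-1).
    by rewrite (_ : N a y - _ = y * m a y); [ring|rewrite /N /m; ring].
  by field; rewrite gt_eqF.
have cub_eq : rho * (t ^+ 3 / 3) = y ^+ 3 *
    (rho * (64 / 3) * (u a y * (N a y)^-1) ^+ 3).
  by rewrite /t /s; field; rewrite gt_eqF.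
have y4 : 0 <= y ^+ 4 by rewrite exprn_even_ge0.
have K3ub : rho * (C / (3 * e0) * y ^+ 4) <= K3 * y ^+ 4.
  rewrite mulrA ler_wpM2r// ler_wpM2r//.
    by rewrite divr_ge0// mulr_ge0// ltW.
  by rewrite lerD2r lerXn2r ?nnegrE ?(ltW ap)//; case/andP: Pa => *; lra.
have main_lb : kappa a * y ^+ 2 + f1 a * y ^+ 3 - K1 * y ^+ 4 <=
    y ^+ 2 * (u a y * m a y * (N a y)^-1).
  have /ler_normlP[] := F1; move: (u a y * m a y * _) => A A1 A2.
  rewrite (_ : _ - _ = y ^+ 2 * (kappa a + f1 a * y - K1 * y ^+ 2)); last by ring.
  by rewrite ler_wpM2l ?sqr_ge0//; lra.
have cub_ub : y ^+ 3 * (rho * (64 / 3) * (u a y * (N a y)^-1) ^+ 3) <=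
    h0 a * y ^+ 3 + K2 * y ^+ 4.
  rewrite -lerBlDl (_ : _ - _ = y ^+ 3 * (rho * (64 / 3) * (u a y * (N a y)^-1) ^+ 3 - h0 a)); last by ring.
  rewrite (le_trans (ler_norm _))// normrM (le_trans (ler_wpM2l (normr_ge0 _) F2))//.
  rewrite normrX mulrCA -exprSr (exprM _ 2 2) real_normK ?num_real// -exprM.
  by [].
have := ler_wpM2l (ltW rho0) artanh_ub; rewrite !mulrDr cub_eq.
move: main_eq main_lb cub_ub K3ub; rewrite /kappa /s.
move: (y ^+ 2 * _) (y ^+ 3 * (rho * _ * _)) (rho * (C / _ * _)) => A B D.
by lra.
Qed.

Lemma low_near : exists2 K, 0 <= K & forall a, a0 <= a <= a1 ->
  exists2 l, `|l| <= K & forall y, `|y| <= d ->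
  (Num.sqrt (low a (a + y)))^-1 <=
  (Num.sqrt (1 + 4 * a ^+ 2))^-1 * expR (l * y + K * y ^+ 2).
Proof.
pose b := Num.min 1 (4 * a0 ^+ 2).
have b0 : 0 < b by rewrite lt_min ltr01 mulr_gt0// exprn_gt0.
pose L (a y : R) := N a y - 4 * (y * u a y).
have lowE a y : P a -> low a (a + y) = L a y.
  by move=> Pa; rewrite /low /L bendE// /N; ring.
have jL : jt L (fun a => 1 + 4 * a ^+ 2).
  apply: jet_ext (jetB jet_N (jM (jetC 4) (jM jetY jet_u))) _ _ => //.
  by move=> a Pa; ring.
have Lb a y : P a -> `|y| <= d -> b <= L a y.
  move=> Pa yd; rewrite -lowE// (le_trans _ (low_ge _ (P_gt0 Pa)))//.
  rewrite le_min !ge_min lexx/=; apply/orP; right.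
  rewrite ler_wpM2l// lerXn2r ?nnegrE ?(ltW a00) ?(ltW (P_gt0 Pa))//.
  by case/andP: Pa.
have jB0 : jt (fun a _ => 1 + 4 * a ^+ 2) (fun a => 1 + 4 * a ^+ 2).
  exact: jetD (jetC 1) (jM (jetC 4) (jX 2 jetA)).
have jLV := jetV d0' d1 b0 jL Lb.
have [f1 [K [K0 HK]]] := jM (jetC 2^-1) (jM (jetB jB0 jL) jLV).
exists K => // a Pa; have ap := P_gt0 Pa.
have z0 : `|0 : R| <= d by rewrite normr0 ltW.
exists (f1 a); first by have [] := HK a 0 Pa z0.
move=> y yd; have [_ _ HQ] := HK a y Pa yd.
rewrite subrr mul0r mulr0 subr0 in HQ.
have L0 : 0 < L a y by rewrite (lt_le_trans b0)// Lb.
have B0 : 0 < 1 + 4 * a ^+ 2 by rewrite ltr_wpDr// mulr_ge0// sqr_ge0.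
rewrite lowE//; set Q := 2^-1 * _ in HQ.
have QE : 2 * Q = (1 + 4 * a ^+ 2) / L a y - 1.
  by rewrite /Q; field; rewrite gt_eqF.
have Qle : Q <= f1 a * y + K * y ^+ 2.
  by rewrite -lerBlDl (le_trans (ler_norm _)).
have H : (L a y)^-1 <= (1 + 4 * a ^+ 2)^-1 * expR Q ^+ 2.
  rewrite mulrC ler_pdivlMr// -expRM_natl QE mulrC.
  by rewrite (le_trans _ (expR_ge1Dx _))// [leRHS]addrCA subrr addr0.
apply: (le_trans (y := (Num.sqrt (1 + 4 * a ^+ 2))^-1 * expR Q)); last first.
  by rewrite ler_wpM2l ?invr_ge0 ?sqrtr_ge0// ler_expR.
rewrite -(@ler_pXn2r _ 2) ?nnegrE ?mulr_ge0 ?invr_ge0 ?sqrtr_ge0 ?expR_ge0//.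
by rewrite exprMn !exprVn !sqr_sqrtr ?(ltW L0) ?(ltW B0).
Qed.

End NearFar.

Section Far.
Context {R : realType}.
Variables a0 a1 d : R.
Hypothesis a00 : 0 < a0.
Hypothesis d0 : 0 < d.

Lemma decay_far : exists2 k, 0 < k & forall a x, a0 <= a <= a1 -> 0 <= x ->
  d <= `|x - a| ->
  high a x / low a x <= expR (2 * ((bend a x - k) / (a ^+ 2 + 1 / 4))).
Proof.
pose th := d / (a1 + d).
pose k1 := 2 / 3 * a0 * th ^+ 2 * (a0 ^+ 2 / (1 + 8 * a0 ^+ 2)).
pose k2 := d ^+ 2 * a0 / (2 * (1 + 8 * a1 ^+ 2)).
have [a1p|a1n] := ltP 0 a1; last first.
  exists 1 => // a x /andP[h1 h2]; have := lt_le_trans a00 (le_trans h1 (le_trans h2 a1n)).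
  by rewrite ltxx.
have th0 : 0 < th by rewrite divr_gt0// addr_gt0.
have p8 (v : R) : 0 < 1 + 8 * v ^+ 2 by rewrite ltr_wpDr// mulr_ge0// sqr_ge0.
have k10 : 0 < k1.
  have h1 : 0 < a0 ^+ 2 / (1 + 8 * a0 ^+ 2) by rewrite divr_gt0// exprn_gt0.
  have h2 : 0 < th ^+ 2 by exact: exprn_gt0.
  by rewrite mulr_gt0// mulr_gt0// mulr_gt0.
have k20 : 0 < k2.
  have h1 : 0 < d ^+ 2 by exact: exprn_gt0.
  by rewrite divr_gt0// mulr_gt0.
exists (Num.min k1 k2); first by rewrite lt_min k10.
move=> a x Pa x0 dx; have ap : 0 < a by case/andP: Pa => h _; exact: lt_le_trans h.
have den0 := bend_den_gt0 x ap.
have [-> t1] := ratioE x ap; rewrite /= in t1 *.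
have N0 : 0 < midN a x by exact: lt_le_trans ltr01 (midN_ge1 a x).
set t := 4 * bend a x / midN a x in t1 *.
set rho := a ^+ 2 + 1 / 4; have rho0 : 0 < rho by rewrite ltr_wpDl ?sqr_ge0.
have gapE : bend a x - rho * t =
    4 * bend a x * (x ^+ 2 - a ^+ 2 + bend a x ^+ 2) / midN a x.
  rewrite /t /rho; move: N0; rewrite /midN; move: (bend a x) => s N0.
  by field; rewrite gt_eqF.
have bE : bend a x * (x ^+ 2 + 3 * a ^+ 2) = 2 * a * (x ^+ 2 - a ^+ 2).
  by rewrite /bend mulfVK// gt_eqF.
have /andP[aa0 aa1] := Pa.
have [ax|xa] := leP a x.
- have xad : d <= x - a by move: dx; rewrite ger0_norm// subr_ge0.
  have /andP[s0 s1] := bend_ge0 ap ax.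
  have t0 : 0 <= t by rewrite /t divr_ge0 ?(ltW N0)// mulr_ge0.
  apply: ratio_le; first by rewrite t1 (lt_le_trans _ t0).
  rewrite ler_pdivlMr// mulrC.
  apply: (le_trans (y := bend a x - k1)); last by rewrite lerD2l lerN2 ge_min lexx.
  rewrite lerBrDr -lerBrDl.
  have artub := artanh_le (introT andP (conj t0 t1)).
  apply: (le_trans (y := bend a x - rho * (t + t ^+ 3 / (3 * (1 - t ^+ 2))))); last first.
    by rewrite lerD2l lerN2 ler_wpM2l// ltW.
  pose W := 1 + 8 * (x ^+ 2 - bend a x ^+ 2) + 16 * (x ^+ 2 + bend a x ^+ 2) ^+ 2.
  have sx : bend a x ^+ 2 <= (x - a) ^+ 2 by rewrite lerXn2r// nnegrE// (le_trans s0).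
  have W1 : 1 + 16 * (x ^+ 2) ^+ 2 <= W by rewrite /W; nra.
  have W0 : 0 < W by apply: lt_le_trans W1; rewrite ltr_wpDr// mulr_ge0// sqr_ge0.
  have WE : midN a x ^+ 2 - 16 * bend a x ^+ 2 = W by rewrite /W /midN; ring.
  have remE : rho * (t ^+ 3 / (3 * (1 - t ^+ 2))) =
      4 * bend a x * (16 * rho * bend a x ^+ 2 / (3 * W)) / midN a x.
    have e : 1 - t ^+ 2 = W / midN a x ^+ 2.
      by rewrite -WE /t; field; rewrite gt_eqF.
    by rewrite e /t; field; rewrite !gt_eqF.
  have rhoW : 16 * rho / (3 * W) <= 5 / 3.
    rewrite ler_pdivrMr ?mulr_gt0// /rho.
    have : a ^+ 2 <= x ^+ 2 by rewrite lerXn2r// nnegrE// ltW.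
    by have := sqr_ge0 (4 * x ^+ 2 - 1); nra.
  have D0 : 0 <= x ^+ 2 - a ^+ 2 by rewrite subr_ge0 lerXn2r// nnegrE// ltW.
  have bracket : (x ^+ 2 - a ^+ 2) / 3 <=
      x ^+ 2 - a ^+ 2 + bend a x ^+ 2 - 16 * rho * bend a x ^+ 2 / (3 * W).
    have := ler_wpM2r (sqr_ge0 (bend a x)) rhoW.
    rewrite (_ : 16 * rho / _ * _ = 16 * rho * bend a x ^+ 2 / (3 * W)); last by ring.
    have : (x - a) ^+ 2 <= x ^+ 2 - a ^+ 2.
      rewrite -subr_ge0 (_ : _ - _ = 2 * a * (x - a)); last by ring.
      by rewrite !mulr_ge0 ?subr_ge0 ?(ltW ap).
    by lra.
  have xth : th * x <= x - a.
    rewrite /th mulrAC ler_pdivrMr ?addr_gt0//.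
    have : 0 <= (a1 - a) * x by rewrite mulr_ge0// subr_ge0.
    have : 0 <= (x - a - d) * a1 by rewrite mulr_ge0 ?(ltW a1p)//; lra.
    by have := d0; nra.
  have Dth : th * x ^+ 2 <= x ^+ 2 - a ^+ 2.
    have := ler_wpM2r x0 xth; have : a * a <= a * x by rewrite ler_wpM2l// ltW.
    by rewrite !expr2; lra.
  have sth : a * th / 2 <= bend a x.
    rewrite /bend ler_pdivlMr//.
    have : x ^+ 2 + 3 * a ^+ 2 <= 4 * x ^+ 2.
      by have : a ^+ 2 <= x ^+ 2; [rewrite lerXn2r ?nnegrE ?(ltW ap)|lra].
    move=> /(ler_wpM2l (_ : 0 <= a * th / 2)) h.
    apply: le_trans (h _) _; first by rewrite divr_ge0// mulr_ge0// ltW.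
    rewrite (_ : _ * (4 * _) = 2 * a * (th * x ^+ 2)); last by field.
    by rewrite ler_wpM2l// mulr_ge0// ltW.
  have N8 : midN a x <= 1 + 8 * x ^+ 2.
    rewrite /midN; have : bend a x ^+ 2 <= x ^+ 2.
      have sxx : bend a x <= x by apply: le_trans s1 _; rewrite lerBlDr lerDl ltW.
      by rewrite lerXn2r ?nnegrE.
    by lra.
  rewrite mulrDr opprD addrA remE gapE -mulrBl -mulrBr.
  rewrite ler_pdivlMr//.
  apply: (le_trans (y := k1 * (1 + 8 * x ^+ 2))); first by rewrite ler_wpM2l// ltW.
  apply: (le_trans (y := 4 * (a * th / 2) * (th * x ^+ 2 / 3))); last first.
    apply: ler_pM.
    + by rewrite mulr_ge0// divr_ge0// mulr_ge0// ltW.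
    + by rewrite divr_ge0// mulr_ge0 ?sqr_ge0// ltW.
    + by rewrite ler_wpM2l.
    + by apply: le_trans bracket; rewrite ler_wpM2r ?invr_ge0.
  have ax2 : a0 ^+ 2 <= x ^+ 2 by rewrite lerXn2r ?nnegrE ?(ltW a00)// (le_trans aa0).
  have q8 : a0 ^+ 2 / (1 + 8 * a0 ^+ 2) * (1 + 8 * x ^+ 2) <= x ^+ 2.
    by rewrite mulrAC ler_pdivrMr ?p8//; lra.
  rewrite /k1 -mulrA (_ : 4 * _ * _ = 2 / 3 * a * th ^+ 2 * x ^+ 2); last by field.
  apply: ler_pM => //.
  + by rewrite mulr_ge0 ?exprn_ge0 ?(ltW th0)// mulr_ge0 ?(ltW a00).
  + by rewrite mulr_ge0 ?divr_ge0 ?sqr_ge0 ?(ltW (p8 _)).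
  + by rewrite ler_wpM2r ?exprn_ge0 ?(ltW th0)// ler_wpM2l.
- have xad : x + d <= a by move: dx; rewrite ltr0_norm ?subr_lt0//; lra.
  have xa' : 0 <= x <= a by rewrite x0 ltW.
  have /andP[s0 s1] := bend_le0 ap xa'.
  have high0 : 0 <= high a x by rewrite /high addr_ge0 ?sqr_ge0// mulr_ge0// sqr_ge0.
  have tt : -1 <= t <= 0.
    rewrite /t ler_pdivlMr// ler_pdivrMr// mul0r; apply/andP; split; last by lra.
    by move: high0; rewrite /high /midN; lra.
  apply: le_trans (ratio_neg_le tt) _.
  rewrite ler_expR ler_wpM2l// ler_pdivlMr// mulrC.
  apply: (le_trans (y := bend a x - k2)); last by rewrite lerD2l lerN2 ge_min lexx orbT.
  rewrite lerBrDr -lerBrDl gapE.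
  have dd := ltW d0.
  have den4 : x ^+ 2 + 3 * a ^+ 2 <= 4 * a ^+ 2.
    have : x ^+ 2 <= a ^+ 2 by rewrite lerXn2r ?nnegrE ?(ltW ap)// ltW.
    by move: (x ^+ 2) (a ^+ 2) => X A; lra.
  have da : d * a <= a ^+ 2 - x ^+ 2.
    have h : d * (a + x) <= (a - x) * (a + x).
      by rewrite ler_wpM2r ?addr_ge0 ?(ltW ap)// lerBrDr addrC.
    rewrite (_ : _ - _ = (a - x) * (a + x)); last by ring.
    by apply: le_trans h; rewrite ler_wpM2l// lerDl.
  have dq : d / 2 <= - bend a x.
    rewrite -(ler_pM2r den0) mulNr bE.
    have h := ler_wpM2l (_ : 0 <= d / 2) den4.
    apply: le_trans (h _) _; first by rewrite divr_ge0.
    have := ler_wpM2l (_ : 0 <= 2 * a) da.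
    move=> /(_ (mulr_ge0 (ler0n _ 2) (ltW ap))).
    rewrite (_ : d / 2 * _ = 2 * a * (d * a)); last by field.
    by move=> h'; apply: le_trans h' _; rewrite -[leRHS]mulrN opprB.
  have gq : d * a / 4 <= a ^+ 2 - x ^+ 2 - bend a x ^+ 2.
    rewrite -(ler_pM2r den0).
    apply: (le_trans (y := d * a / 4 * (4 * a ^+ 2))).
      by rewrite ler_wpM2l// divr_ge0// mulr_ge0// ltW.
    apply: (le_trans (y := (a ^+ 2 - x ^+ 2) * (a + x) ^+ 2)).
      rewrite (_ : _ * (4 * _) = d * a * a ^+ 2); last by field.
      apply: ler_pM => //; rewrite ?sqr_ge0 ?mulr_ge0 ?(ltW ap)//.
      by rewrite lerXn2r ?nnegrE ?addr_ge0 ?(ltW ap)// lerDl.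
    have : 0 <= (bend a x - (x - a)) * (- bend a x * (x ^+ 2 + 3 * a ^+ 2)).
      by rewrite mulr_ge0 ?subr_ge0// mulr_ge0 ?oppr_ge0// ltW.
    rewrite mulNr bE -subr_ge0 => h.
    rewrite (_ : _ - _ = (a ^+ 2 - x ^+ 2) * (x ^+ 2 + 3 * a ^+ 2 - (a + x) ^+ 2) -
      bend a x * (bend a x * (x ^+ 2 + 3 * a ^+ 2))); last by ring.
    by rewrite bE; apply: le_trans h _; rewrite le_eqVlt; apply/orP; left; apply/eqP; ring.
  have N8 : midN a x <= 1 + 8 * a1 ^+ 2.
    rewrite /midN; have : bend a x ^+ 2 <= a ^+ 2.
      by rewrite -sqrrN lerXn2r// ?nnegrE; lra.
    have : x ^+ 2 <= a ^+ 2 by rewrite lerXn2r// ?nnegrE; lra.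
    have : a ^+ 2 <= a1 ^+ 2 by rewrite lerXn2r// ?nnegrE; lra.
    by lra.
  rewrite ler_pdivlMr//.
  apply: (le_trans (y := k2 * (1 + 8 * a1 ^+ 2))); first by rewrite ler_wpM2l// ltW.
  rewrite (_ : 4 * _ * _ = 4 * (- bend a x) * (a ^+ 2 - x ^+ 2 - bend a x ^+ 2)); last by ring.
  apply: (le_trans (y := 4 * (d / 2) * (d * a / 4))); last first.
    apply: ler_pM => //.
    + by rewrite mulr_ge0// divr_ge0// ltW.
    + by rewrite divr_ge0// mulr_ge0// ltW.
    + by rewrite ler_wpM2l.
  rewrite (_ : k2 * _ = d ^+ 2 / 2 * a0); last first.
    by rewrite /k2; field; rewrite gt_eqF ?p8.
  rewrite (_ : 4 * _ * _ = d ^+ 2 / 2 * a); last by field.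
  by rewrite ler_wpM2l// divr_ge0// sqr_ge0.
Qed.

End Far.

(** * Laplace's method *)

Section Laplace.
Context {R : realType}.
Notation mu := (@lebesgue_measure R).

Lemma expR_le_quadratic (t : R) : expR t <= 1 + t + t ^+ 2 * expR `|t|.
Proof.
have le1 (u : R) : expR u <= 1 + u * expR u.
  have := expR_ge1Dx (- u); have E0 := expR_gt0 u.
  rewrite expRN -(ler_pM2r E0) mulVf ?gt_eqF//.
  by lra.
apply: le_trans (le1 t) _; rewrite -addrA lerD2l.
have [t0|t0] := lerP 0 t.
  by rewrite ger0_norm//; have := ler_wpM2l t0 (le1 t); rewrite mulrDr mulr1 mulrA -expr2.
rewrite ltr0_norm//; have e1 : 1 + t <= expR t by exact: expR_ge1Dx.
have : t * expR t <= t * (1 + t) by rewrite ler_wnM2l// ltW.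
have : t ^+ 2 * 1 <= t ^+ 2 * expR (- t).
  by rewrite ler_wpM2l ?sqr_ge0// -[leLHS]expR0 ler_expR oppr_ge0 ltW.
by lra.
Qed.

(* Dominates [expR (l * y + K * y ^+ 2 - w * (k * y ^+ 2 + c * y ^+ 3 - K * y ^+ 4))]
   near 0; the odd terms do not contribute to its integral. *)
Definition laplace_dom (k k0 l c C w y : R) : R :=
  expR (- (w * k) * y ^+ 2) * (1 + l * y - w * c * y ^+ 3) +
  C / w * expR (- (w * k0) * y ^+ 2).

Lemma laplace_domP (K k0 : R) : 0 <= K -> 0 < k0 ->
  exists C d : R, [/\ 0 <= C, 0 < d <= 1 &
    forall k l c w y : R, k0 <= k -> `|l| <= K -> `|c| <= K -> 0 < w ->
      0 <= laplace_dom k (k0 / 4) l c C w y /\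
      (`|y| <= d ->
       expR (l * y + K * y ^+ 2 - w * (k * y ^+ 2 + c * y ^+ 3 - K * y ^+ 4)) <=
       laplace_dom k (k0 / 4) l c C w y)].
Proof.
move=> K0 k00; have k02 : 0 < k0 / 2 by rewrite divr_gt0.
have [C3 C30 HC3] := expr_expR_bounded 3 k02.
pose A := K + 4 * K ^+ 2 * expR (2 * K).
have e2K : 1 <= expR (2 * K) by rewrite -[leLHS]expR0 ler_expR mulr_ge0.
have A0 : 0 <= A by rewrite addr_ge0// mulr_ge0 ?expR_ge0// mulr_ge0// sqr_ge0.
pose D := C3 * expR (k0 / 2).
have D0 : 0 <= D by rewrite mulr_ge0 ?expR_ge0.
have cube v : 0 <= v -> (1 + v) ^+ 3 * expR (- (k0 / 2 * v)) <= D.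
  move=> v0; have := ler_wpM2r (expR_ge0 (k0 / 2)) (HC3 (1 + v) (addr_ge0 ler01 v0)).
  by rewrite -[X in X <= _ -> _]mulrA -expRD mulrDr mulr1 opprD addrAC addNr add0r.
exists (A * D), (Num.min 1 (k0 / (8 * K + 1))).
have K81 : 0 < 8 * K + 1 by rewrite ltr_wpDl// mulr_ge0.
split; first exact: mulr_ge0.
  by rewrite lt_min ltr01/= divr_gt0//= ge_min lexx.
move=> k l c w y k0k lK cK w0.
pose v := w * y ^+ 2; have v0 : 0 <= v by rewrite mulr_ge0 ?sqr_ge0// ltW.
have y2E : y ^+ 2 = v / w by rewrite /v mulrC mulKf// gt_eqF.
have wV0 : 0 <= w^-1 by rewrite invr_ge0 ltW.
have ek : expR (- (w * k) * y ^+ 2) <= expR (- (k0 * v)).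
  rewrite ler_expR mulNr lerN2 (_ : w * k * y ^+ 2 = k * v); last by rewrite /v; ring.
  by rewrite ler_wpM2r.
have core B : 0 <= B -> B <= A ->
    expR (- (w * k) * y ^+ 2) * (B * (y ^+ 2 * (1 + v) ^+ 2) * expR (k0 / 4 * v)) <=
    A * D / w * expR (- (w * (k0 / 4)) * y ^+ 2).
  move=> B0 BA.
  have v3 : v * (1 + v) ^+ 2 <= (1 + v) ^+ 3.
    by rewrite [leRHS]exprS ler_wpM2r ?sqr_ge0// lerDr.
  have h : v * (1 + v) ^+ 2 * expR (- (k0 / 2 * v)) <= D.
    by apply: le_trans (cube v v0); rewrite ler_wpM2r ?expR_ge0.
  have -> : - (w * (k0 / 4)) * y ^+ 2 = - (k0 / 4 * v) by rewrite /v; ring.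
  apply: (le_trans (y := expR (- (k0 * v)) *
     (B * (y ^+ 2 * (1 + v) ^+ 2) * expR (k0 / 4 * v)))).
    apply: ler_wpM2r => //; apply: mulr_ge0; last exact: expR_ge0.
    by apply: mulr_ge0 => //; rewrite mulr_ge0 ?sqr_ge0.
  have -> : expR (- (k0 * v)) = expR (- (k0 / 2 * v)) * expR (- (k0 / 4 * v)) *
      expR (- (k0 / 4 * v)).
    by rewrite -!expRD; congr expR; field.
  have ee : expR (- (k0 / 4 * v)) * expR (k0 / 4 * v) = 1.
    by rewrite -expRD addNr expR0.
  rewrite y2E (_ : _ * _ * _ * _ = B * (v * (1 + v) ^+ 2 * expR (- (k0 / 2 * v))) / w *
     expR (- (k0 / 4 * v)) * (expR (- (k0 / 4 * v)) * expR (k0 / 4 * v))); last by ring.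
  rewrite ee mulr1 ler_wpM2r ?expR_ge0// ler_wpM2r//.
  by rewrite ler_pM// mulr_ge0 ?expR_ge0// mulr_ge0// sqr_ge0.
have y3 : `|y ^+ 3| = `|y| * y ^+ 2.
  by rewrite normrX exprS real_normK ?num_real.
have tle : `|l * y - w * c * y ^+ 3| <= K * `|y| * (1 + v).
  rewrite (le_trans (ler_normD _ _))// normrN mulrDr mulr1 lerD//.
    by rewrite normrM ler_wpM2r.
  rewrite normrM [`|w * c|]normrM (gtr0_norm w0) y3 /v (_ : w * _ * _ = `|c| * `|y| * (w * y ^+ 2)); last by ring.
  by rewrite ler_wpM2r// ler_wpM2r.
have yy : `|y| ^+ 2 = y ^+ 2 by rewrite real_normK ?num_real.
have t2 : (l * y - w * c * y ^+ 3) ^+ 2 <= K ^+ 2 * (y ^+ 2 * (1 + v) ^+ 2).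
  rewrite -real_normK ?num_real// -yy -!exprMn lerXn2r ?nnegrE ?mulr_ge0 ?addr_ge0//.
  by rewrite mulrA.
split.
  rewrite /laplace_dom; set t := l * y - _ in tle t2.
  rewrite -addrA -/t.
  have p : - t ^+ 2 <= 1 + t by have := sqr_ge0 (1 + t); have := sqr_ge0 t; rewrite expr2; nra.
  have B0 : 0 <= K ^+ 2 by exact: sqr_ge0.
  have BA : K ^+ 2 <= A.
    have : K ^+ 2 * 1 <= K ^+ 2 * expR (2 * K) by rewrite ler_wpM2l.
    by rewrite /A; lra.
  have := core _ B0 BA.
  have e4 : 1 <= expR (k0 / 4 * v).
    by rewrite -[leLHS]expR0 ler_expR mulr_ge0// divr_ge0// ltW.
  have h1 : t ^+ 2 <= K ^+ 2 * (y ^+ 2 * (1 + v) ^+ 2) * expR (k0 / 4 * v).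
    have y2v : 0 <= y ^+ 2 * (1 + v) ^+ 2 by rewrite mulr_ge0 ?sqr_ge0.
    by apply: le_trans t2 _; rewrite ler_peMr// mulr_ge0.
  have := ler_wpM2l (expR_ge0 (- (w * k) * y ^+ 2)) h1.
  have := ler_wpM2l (expR_ge0 (- (w * k) * y ^+ 2)) p.
  by lra.
rewrite le_min => /andP[y1 yk].
set t := l * y - w * c * y ^+ 3 in tle t2 *.
pose T := t + K * y ^+ 2 * (1 + v).
have -> : l * y + K * y ^+ 2 - w * (k * y ^+ 2 + c * y ^+ 3 - K * y ^+ 4) =
   - (w * k) * y ^+ 2 + T by rewrite /T /t /v; ring.
have Tle : `|T| <= 2 * (K * `|y| * (1 + v)).
  rewrite (le_trans (ler_normD _ _))// mulr2n mulrDl !mul1r lerD//.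
  have Kv : 0 <= K * y ^+ 2 * (1 + v).
    by apply: mulr_ge0; [rewrite mulr_ge0// sqr_ge0|exact: addr_ge0].
  rewrite (ger0_norm Kv); apply: ler_wpM2r; first exact: addr_ge0.
  apply: ler_wpM2l => //.
  by rewrite -yy expr2 ler_piMr.
have Te : `|T| <= 2 * K + k0 / 4 * v.
  apply: le_trans Tle _; rewrite mulrDr mulr1 mulrDr lerD//.
    by rewrite ler_wpM2l// ler_piMr.
  rewrite mulrA ler_wpM2r//.
  move: yk; rewrite ler_pdivlMr// => yk.
  have := normr_ge0 y; by nra.
have T2 : T ^+ 2 <= 4 * K ^+ 2 * (y ^+ 2 * (1 + v) ^+ 2).
  rewrite -real_normK ?num_real// -yy.
  apply: (le_trans (y := (2 * (K * `|y| * (1 + v))) ^+ 2)).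
    by rewrite lerXn2r ?nnegrE ?mulr_ge0 ?addr_ge0.
  rewrite !exprMn (_ : 2 ^+ 2 = 4 :> R) -?natrX//.
  by rewrite !mulrA.
rewrite expRD /laplace_dom.
apply: (le_trans (y := expR (- (w * k) * y ^+ 2) * (1 + T + T ^+ 2 * expR `|T|))).
  by rewrite ler_wpM2l ?expR_ge0 ?expR_le_quadratic.
rewrite (_ : 1 + T + _ = 1 + t + (K * y ^+ 2 * (1 + v) + T ^+ 2 * expR `|T|)); last first.
  by rewrite /T; ring.
rewrite -[1 + l * y - _]addrA -/t mulrDr lerD2l.
apply: le_trans (core A A0 (lexx _)); rewrite ler_wpM2l ?expR_ge0//.
have e4 : 1 <= expR (k0 / 4 * v).
  by rewrite -[leLHS]expR0 ler_expR mulr_ge0// divr_ge0// ltW.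
rewrite /A 2!mulrDl; apply: lerD.
  rewrite -[leLHS]mulr1; apply: ler_pM => //.
    by apply: mulr_ge0; [rewrite mulr_ge0// sqr_ge0|exact: addr_ge0].
  rewrite -mulrA; apply: ler_wpM2l => //; apply: ler_wpM2l; first exact: sqr_ge0.
  by rewrite expr2 ler_peMr ?addr_ge0// lerDl.
have eT : expR `|T| <= expR (2 * K) * expR (k0 / 4 * v) by rewrite -expRD ler_expR.
apply: le_trans (ler_pM (sqr_ge0 _) (expR_ge0 _) T2 eT) _.
by rewrite le_eqVlt; apply/orP; left; apply/eqP; ring.
Qed.

Lemma lintegrable_laplace_dom k k0 l c C w m : 0 < k -> 0 < k0 -> 0 < w ->
  lintegrable (fun x => laplace_dom k k0 l c C w (x - m)).
Proof.
move=> kp k0p w0; have wk : 0 < w * k by rewrite mulr_gt0.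
have wk0 : 0 < w * k0 by rewrite mulr_gt0.
have I0 := lintegrable_gauss m wk.
have I1 := lintegrableZ l (lintegrable_gaussX m 1 wk).
have I3 := lintegrableZ (- (w * c)) (lintegrable_gaussX m 3 wk).
have I4 := lintegrableZ (C / w) (lintegrable_gauss m wk0).
have := lintegrableD (lintegrableD I0 (lintegrableD I1 I3)) I4.
by apply: eq_integrable => // x _ /=; congr EFin; rewrite /laplace_dom; ring.
Qed.

Lemma Rintegral_laplace_dom k k0 l c C w m : 0 < k -> 0 < k0 -> 0 < w ->
  (\int[mu]_x laplace_dom k k0 l c C w (x - m) =
   Num.sqrt (pi / (w * k)) + C / w * Num.sqrt (pi / (w * k0)))%R.
Proof.
move=> kp k0p w0; have wk : 0 < w * k by rewrite mulr_gt0.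
have wk0 : 0 < w * k0 by rewrite mulr_gt0.
have I0 := lintegrable_gauss m wk.
have J1 := lintegrable_gaussX m 1 wk; have J3 := lintegrable_gaussX m 3 wk.
have I1 := lintegrableZ l J1.
have I3 := lintegrableZ (- (w * c)) J3.
have J4 := lintegrable_gauss m wk0.
have I4 := lintegrableZ (C / w) J4.
transitivity (\int[mu]_x (expR (- (w * k) * (x - m) ^+ 2) +
  (l * ((x - m) ^+ 1 * expR (- (w * k) * (x - m) ^+ 2)) +
   - (w * c) * ((x - m) ^+ 3 * expR (- (w * k) * (x - m) ^+ 2))) +
   C / w * expR (- (w * k0) * (x - m) ^+ 2)))%R.
  by apply: eq_Rintegral => x _; rewrite /laplace_dom; ring.
have I13 := lintegrableD I1 I3; have I013 := lintegrableD I0 I13.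
rewrite RintegralD// RintegralD// RintegralD// !RintegralZl//.
rewrite !Rintegral_gauss// Rintegral_gaussX3// mulr0 addr0.
rewrite (_ : (\int[mu]_x _)%R = 0) ?mulr0 ?addr0//.
exact: Rintegral_gaussX1.
Qed.

End Laplace.

Section PathModulus.
Local Open Scope complex_scope.
Context {R : realType}.
Variables (alpha x0 : R).
Hypothesis alpha0 : 0 < alpha.

Definition path_mod (w : R) (n : nat) (a x : R) : R :=
  expR (- alpha * (x - x0) ^+ 2 + alpha * bend a x ^+ 2 - w * bend a x) *
  ((Num.sqrt (low a x))^-1 * Num.sqrt (high a x / low a x) ^+ n) *
  Num.sqrt (1 + dbend a x ^+ 2).

Lemma cmod_packet_path w n a x : 0 < a ->
  cmod (packet alpha x0 w n (x +i* bend a x) * (1 +i* dbend a x)) = path_mod w n a x.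
Proof.
move=> ap; have low0 := low_gt0 x ap.
have poleE : cmod (pole (x +i* bend a x)) = Num.sqrt (low a x).
  by rewrite -[LHS]ger0_norm ?cmod_ge0// -sqrtr_sqr sqr_cmod_pole.
have pole0 : pole (x +i* bend a x) != 0.
  by rewrite -cmod_eq0 poleE gt_eqF// sqrtr_gt0.
rewrite cmodM cmod_packet /path_mod; congr (_ * _ * _).
  rewrite /packet_factor cmodM cmodV cmodX poleE; congr (_ * _ ^+ _).
  have -> : 2 * (pole (x +i* bend a x))^-1 - 1 =
      (2 - pole (x +i* bend a x)) / pole (x +i* bend a x).
    by rewrite mulrBl mulfV.
  rewrite cmodM cmodV poleE sqrtrM; last first.
    by rewrite /high addr_ge0 ?sqr_ge0// mulr_ge0// sqr_ge0.
  rewrite sqrtrV ?(ltW low0)//; congr (_ / _).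
  rewrite cmodE; congr Num.sqrt; rewrite /pole /high /=; ring.
by rewrite cmodE /= expr1n.
Qed.

Lemma path_mod_le w n a x h : 0 < a -> n%:R = w * (a ^+ 2 + 1 / 4) ->
  high a x / low a x <= expR (2 * ((bend a x - h) / (a ^+ 2 + 1 / 4))) ->
  path_mod w n a x <= Num.sqrt 2 * (Num.sqrt (low a x))^-1 *
    expR (- alpha * (x - x0) ^+ 2 + alpha * bend a x ^+ 2 - w * h).
Proof.
move=> ap nE hl; have rho0 : 0 < a ^+ 2 + 1 / 4 by rewrite ltr_wpDl ?sqr_ge0.
have sq : Num.sqrt (high a x / low a x) <= expR ((bend a x - h) / (a ^+ 2 + 1 / 4)).
  rewrite -[leRHS]ger0_norm ?expR_ge0// -sqrtr_sqr -expRM_natl.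
  exact: ler_wsqrtr.
have sqn : Num.sqrt (high a x / low a x) ^+ n <= expR (w * (bend a x - h)).
  apply: (le_trans (y := expR ((bend a x - h) / (a ^+ 2 + 1 / 4)) ^+ n)).
    by rewrite lerXn2r ?nnegrE ?sqrtr_ge0 ?expR_ge0.
  rewrite -expRM_natl nE; set q := a ^+ 2 + 1 / 4 in rho0 *.
  by rewrite (_ : w * q * _ = w * (bend a x - h))//; field; rewrite gt_eqF.
have s2 : Num.sqrt (1 + dbend a x ^+ 2) <= Num.sqrt 2.
  have : `|dbend a x| ^+ 2 <= 1 by rewrite exprn_ile1// normr_dbend_le.
  by rewrite real_normK ?num_real// => h2; apply: ler_wsqrtr; lra.
rewrite /path_mod mulrC -[leRHS]mulrA.
apply: ler_pM; rewrite ?sqrtr_ge0//.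
rewrite mulrCA; apply: ler_wpM2l; first by rewrite invr_ge0 sqrtr_ge0.
rewrite (_ : - alpha * (x - x0) ^+ 2 + _ - w * h = (- alpha * (x - x0) ^+ 2 +
  alpha * bend a x ^+ 2 - w * bend a x) + w * (bend a x - h)); last by ring.
by rewrite [leRHS]expRD ler_wpM2l ?expR_ge0.
Qed.

Variables a0 a1 : R.
Hypothesis a00 : 0 < a0.
Hypothesis a01 : a0 <= a1.

Lemma half_line_bound : exists C k0 k : R, [/\ 0 <= C, 0 < k0, 0 < k &
  forall a, a0 <= a <= a1 -> exists l c, forall w n, 0 < w ->
  n%:R = w * (a ^+ 2 + 1 / 4) ->
  (forall y, 0 <= laplace_dom (8 * a / (1 + 4 * a ^+ 2)) k0 l c C w y) /\
  (forall x, 0 <= x -> path_mod w n a x <=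
    Num.sqrt 2 / Num.sqrt (1 + 4 * a ^+ 2) * expR (- alpha * (a - x0) ^+ 2) *
      laplace_dom (8 * a / (1 + 4 * a ^+ 2)) k0 l c C w (x - a) +
    C * expR (- (k * w)) * expR (- alpha * (x - x0) ^+ 2))].
Proof.
pose d1 : R := Num.min 1 (a0 / 2).
have d10 : 0 < d1 by rewrite lt_min ltr01 divr_gt0.
have d11 : d1 <= 1 by rewrite ge_min lexx.
have d1a : d1 <= a0 / 2 by rewrite ge_min lexx orbT.
have [K1 K10 H1] := decay_near a1 a00 d10 d11 d1a.
have [K2 K20 H2] := low_near a1 a00 d10 d11.
have a1p : 0 < a1 by exact: lt_le_trans a01.
have p4 (v : R) : 0 < 1 + 4 * v ^+ 2 by rewrite ltr_wpDr// mulr_ge0// sqr_ge0.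
pose kk : R := 8 * a0 / (1 + 4 * a1 ^+ 2).
have kk0 : 0 < kk by rewrite divr_gt0// mulr_gt0.
pose K := K1 + K2 + 2 * alpha * (a1 + `|x0|).
have K3 : 0 <= 2 * alpha * (a1 + `|x0|).
  by apply: mulr_ge0; [rewrite mulr_ge0// ltW|rewrite addr_ge0// ltW].
have K0 : 0 <= K by rewrite /K !addr_ge0.
have [C1 [d2 [C10 /andP[d20 d21] H3]]] := laplace_domP K0 kk0.
pose d := Num.min d1 d2.
have d0 : 0 < d by rewrite lt_min d10.
have [k kp H4] := decay_far a1 a00 d0.
pose lowm := Num.min 1 (4 * a0 ^+ 2).
have lowm0 : 0 < lowm by rewrite lt_min ltr01 mulr_gt0// exprn_gt0.
pose C2 := Num.sqrt 2 * (Num.sqrt lowm)^-1 * expR (alpha * (2 * a1) ^+ 2).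
have C20 : 0 <= C2.
  by rewrite mulr_ge0 ?expR_ge0// mulr_ge0 ?invr_ge0 ?sqrtr_ge0.
exists (C1 + C2), (kk / 4), k; split => //.
- exact: addr_ge0.
- by rewrite divr_gt0.
move=> a Pa; have /andP[aa0 aa1] := Pa; have ap : 0 < a by exact: lt_le_trans aa0.
have [c cK Hc] := H1 a Pa; have [l lK Hl] := H2 a Pa.
pose l' := l - 2 * alpha * (a - x0).
have l'K : `|l'| <= K.
  rewrite /l' (le_trans (ler_normB _ _))// /K lerD//.
    by rewrite (le_trans lK)// lerDr.
  rewrite normrM [`|2 * _|]ger0_norm ?mulr_ge0 ?(ltW alpha0)//.
  apply: ler_wpM2l; first by rewrite mulr_ge0// ltW.
  by rewrite (le_trans (ler_normB _ _))// gtr0_norm// lerD2r.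
have cK' : `|c| <= K by rewrite (le_trans cK)// /K -addrA lerDl addr_ge0.
have kka : kk <= 8 * a / (1 + 4 * a ^+ 2).
  rewrite /kk; apply: ler_pM; rewrite ?mulr_ge0 ?invr_ge0 ?(ltW a00) ?(ltW (p4 _))//.
    by rewrite ler_wpM2l.
  rewrite lef_pV2 ?posrE// lerD2l ler_wpM2l//.
  by rewrite lerXn2r ?nnegrE ?(ltW ap) ?(ltW a1p).
exists l', c => w n w0 nE.
have H3' := H3 _ _ _ _ _ kka l'K cK' w0.
have domC y : laplace_dom (8 * a / (1 + 4 * a ^+ 2)) (kk / 4) l' c C1 w y <=
    laplace_dom (8 * a / (1 + 4 * a ^+ 2)) (kk / 4) l' c (C1 + C2) w y.
  rewrite /laplace_dom lerD2l ler_wpM2r ?expR_ge0// ler_wpM2r ?invr_ge0 ?(ltW w0)//.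
  by rewrite lerDl.
have dom0 y : 0 <= laplace_dom (8 * a / (1 + 4 * a ^+ 2)) (kk / 4) l' c (C1 + C2) w y.
  by apply: le_trans (domC y); have [] := H3' y.
split=> // x x_ge0.
pose W := Num.sqrt 2 / Num.sqrt (1 + 4 * a ^+ 2) * expR (- alpha * (a - x0) ^+ 2).
have W0 : 0 <= W by rewrite mulr_ge0 ?expR_ge0// divr_ge0 ?sqrtr_ge0.
have [xd|xd] := leP `|x - a| d.
- have xd1 : `|x - a| <= d1 by rewrite (le_trans xd)// ge_min lexx.
  have xd2 : `|x - a| <= d2 by rewrite (le_trans xd)// ge_min lexx orbT.
  pose y := x - a; have xE : x = a + y by rewrite /y addrC subrK.
  have hy := Hc y xd1; have ly := Hl y xd1; rewrite -xE in hy ly.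
  apply: (le_trans (y := W * laplace_dom (8 * a / (1 + 4 * a ^+ 2)) (kk / 4) l' c
     (C1 + C2) w (x - a))); last first.
    by rewrite lerDl mulr_ge0 ?expR_ge0// mulr_ge0 ?expR_ge0// addr_ge0.
  apply: le_trans (ler_wpM2l W0 (domC _)).
  have [_ /(_ xd2) lap] := H3' y.
  apply: le_trans (ler_wpM2l W0 lap).
  apply: le_trans (path_mod_le ap nE hy) _.
  have s2 : bend a x ^+ 2 <= y ^+ 2.
    rewrite -real_normK ?num_real// -[leRHS]real_normK ?num_real//.
    by rewrite lerXn2r ?nnegrE// normr_bend_sub.
  apply: (le_trans (y := Num.sqrt 2 * ((Num.sqrt (1 + 4 * a ^+ 2))^-1 *
     expR (l * y + K2 * y ^+ 2)) * expR (- alpha * (x - x0) ^+ 2 + alpha * y ^+ 2 -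
      w * (8 * a / (1 + 4 * a ^+ 2) * y ^+ 2 + c * y ^+ 3 - K1 * y ^+ 4)))).
    apply: ler_pM; rewrite ?expR_ge0 ?mulr_ge0 ?invr_ge0 ?sqrtr_ge0//.
      by apply: ler_wpM2l; rewrite ?sqrtr_ge0.
    by rewrite ler_expR lerD2r lerD2l ler_wpM2l// ltW.
  rewrite /W (_ : Num.sqrt 2 * (_ * expR _) * expR _ =
    Num.sqrt 2 / Num.sqrt (1 + 4 * a ^+ 2) * (expR (l * y + K2 * y ^+ 2) *
    expR (- alpha * (x - x0) ^+ 2 + alpha * y ^+ 2 -
      w * (8 * a / (1 + 4 * a ^+ 2) * y ^+ 2 + c * y ^+ 3 - K1 * y ^+ 4)))); last by ring.
  rewrite -!expRD -[leRHS]mulrA -expRD.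
  apply: ler_wpM2l; first by rewrite divr_ge0 ?sqrtr_ge0.
  rewrite ler_expR -subr_ge0.
  rewrite (_ : _ - _ = (K - K2) * y ^+ 2 + w * (K - K1) * y ^+ 4); last first.
    by rewrite xE /l'; ring.
  have KK2 : 0 <= K - K2.
    by rewrite (_ : K - K2 = K1 + 2 * alpha * (a1 + `|x0|)) ?addr_ge0// /K; ring.
  have KK1 : 0 <= K - K1.
    by rewrite (_ : K - K1 = K2 + 2 * alpha * (a1 + `|x0|)) ?addr_ge0// /K; ring.
  apply: addr_ge0; first by rewrite mulr_ge0 ?sqr_ge0.
  by apply: mulr_ge0; [rewrite mulr_ge0// ltW|rewrite exprn_even_ge0].
- have hx := H4 a x Pa x_ge0 (ltW xd).
  apply: le_trans (path_mod_le ap nE hx) _.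
  apply: (le_trans (y := C2 * expR (- (k * w)) * expR (- alpha * (x - x0) ^+ 2))); last first.
    rewrite -[leLHS]add0r; apply: lerD; first exact: mulr_ge0.
    by rewrite ler_wpM2r ?expR_ge0// ler_wpM2r ?expR_ge0// lerDr.
  rewrite !expRD.
  have e1 : expR (alpha * bend a x ^+ 2) <= expR (alpha * (2 * a1) ^+ 2).
    rewrite ler_expR; apply: ler_wpM2l; first exact: ltW.
    rewrite -real_normK ?num_real// lerXn2r ?nnegrE ?mulr_ge0 ?(ltW a1p)//.
    by rewrite (le_trans (normr_bend_le x ap))// ler_wpM2l.
  have e2 : (Num.sqrt (low a x))^-1 <= (Num.sqrt lowm)^-1.
    rewrite lef_pV2 ?posrE ?sqrtr_gt0 ?low_gt0//; apply: ler_wsqrtr.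
    apply: le_trans (low_ge x ap); rewrite le_min !ge_min lexx/=; apply/orP; right.
    by rewrite ler_wpM2l// lerXn2r ?nnegrE ?(ltW a00) ?(ltW ap).
  rewrite (_ : - (w * k) = - (k * w)) 1?mulrC//.
  rewrite /C2 [leLHS](_ : _ = Num.sqrt 2 * (Num.sqrt (low a x))^-1 *
     expR (alpha * bend a x ^+ 2) * expR (- (k * w)) * expR (- alpha * (x - x0) ^+ 2)); last by ring.
  rewrite ler_wpM2r ?expR_ge0// ler_wpM2r ?expR_ge0//.
  apply: ler_pM => //; rewrite ?expR_ge0 ?mulr_ge0 ?invr_ge0 ?sqrtr_ge0//.
  by apply: ler_wpM2l; rewrite ?sqrtr_ge0.
Qed.

End PathModulus.

Section SaddlePoint.
Local Open Scope complex_scope.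
Context {R : realType}.
Notation mu := (@lebesgue_measure R).
Variables (alpha x0 : R).
Hypothesis alpha0 : 0 < alpha.

Lemma path_modN w n a x : path_mod alpha x0 w n a (- x) = path_mod alpha (- x0) w n a x.
Proof.
have xE : (- x - x0) ^+ 2 = (x - - x0) ^+ 2 by ring.
have dE : dbend a (- x) = - dbend a x by rewrite /dbend sqrrN mulrN mulNr.
by rewrite /path_mod /low /high bendN dE xE !sqrrN.
Qed.

Lemma laplace_domN k k0 l c C w (y : R) :
  laplace_dom k k0 l c C w (- y) = laplace_dom k k0 (- l) (- c) C w y.
Proof. by rewrite /laplace_dom sqrrN; congr (_ * _ + _); ring. Qed.

Lemma packet_path_shift w n a : 0 < a ->
  cintegral (fun x => packet alpha x0 w n x%:C) =
    cintegral (fun x => packet alpha x0 w n (x +i* bend a x) * (1 +i* dbend a x)) /\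
  cintegrable (fun x => packet alpha x0 w n (x +i* bend a x) * (1 +i* dbend a x)).
Proof.
move=> ap; pose e : R := Num.min 1 (2 * a).
have e0 : 0 < e by rewrite lt_min ltr01 mulr_gt0.
have S1 x : `|bend a x| <= 2 * a + 1 by rewrite (le_trans (normr_bend_le x ap))// lerDl.
have S2 x : `|dbend a x| <= 2 * a + 1.
  by rewrite (le_trans (normr_dbend_le x ap))// lerDr mulr_ge0// ltW.
have far (x t : R) : 0 <= t -> e ^+ 2 <= (1 - 2 * (t * bend a x)) ^+ 2 + 4 * x ^+ 2.
  move=> t0; have den0 := bend_den_gt0 x ap.
  have [x2|x2] := lerP (a ^+ 2) (x ^+ 2).
    apply: (le_trans (y := (2 * a) ^+ 2)).
      by rewrite lerXn2r ?nnegrE ?(ltW e0) ?mulr_ge0 ?(ltW ap)// ge_min lexx orbT.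
    rewrite exprMn (_ : 2 ^+ 2 = 4 :> R) -?natrX//.
    by have := sqr_ge0 (1 - 2 * (t * bend a x)); lra.
  have b0 : bend a x <= 0.
    by rewrite /bend ler_pdivrMr// mul0r mulr_ge0_le0 ?mulr_ge0 ?(ltW ap)//; lra.
  have tb : t * bend a x <= 0 by rewrite mulr_ge0_le0.
  apply: (le_trans (y := 1 ^+ 2)).
    by rewrite lerXn2r ?nnegrE ?(ltW e0)// ge_min lexx.
  by have := sqr_ge0 x; move: (t * bend a x) tb => u u0; rewrite expr1n; nra.
have dd x : derivable (dbend a) x 1 by exact: derivable_dbend.
split.
  exact: (@contour_shift R alpha x0 w n alpha0 (bend a) (dbend a) _ _
    (fun x => is_derive_bend x ap) dd S1 S2 e0 far).
exact: (@cintegrable_shift R alpha x0 w n alpha0 (bend a) (dbend a) _ _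
  (fun x => is_derive_bend x ap) dd S1 S2 e0 far).
Qed.

Variables a0 a1 : R.
Hypothesis a00 : 0 < a0.
Hypothesis a01 : a0 <= a1.

Local Notation E a := ( expR (- alpha * (a - x0) ^+ 2) + expR (- alpha * (a + x0) ^+ 2)).

Lemma packet_saddle_estimate : exists2 C, 0 <= C & forall a w n,
  a0 <= a <= a1 -> 1 <= w -> n%:R = w * (a ^+ 2 + 1 / 4) ->
  cmod (cintegral (fun x => packet alpha x0 w n x%:C)) <=
  Num.sqrt 2 / Num.sqrt (1 + 4 * a ^+ 2) * E a *
    Num.sqrt (pi / (w * (8 * a / (1 + 4 * a ^+ 2)))) + C / (w * Num.sqrt w).
Proof.
have [C1 [j1 [k1 [C10 j10 k10 H1]]]] := half_line_bound x0 alpha0 a00 a01.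
have [C2 [j2 [k2 [C20 j20 k20 H2]]]] := half_line_bound (- x0) alpha0 a00 a01.
have [D1 D10 HD1] := expr_expR_bounded 2 k10.
have [D2 D20 HD2] := expr_expR_bounded 2 k20.
pose C := Num.sqrt 2 * C1 * Num.sqrt (pi / j1) + Num.sqrt 2 * C2 * Num.sqrt (pi / j2) +
  (C1 * D1 + C2 * D2) * Num.sqrt (pi / alpha).
have s20 : 0 <= Num.sqrt 2 :> R by exact: sqrtr_ge0.
have C0 : 0 <= C.
  rewrite addr_ge0// ?mulr_ge0 ?sqrtr_ge0//.
    by rewrite addr_ge0// mulr_ge0 ?sqrtr_ge0// mulr_ge0.
  by rewrite addr_ge0// mulr_ge0.
exists C => // a w n Pa w1 nE.
have w0 : 0 < w by exact: lt_le_trans w1.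
have /andP[aa0 aa1] := Pa; have ap : 0 < a by exact: lt_le_trans aa0.
have p4 : 0 < 1 + 4 * a ^+ 2 by rewrite ltr_wpDr// mulr_ge0// sqr_ge0.
pose kap := 8 * a / (1 + 4 * a ^+ 2).
have kap0 : 0 < kap by rewrite divr_gt0// mulr_gt0.
have [l1 [c1 /(_ w n w0 nE) [P1 Q1]]] := H1 a Pa.
have [l2 [c2 /(_ w n w0 nE) [P2 Q2]]] := H2 a Pa.
pose V := Num.sqrt 2 / Num.sqrt (1 + 4 * a ^+ 2).
have V0 : 0 <= V by rewrite divr_ge0// sqrtr_ge0.
have V2 : V <= Num.sqrt 2.
  rewrite /V ler_piMr// invf_le1 ?sqrtr_gt0// -[leLHS]sqrtr1 ler_wsqrtr// lerDl.
  by rewrite mulr_ge0// sqr_ge0.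
pose g1 := expR (- alpha * (a - x0) ^+ 2).
pose g2 := expR (- alpha * (a + x0) ^+ 2).
have g10 : 0 <= g1 by exact: expR_ge0.
have g20 : 0 <= g2 by exact: expR_ge0.
have g1le : g1 <= 1.
  by rewrite -[leRHS]expR0 ler_expR mulNr oppr_le0 mulr_ge0 ?sqr_ge0// ltW.
have g2le : g2 <= 1.
  by rewrite -[leRHS]expR0 ler_expR mulNr oppr_le0 mulr_ge0 ?sqr_ge0// ltW.
pose F x := V * g1 * laplace_dom kap j1 l1 c1 C1 w (x - a) +
  (V * g2 * laplace_dom kap j2 (- l2) (- c2) C2 w (x - - a) +
   (C1 * expR (- (k1 * w)) + C2 * expR (- (k2 * w))) * expR (- alpha * (x - x0) ^+ 2)).
have ub x : path_mod alpha x0 w n a x <= F x.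
  have e1 : 0 <= C1 * expR (- (k1 * w)) by rewrite mulr_ge0 ?expR_ge0.
  have e2 : 0 <= C2 * expR (- (k2 * w)) by rewrite mulr_ge0 ?expR_ge0.
  have e3 := expR_ge0 (- alpha * (x - x0) ^+ 2).
  have := mulr_ge0 e1 e3; have := mulr_ge0 e2 e3.
  have d1 := mulr_ge0 (mulr_ge0 V0 g10) (P1 (x - a)).
  have d2 := mulr_ge0 (mulr_ge0 V0 g20) (P2 (- (x - - a))).
  rewrite laplace_domN in d2.
  rewrite /F mulrDl => m1 m2.
  have [x_ge0|x_lt0] := lerP 0 x.
    apply: le_trans (Q1 x x_ge0) _; rewrite -/kap -/V -/g1 -/kap lerD2l.
    rewrite addrA; rewrite [leRHS]addrAC lerDr.
    exact: addr_ge0.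
  have nx : 0 <= - x by rewrite oppr_ge0 ltW.
  rewrite -[x in path_mod _ _ _ _ _ x]opprK path_modN.
  apply: le_trans (Q2 (- x) nx) _; rewrite -/kap -/V.
  rewrite (_ : (- x - - x0) ^+ 2 = (x - x0) ^+ 2); last by ring.
  rewrite (_ : - x - a = - (x - - a)); last by ring.
  rewrite opprK laplace_domN -/g2.
  set A2 := V * g2 * _ in d2 *; set B2 := C2 * _ * _ in m1 m2 *.
  set A1 := V * g1 * _ in d1 *; set B1 := C1 * _ * _ in m1 m2 *.
  by lra.
have I1 := lintegrable_laplace_dom l1 c1 C1 a kap0 j10 w0.
have I2 := lintegrable_laplace_dom (- l2) (- c2) C2 (- a) kap0 j20 w0.
have I3 := lintegrable_gauss x0 alpha0.
have J1 := lintegrableZ (V * g1) I1.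
have J2 := lintegrableZ (V * g2) I2.
have J3 := lintegrableZ (C1 * expR (- (k1 * w)) + C2 * expR (- (k2 * w))) I3.
have J23 := lintegrableD J2 J3.
have [-> If] := packet_path_shift w n ap.
have IF : lintegrable F by exact: lintegrableD J1 J23.
have := le_cmod_cintegral If IF.
move=> /(_ _)/le_trans; apply.
  by move=> x; rewrite cmod_packet_path.
rewrite /F RintegralD// RintegralD// !RintegralZl//.
rewrite !Rintegral_laplace_dom// Rintegral_gauss//.
have sw : 0 < Num.sqrt w by rewrite sqrtr_gt0.
have sj j : 0 < j -> Num.sqrt (pi / (w * j)) = Num.sqrt (pi / j) / Num.sqrt w.
  move=> j_gt0; rewrite -sqrtrV ?(ltW w0)// -sqrtrM ?divr_ge0 ?pi_ge0 ?(ltW j_gt0)//.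
  by rewrite invfM mulrA mulrAC.
rewrite (sj j1)// (sj j2)//.
have ww : w * Num.sqrt w <= w ^+ 2.
  rewrite expr2 ler_wpM2l ?(ltW w0)// -[leRHS]sqr_sqrtr ?(ltW w0)// expr2.
  by rewrite ler_peMr ?(ltW sw)// -[leLHS]sqrtr1 ler_wsqrtr.
have tail D k : 0 < k -> (forall v, 0 <= v -> v ^+ 2 * expR (- (k * v)) <= D) ->
    expR (- (k * w)) <= D / (w * Num.sqrt w).
  move=> k0 /(_ w (ltW w0)) h.
  rewrite ler_pdivlMr ?mulr_gt0//; apply: le_trans h.
  by rewrite mulrC ler_wpM2r ?expR_ge0.
have T1 := ler_wpM2l C10 (tail _ _ k10 HD1).
have T2 := ler_wpM2l C20 (tail _ _ k20 HD2).
have u1 : V * g1 * (C1 / w * (Num.sqrt (pi / j1) / Num.sqrt w)) <=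
    Num.sqrt 2 * C1 * Num.sqrt (pi / j1) / (w * Num.sqrt w).
  rewrite (_ : _ * (_ * _) = V * g1 * (C1 * Num.sqrt (pi / j1) / (w * Num.sqrt w))); last first.
    by rewrite invfM; ring.
  rewrite -[Num.sqrt 2 * C1 * _]mulrA -[leRHS]mulrA ler_wpM2r//.
    by rewrite divr_ge0 ?mulr_ge0 ?sqrtr_ge0 ?(ltW w0).
  by rewrite -[leRHS]mulr1 ler_pM.
have u2 : V * g2 * (C2 / w * (Num.sqrt (pi / j2) / Num.sqrt w)) <=
    Num.sqrt 2 * C2 * Num.sqrt (pi / j2) / (w * Num.sqrt w).
  rewrite (_ : _ * (_ * _) = V * g2 * (C2 * Num.sqrt (pi / j2) / (w * Num.sqrt w))); last first.
    by rewrite invfM; ring.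
  rewrite -[Num.sqrt 2 * C2 * _]mulrA -[leRHS]mulrA ler_wpM2r//.
    by rewrite divr_ge0 ?mulr_ge0 ?sqrtr_ge0 ?(ltW w0).
  by rewrite -[leRHS]mulr1 ler_pM.
have u3 : (C1 * expR (- (k1 * w)) + C2 * expR (- (k2 * w))) * Num.sqrt (pi / alpha) <=
    (C1 * D1 + C2 * D2) * Num.sqrt (pi / alpha) / (w * Num.sqrt w).
  rewrite [leRHS]mulrAC ler_wpM2r ?sqrtr_ge0// [leRHS]mulrDl.
  by rewrite -!mulrA; apply: lerD; rewrite ?mulrA -?mulrA.
rewrite -/kap -/V -/g1 -/g2; set s := Num.sqrt (pi / (w * kap)).
rewrite {1}/C 2![in leRHS]mulrDl.
have := lerD (lerD u1 u2) u3.
set r1 := Num.sqrt 2 * C1 * _ * _; set r2 := Num.sqrt 2 * C2 * _ * _; set r3 := _ * _ / _.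
by rewrite !mulrDr mulrDl; lra.
Qed.

Lemma coef_b_saddle_estimate : exists2 C, 0 <= C & forall a w (n : nat),
  a0 <= a <= a1 -> 1 <= w -> n%:R = w * (a ^+ 2 + 1 / 4) ->
  cmod (coef_b alpha x0 w n) <=
  (2 * Num.sqrt (2 * w) * Num.sqrt a)^-1 * E a + C / (w * Num.sqrt w).
Proof.
have [C C0 HC] := packet_saddle_estimate.
exists (2^-1 * Num.sqrt (2 / pi) * C); first by rewrite !mulr_ge0 ?sqrtr_ge0 ?invr_ge0.
move=> a w n Pa w1 nE; rewrite (cmod_coef_b_nat x0 alpha0).
have w0 : 0 < w by exact: lt_le_trans w1.
have /andP[aa0 aa1] := Pa; have ap : 0 < a by exact: lt_le_trans aa0.
have p4 : 0 < 1 + 4 * a ^+ 2 by rewrite ltr_wpDr// mulr_ge0// sqr_ge0.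
have c0 : 0 <= 2^-1 * Num.sqrt (2 / pi) :> R by rewrite mulr_ge0 ?sqrtr_ge0 ?invr_ge0.
apply: le_trans (ler_wpM2l c0 (HC a w n Pa w1 nE)) _.
rewrite mulrDr [X in _ + X <= _]mulrA lerD2r.
rewrite le_eqVlt; apply/orP; left; apply/eqP.
set V := Num.sqrt 2 / _; set S := Num.sqrt (pi / _).
rewrite (_ : _ * (V * E a * S) = 2^-1 * Num.sqrt (2 / pi) * (V * S) * E a); last by ring.
congr (_ * _); rewrite /V /S {V S}.
have p0 : 0 < pi :> R := pi_gt0 R.
set lhs := LHS; set rhs := RHS.
have l0 : 0 <= lhs by rewrite !mulr_ge0 ?sqrtr_ge0 ?invr_ge0 ?sqrtr_ge0.
have r0 : 0 <= rhs by rewrite invr_ge0 !mulr_ge0 ?sqrtr_ge0.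
apply/eqP; rewrite -(@eqrXn2 _ 2 _ _ isT l0 r0) /lhs /rhs {lhs rhs l0 r0}; apply/eqP.
rewrite exprVn !exprMn !exprVn !sqr_sqrtr ?divr_ge0 ?mulr_ge0 ?divr_ge0 ?mulr_ge0 ?(ltW p0) ?(ltW w0) ?(ltW ap) ?(ltW p4)//.
  move: (pi : R) p0 => p p0.
  by field; rewrite !gt_eqF.
by rewrite invr_ge0 ltW.
Qed.

End SaddlePoint.

Lemma saddle_bound_uniform (R : realType) (alpha x0 delta c : R) :
  0 < alpha -> 0 < delta -> 1 / 4 + delta < c ->
  exists C : R, forall w (n : nat), 1 <= w -> 1 / 4 + delta <= n%:R / w <= c ->
    exists2 e : R, `|e| <= C * w^-1 &
      cmod (coef_b alpha x0 w n) <= saddle_bound alpha x0 w n e.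
Proof.
move=> alpha0 delta0 dc; have dc' : delta <= c by lra.
have c0 : 0 < c by exact: lt_le_trans dc'.
have a00 : 0 < Num.sqrt delta by rewrite sqrtr_gt0.
have a01 : Num.sqrt delta <= Num.sqrt c by rewrite ler_wsqrtr.
have [C C0 HC] := coef_b_saddle_estimate x0 alpha0 a00 a01.
pose m := expR (- alpha * (Num.sqrt c + `|x0|) ^+ 2).
have m0 : 0 < m by exact: expR_gt0.
exists (2 * Num.sqrt 2 * Num.sqrt (Num.sqrt c) / m * C) => w n w1 /andP[r1 r2].
have w0 : 0 < w by exact: lt_le_trans w1.
pose r := n%:R / w - 1 / 4.
have rd : delta <= r by rewrite /r; lra.
have rc : r <= c by rewrite /r; lra.
have rp : 0 < r by exact: lt_le_trans rd.
pose a := Num.sqrt r; have ap : 0 < a by rewrite sqrtr_gt0.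
have Pa : Num.sqrt delta <= a <= Num.sqrt c by rewrite !ler_wsqrtr.
have nE : n%:R = w * (a ^+ 2 + 1 / 4).
  by rewrite sqr_sqrtr ?(ltW rp)// /r subrK mulrC divfK// gt_eqF.
have ra : r `^ (1 / 4) = Num.sqrt a.
  rewrite /a -!powR12_sqrt ?powR_ge0 ?(ltW rp)// -powRrM.
  by congr (_ `^ _); field.
pose E := expR (- alpha * (a - x0) ^+ 2) + expR (- alpha * (a + x0) ^+ 2).
have Em : m <= E.
  apply: (le_trans (y := expR (- alpha * (a - x0) ^+ 2))); last first.
    by rewrite lerDl expR_ge0.
  rewrite ler_expR !mulNr lerN2 ler_wpM2l ?(ltW alpha0)//.
  rewrite -real_normK ?num_real// lerXn2r ?nnegrE ?addr_ge0 ?sqrtr_ge0//.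
  rewrite (le_trans (ler_normB _ _))// lerD2r gtr0_norm//.
  by case/andP: Pa.
have E0 : 0 < E by exact: lt_le_trans Em.
pose M := 2 * Num.sqrt (2 * w) * Num.sqrt a.
have sa0 : 0 < Num.sqrt a by rewrite sqrtr_gt0.
have sw0 : 0 < Num.sqrt w by rewrite sqrtr_gt0.
have s20 : 0 < Num.sqrt 2 :> R by rewrite sqrtr_gt0.
have ME : M = 2 * Num.sqrt 2 * Num.sqrt w * Num.sqrt a by rewrite /M sqrtrM// mulrA.
have M0 : 0 < M by rewrite ME !mulr_gt0.
pose e := C / (w * Num.sqrt w) * M / E.
have e0 : 0 <= e.
  by apply: mulr_ge0; [apply: mulr_ge0; [apply: mulr_ge0|]|];
    rewrite ?invr_ge0 ?mulr_ge0 ?(ltW w0) ?(ltW sw0) ?(ltW M0) ?(ltW E0).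
exists e.
  rewrite ger0_norm// /e ME.
  rewrite (_ : _ / E = C * (2 * Num.sqrt 2) / w * (Num.sqrt a * E^-1)); last first.
    by field; rewrite !gt_eqF.
  rewrite (_ : _ * C * w^-1 = C * (2 * Num.sqrt 2) / w * (Num.sqrt (Num.sqrt c) * m^-1)); last by ring.
  apply: ler_wpM2l.
    by apply: mulr_ge0; [apply: mulr_ge0 => //; rewrite mulr_ge0// ltW|rewrite invr_ge0 ltW].
  apply: ler_pM; rewrite ?sqrtr_ge0 ?invr_ge0 ?(ltW E0)//.
    by rewrite ler_wsqrtr//; case/andP: Pa.
  by rewrite lef_pV2.
apply: le_trans (HC a w n Pa w1 nE) _.
rewrite /saddle_bound -/r ra -/a -/E -/M le_eqVlt; apply/orP; left; apply/eqP.
by rewrite /e; field; rewrite !gt_eqF.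
Qed.

Theorem theorem4p2 (R : realType) (alpha x0 : R) (halpha : 0 < alpha) :
  (forall (w : R) (n : int),
     cmod (coef_a alpha x0 w n)
       <= cmod (coef_b alpha x0 w n) + cmod (coef_b alpha x0 (- w) n))
  /\
  (forall (w : R) (n : int), 0 <= w -> n < 0 ->
     cmod (coef_b alpha x0 w n) <= exp_bound alpha w)
  /\
  (forall delta c : R, 0 < delta -> 1 / 4 + delta < c ->
     exists C : R, \forall w \near +oo, forall n : int, 0 <= n ->
       1 / 4 + delta <= n%:~R / w <= c ->
       exists2 e : R, `|e| <= C * w^-1 &
         cmod (coef_b alpha x0 w n) <= saddle_bound alpha x0 w n e)
  /\
  (forall (w : R) (n : int), 0 <= w -> 0 <= n ->
     cmod (coef_b alpha x0 (- w) n) <= exp_bound alpha w)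
  /\
  (forall delta c : R, 0 < delta -> 1 / 4 + delta < c ->
     exists C : R, \forall w \near +oo, forall n : int, n < 0 ->
       let m := - n - 1 in
       1 / 4 + delta <= m%:~R / w <= c ->
       exists2 e : R, `|e| <= C * w^-1 &
         cmod (coef_b alpha x0 (- w) n) <= saddle_bound alpha x0 w m e).
Proof.
split; [|split; [|split; [|split]]].
- by move=> w n; rewrite coef_aE// ler_cmodD.
- by move=> w [n|n] w0 // _; rewrite cmod_coef_b_neg//; exact: coef_b_exp_bound.
- move=> delta c delta0 dc.
  have [C HC] := saddle_bound_uniform x0 halpha delta0 dc.
  exists C; near=> w => -[n|n] // _ nw.
  by apply: HC => //; near: w; exact: nbhs_pinfty_ge.
- by move=> w [n|n] w0 // _; exact: coef_b_exp_bound.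
- move=> delta c delta0 dc.
  have [C HC] := saddle_bound_uniform x0 halpha delta0 dc.
  exists C; near=> w => -[n|n] // _.
  have -> : - Negz n - 1 = n by rewrite NegzE opprK -addn1 PoszD addrK.
  move=> nw; rewrite cmod_coef_b_neg// opprK.
  by apply: HC => //; near: w; exact: nbhs_pinfty_ge.
Unshelve. all: by end_near. Qed.
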